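(* Let $2\le k<n-1$ and let $K$ be a star body in $\mathbb{R}^n$. Then the radial function $\rho_K$ can be recovered from the volumes $v^{\pm}(\xi)=\mathrm{vol}_k(K\cap\xi_{\pm})$, where $\xi$ ranges only over those subspaces in $\mathfrak{M}$ that are not orthogonal to $e_n$. Explicitly, for $v\in S^{n-k-1}$ and $w\in S^k$, $w\neq\pm e_n$, let $$v^{\pm}_v(w)=\mathrm{vol}_k(K\cap\xi_{\pm}),\qquad \xi=\tilde\gamma_v(w^\perp\cap\mathbb{R}^{k+1}).$$ Then for every $v\in S^{n-k-1}$, $$\rho_K^k(\tilde\gamma_v\eta)=\begin{cases}2k\,(\tilde F^{-1}v^{+}_v)(\eta) & \text{if } \eta\in S^{k}_{+},\\ 2k\,(\tilde F^{-1}v^{-}_v)(\eta) & \text{if } \eta\in S^{k}_{-}.\end{cases}$$ Every $\theta=(\theta',\theta'')\in S^{n-1}$, $\theta'\in\mathbb{R}^{n-k}$, $\theta''\in\mathbb{R}^k$, with $\theta'\ne0$ equals $\tilde\gamma_v\eta$ for $v=\theta'/|\theta'|\in S^{n-k-1}$ and $\eta=(0,\ldots,0,|\theta'|,\theta'')\in S^k$; the values of $\rho_K$ at points with $\theta'=0$ or $\theta_n=0$ are determined by continuity.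
   Context: A star body is a compact set $K\subset\mathbb{R}^n$ that contains the origin as an interior point, is star-shaped with respect to the origin, and whose radial function $\rho_K(\theta)=\max\{r\ge0:\ r\theta\in K\}$, $\theta\in S^{n-1}$, is continuous. For a $k$-dimensional linear subspace $\xi$ of $\mathbb{R}^n$ not orthogonal to $e_n$ (i.e. $\xi\not\subset e_n^\perp$), $\xi_{\pm}=\xi\cap\{x\in\mathbb{R}^n:\ \pm x_n>0\}$. Let $e_1,\ldots,e_n$ be the standard basis of $\mathbb{R}^n$, and put $\mathbb{R}^{n-k}=\mathbb{R}e_1\oplus\cdots\oplus\mathbb{R}e_{n-k}$, $\mathbb{R}^k=\mathbb{R}e_{n-k+1}\oplus\cdots\oplus\mathbb{R}e_n$, $\mathbb{R}^{k+1}=\mathbb{R}e_{n-k}\oplus\mathbb{R}^k$, $S^{n-k-1}=S^{n-1}\cap\mathbb{R}^{n-k}$, $S^k=S^{n-1}\cap\mathbb{R}^{k+1}$, $S^k_{\pm}=\{\eta\in S^k:\ \pm\eta_n>0\}$. For each $v\in S^{n-k-1}$ fix an orthogonal transformation $\gamma_v$ of $\mathbb{R}^{n-k}$ with $\gamma_ve_{n-k}=v$, and let $\tilde\gamma_v=\begin{bmatrix}\gamma_v&0\\0&I_k\end{bmatrix}$, where $I_k$ is the $k\times k$ identity matrix. Then $\mathfrak{M}=\bigcup_{v\in S^{n-k-1}}G_k(\tilde\gamma_v\mathbb{R}^{k+1})$, where $G_k(\tilde\gamma_v\mathbb{R}^{k+1})$ is the set of all $k$-dimensional linear subspaces of $\tilde\gamma_v\mathbb{R}^{k+1}$;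 its elements are the subspaces $\tilde\gamma_v(w^\perp\cap\mathbb{R}^{k+1})$ with $v\in S^{n-k-1}$, $w\in S^k$. $\tilde F$ is the Funk transform on $S^k$: $(\tilde Fg)(w)=\int_{\{\eta\in S^k:\ \eta\cdot w=0\}}g(\eta)\,d_w\eta$, $w\in S^k$, with $d_w\eta$ the (unnormalized) $(k-1)$-dimensional surface element. It is a known fact that $\tilde F$ is injective on even functions in $L^1(S^k)$; $\tilde F^{-1}$ denotes the inverse of $\tilde F$ restricted to even functions in $L^1(S^k)$ (part of the assertion is that $v_v^{\pm}$ lie in the range). The representative of $\tilde F^{-1}v_v^{\pm}$ that is continuous on $S^k_{\pm}$ is used. *)

(* Defs.v *)
From HB Require Import structures.
From mathcomp Require Import all_boot all_order all_algebra.
From mathcomp Require Import all_classical all_reals all_analysis.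
From mathcomp Require Import measurable_realfun.

Set Implicit Arguments.
Unset Strict Implicit.
Unset Printing Implicit Defensive.

Import Order.TTheory GRing.Theory Num.Theory.
Import numFieldNormedType.Exports.

Local Open Scope classical_set_scope.
Local Open Scope ring_scope.

(** Points of R^n are row vectors ['rV[R]_n], so a linear map acts by
    multiplication on the right. A linear subspace is the row space of a
    matrix. The library norm [`|x|] on ['rV[R]_n] is the sup norm; the
    Euclidean norm is [enorm]. *)

Section Euclidean.
Context {R : realType}.
Implicit Types (n : nat).

Definition dotp n (x y : 'rV[R]_n) : R := \sum_i x 0 i * y 0 i.

Definition enorm n (x : 'rV[R]_n) : R := Num.sqrt (dotp x x).

Definition sphere {n} : set 'rV[R]_n := [set x | enorm x = 1].

(** [evec n i] is e_i with the 1-based numbering e_1, ..., e_n (it is 0 when i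
    is out of range). *)
Definition evec n (i : nat) : 'rV[R]_n := \row_(j < n) (j.+1 == i)%:R.

Definition rowset n (E : 'M[R]_n) : set 'rV[R]_n := [set x | (x <= E)%MS].

Definition orthc n (w : 'rV[R]_n) : 'M[R]_n := kermx w^T.

(** {x | x_n > 0} for [eps = false], {x | - x_n > 0} for [eps = true]. *)
Definition halfspace {n} (eps : bool) : set 'rV[R]_n :=
  [set x | 0 < (-1) ^+ eps * dotp x (evec n n)].

Definition orthogonal_mx n (A : 'M[R]_n) := A *m A^T = 1%:M.

(** Any orthonormal basis of the row space of E: none of what follows depends
    on which one is chosen, by orthogonal invariance of Lebesgue measure. *)
Definition orthobasis n (E : 'M[R]_n) : 'M[R]_(\rank E, n) :=
  get [set B : 'M[R]_(\rank E, n) | B *m B^T = 1%:M /\ (B == E)%MS].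

End Euclidean.

(** As for [n.-tuple] in the library, this is the product sigma-algebra, which
    on R^n is the Borel one. *)

Definition rV_display : measure_display. Proof. exact: default_measure_display. Qed.

Section measurable_rV.
Context {R : realType} (n : nat).

Let coor : 'I_n -> 'rV[R]_n -> R := fun i x => x 0 i.

Let rV_set0 : g_sigma_preimage coor set0.
Proof. exact: sigma_algebra0. Qed.

Let rV_setC A : g_sigma_preimage coor A -> g_sigma_preimage coor (~` A).
Proof. exact: sigma_algebraC. Qed.

Let rV_bigcup (F : _^nat) : (forall i, g_sigma_preimage coor (F i)) ->
  g_sigma_preimage coor (\bigcup_i (F i)).
Proof. exact: sigma_algebra_bigcup. Qed.

HB.instance Definition _ := @isMeasurable.Build rV_display
  'rV[R]_n (g_sigma_preimage coor) rV_set0 rV_setC rV_bigcup.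

End measurable_rV.

Section measurable_rV_lemmas.
Context {R : realType}.

Lemma measurable_coor n (i : 'I_n) :
  measurable_fun [set: 'rV[R]_n] (fun x : 'rV[R]_n => x 0 i).
Proof.
move=> _ Y mY; rewrite setTI; apply: sub_sigma_algebra => /=.
rewrite -bigcup_seq/=; exists i => /=; first by rewrite mem_index_enum.
by exists Y => //; rewrite setTI.
Qed.

Lemma measurable_fun_rV d (T : measurableType d) n (f : T -> 'rV[R]_n) :
  (forall i, measurable_fun [set: T] (fun x => f x 0 i)) ->
  measurable_fun [set: T] f.
Proof.
move=> mf _ A; rewrite setTI; move: A.
pose G := [set A : set 'rV[R]_n | measurable (f @^-1` A)].
suff mG : measurable `<=` G by move=> A /mG.
apply: (@smallest_sub _ _ _ G); first split.
- by rewrite /G/= preimage_set0.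
- by move=> A mA; rewrite /G/= setTD -preimage_setC; exact: measurableC.
- by move=> F mF; rewrite /G/= preimage_bigcup; exact: bigcupT_measurable.
- rewrite -bigcup_seq => _ [i _ [C mC <-]]; rewrite /G/= setTI.
  by rewrite -[X in measurable X]setTI; exact: mf.
Qed.

Lemma measurable_mulmxr p q (B : 'M[R]_(p, q)) :
  measurable_fun [set: 'rV[R]_p] (fun c : 'rV[R]_p => c *m B).
Proof.
apply: measurable_fun_rV => i; under eq_fun do rewrite mxE.
apply: measurable_sum => j; apply: measurable_funM => //.
exact: measurable_coor.
Qed.

Lemma measurable_enorm n : measurable_fun [set: 'rV[R]_n] (@enorm R n).
Proof.
apply: (@measurableT_comp _ _ _ _ _ _ (@Num.sqrt R)).
  by apply: continuous_measurable_fun; exact: sqrt_continuous.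
by apply: measurable_sum => j; apply: measurable_funM; exact: measurable_coor.
Qed.

Lemma measurable_normalize n :
  measurable_fun [set: 'rV[R]_n] (fun x : 'rV[R]_n => (enorm x)^-1 *: x).
Proof.
apply: measurable_fun_rV => i.
under eq_fun do rewrite mxE -powR_inv1 ?sqrtr_ge0//.
apply: measurable_funM; last exact: measurable_coor.
apply: (@measurableT_comp _ _ _ _ _ _ (@powR R ^~ (-1))).
  exact: measurable_powR.
exact: measurable_enorm.
Qed.

Lemma measurable_uball n :
  measurable [set x : 'rV[R]_n | 0 < enorm x <= 1].
Proof.
rewrite (_ : [set x | _] = @enorm R n @^-1` `]0, 1]%classic); last first.
  by apply/seteqP; split=> x /=; rewrite in_itv.
by rewrite -[X in measurable X]setTI; exact: measurable_enorm.
Qed.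

Definition consrV n (p : R * 'rV[R]_n) : 'rV[R]_n.+1 :=
  row_mx (p.1%:M : 'rV_1) p.2.

Lemma measurable_consrV n : measurable_fun [set: R * 'rV[R]_n] (@consrV n).
Proof.
apply: measurable_fun_rV => i.
have [j ->|j ->] := @split_ordP 1 n i.
- rewrite (_ : (fun _ => _) = fst); first exact: measurable_fst.
  by apply/funext => p; rewrite /consrV (@row_mxEl _ 1 1 n) ord1 mxE eqxx.
- rewrite (_ : (fun _ => _) = (fun x : 'rV[R]_n => x 0 j) \o snd).
    apply: measurableT_comp; [exact: measurable_coor|exact: measurable_snd].
  by apply/funext => p; rewrite /consrV (@row_mxEr _ 1 1 n).
Qed.

Lemma measurable_unconsrV n :
  measurable_fun [set: 'rV[R]_n.+1]
    (fun x : 'rV[R]_(1 + n) => (x 0 0, rsubmx x)).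
Proof.
apply/measurable_fun_pair; first exact: measurable_coor.
apply: measurable_fun_rV => i; under eq_fun do rewrite mxE.
exact: measurable_coor.
Qed.

End measurable_rV_lemmas.

Section lebesgue_cons.
Local Open Scope ereal_scope.
Context {R : realType} n (mu : {sigma_finite_measure set 'rV[R]_n -> \bar R}).

Definition lebesgue_cons : set 'rV[R]_n.+1 -> \bar R :=
  pushforward (@lebesgue_measure R \x mu) (@consrV R n).

Let lebesgue_cons0 : lebesgue_cons set0 = 0.
Proof. by rewrite /lebesgue_cons /pushforward preimage_set0 measure0. Qed.

Let lebesgue_cons_ge0 A : 0 <= lebesgue_cons A.
Proof. by rewrite /lebesgue_cons /pushforward; exact: measure_ge0. Qed.

Let lebesgue_cons_sigma_additive : semi_sigma_additive lebesgue_cons.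
Proof.
by apply: measure_semi_sigma_additive; exact: measurable_consrV.
Qed.

HB.instance Definition _ := isMeasure.Build _ _ _ lebesgue_cons
  lebesgue_cons0 lebesgue_cons_ge0 lebesgue_cons_sigma_additive.

Let lebesgue_cons_sigma_finite : sigma_finite setT lebesgue_cons.
Proof.
pose un (x : 'rV[R]_(1 + n)) : measurableTypeR R * 'rV[R]_n :=
  (x 0%R 0%R, rsubmx x).
have unK p : un (consrV p) = p.
  rewrite /un /consrV row_mxKr; case: p => a y /=; congr pair.
  by rewrite (_ : 0%R = @lshift 1 n 0%R) ?row_mxEl ?mxE ?eqxx//; exact/val_inj.
have /sigma_finiteP[F [TF ndF Foo]] := sigma_finiteT (@lebesgue_measure R).
have /sigma_finiteP[G [TG ndG Goo]] := sigma_finiteT mu.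
exists (fun i => un @^-1` (F i `*` G i)).
  apply/esym/seteqP; split=> // x _.
  have [i _ Fi] : (\bigcup_i F i) (un x).1 by rewrite -TF.
  have [j _ Gj] : (\bigcup_i G i) (un x).2 by rewrite -TG.
  exists (maxn i j) => //; split.
  - by move: Fi; apply/subsetPset/ndF/leq_maxl.
  - by move: Gj; apply/subsetPset/ndG/leq_maxr.
move=> i; have [mF Fioo] := Foo i; have [mG Gioo] := Goo i; split.
  rewrite -[X in measurable X]setTI; apply: measurable_unconsrV => //.
  exact: measurableX.
rewrite /lebesgue_cons /pushforward (_ : _ @^-1` _ = F i `*` G i).
  by rewrite product_measure1E// lte_mul_pinfty// ge0_fin_numE.
have FG p : (F i `*` G i) (un (consrV p)) <-> (F i `*` G i) p by rewrite unK.
by apply/seteqP; split=> p /FG.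
Qed.

HB.instance Definition _ := @Measure_isSigmaFinite.Build _ _ _
  lebesgue_cons lebesgue_cons_sigma_finite.

End lebesgue_cons.

(** n-dimensional Lebesgue measure: the point mass for n = 0, the product of
    1-dimensional and n-dimensional Lebesgue measure for n.+1. *)
Fixpoint lebesgue_rV {R : realType} (n : nat) :
    {sigma_finite_measure set 'rV[R]_n -> \bar R} :=
  match n with
  | 0%N => \d_(0 : 'rV[R]_0)
  | p.+1 => lebesgue_cons (lebesgue_rV p)
  end.

Section subspace_measures.
Local Open Scope ereal_scope.
Context {R : realType} n (E : 'M[R]_n).

(** vol_d on the row space of E, d being its dimension: Lebesgue measure
    transported by an orthonormal basis. *)
Definition vol : set 'rV[R]_n -> \bar R :=
  pushforward (lebesgue_rV (\rank E)) (fun c => c *m orthobasis E)%R.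

Let vol0 : vol set0 = 0.
Proof. by rewrite /vol /pushforward preimage_set0 measure0. Qed.

Let vol_ge0 A : 0 <= vol A.
Proof. by rewrite /vol /pushforward; exact: measure_ge0. Qed.

Let vol_sigma_additive : semi_sigma_additive vol.
Proof.
by apply: measure_semi_sigma_additive; exact: measurable_mulmxr.
Qed.

HB.instance Definition _ := isMeasure.Build _ _ _ vol
  vol0 vol_ge0 vol_sigma_additive.

(** The unnormalized (d-1)-dimensional surface measure on the unit sphere of
    the row space of E, d being its dimension, as the cone measure
    A |-> d * vol {x | 0 < |x| <= 1 and x / |x| \in A}. *)
Definition surface (A : set 'rV[R]_n) : \bar R :=
  (\rank E)%:R%:E * vol ([set x | A ((enorm x)^-1 *: x)%R] `&`
                         [set x | 0 < enorm x <= 1]%R).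

Let pf : {measure set 'rV[R]_n -> \bar R} :=
  measure_function_pushforward__canonical__measure_function_Measure
    (mrestr vol (@measurable_uball R n)) (@measurable_normalize R n).

Let surfaceE : surface = mscale ((\rank E)%:R%:nng)%R pf.
Proof. by []. Qed.

Let surface0 : surface set0 = 0.
Proof. by rewrite surfaceE measure0. Qed.

Let surface_ge0 A : 0 <= surface A.
Proof. by rewrite surfaceE measure_ge0. Qed.

Let surface_sigma_additive : semi_sigma_additive surface.
Proof. by rewrite surfaceE; exact: measure_semi_sigma_additive. Qed.

HB.instance Definition _ := isMeasure.Build _ _ _ surface
  surface0 surface_ge0 surface_sigma_additive.

End subspace_measures.

Section star_bodies.
Context {R : realType}.

(** The maximum of {r >= 0 | r theta \in K}; it is attained for compact K. *)
Definition radial n (K : set 'rV[R]_n) (theta : 'rV[R]_n) : R :=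
  sup [set r | 0 <= r /\ K (r *: theta)].

Definition star_body n (K : set 'rV[R]_n) :=
  [/\ compact K, K° 0,
      forall x t, K x -> 0 <= t <= 1 -> K (t *: x) &
      {within sphere, continuous (radial K)}].

(** vol_k (K `&` xi_+) for [eps = false], vol_k (K `&` xi_-) for [eps = true],
    where k is the dimension of xi. *)
Definition half_section n (K : set 'rV[R]_n) (eps : bool) (xi : 'M[R]_n) :=
  vol xi (K `&` (rowset xi `&` halfspace eps)).

Section funk.
Context n (E : 'M[R]_n).

Definition funk (g : 'rV[R]_n -> R) (w : 'rV[R]_n) : \bar R :=
  (\int[surface (E :&: orthc w)%MS]_(eta in
      sphere `&` rowset E `&` [set eta | dotp eta w = 0%R]) (g eta)%:E)%E.

(** [h] is a representative of the class of an even function [g] in L^1 such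
    that [funk g = phi] almost everywhere. *)
Definition funk_inverse (phi : 'rV[R]_n -> \bar R) (h : 'rV[R]_n -> R) :=
  exists g : 'rV[R]_n -> R,
    [/\ forall eta, (sphere `&` rowset E) eta -> g (- eta) = g eta,
        (surface E).-integrable (sphere `&` rowset E) (EFin \o g),
        {ae surface E, forall w, funk g w = phi w} &
        {ae surface E, forall eta, h eta = g eta}].

End funk.

(** From here on n = m + k, so that m is n - k, and a point of R^n is
    [row_mx theta' theta''] with theta' in R^m and theta'' in R^k. *)

Section family.
Context (m k : nat).

Definition Rk1 : 'M[R]_(m + k) :=
  (\sum_(m <= i < (m + k).+1) <<evec (m + k) i>>)%MS.

Definition Sk : set 'rV[R]_(m + k) := sphere `&` rowset Rk1.

Definition rotation_family (gamma : 'rV[R]_m -> 'M[R]_m) :=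
  forall v, sphere v ->
    orthogonal_mx (gamma v) /\ evec m m *m gamma v = v.

Context (gamma : 'rV[R]_m -> 'M[R]_m).

Definition tgamma (v : 'rV[R]_m) : 'M[R]_(m + k) :=
  block_mx (gamma v) 0 0 1%:M.

Definition frakM : set 'M[R]_(m + k) :=
  [set xi | exists v, [/\ sphere v, (xi <= Rk1 *m tgamma v)%MS &
                          \rank xi = k]].

Definition vfun (K : set 'rV[R]_(m + k)) (eps : bool) (v : 'rV[R]_m)
    (w : 'rV[R]_(m + k)) : \bar R :=
  half_section K eps ((orthc w :&: Rk1)%MS *m tgamma v).

End family.

End star_bodies.

Arguments Sk {R} m k _.

(* Main.v *)
Require Import Defs.
From mathcomp Require Import all_boot all_order all_algebra.
From mathcomp Require Import all_classical all_reals all_analysis.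
From mathcomp Require Import measurable_realfun ring lra.

Set Implicit Arguments.
Unset Strict Implicit.
Unset Printing Implicit Defensive.

Import Order.TTheory GRing.Theory Num.Theory.
Import numFieldNormedType.Exports.

Local Open Scope classical_set_scope.
Local Open Scope ring_scope.

(** Fix v and the sign +, and let E = R^{k+1}. Let f(eta) = rho_K^k(tgamma_v eta)
    on S^k_+, extended evenly by g0(eta) = (f(eta) + f(-eta)) / 2k, with f = 0
    off S^k_+. Polar coordinates in w^perp give vol_k(K n xi_+) = (Ft g0)(w), so
    g0 is an inverse Funk transform of v_v^+, and g0 = rho_K^k / 2k on S^k_+.

    For uniqueness, let F and G be nonnegative on S^k with the same Funk
    transform almost everywhere, extended to the shell 1/2 < |z| <= 1 as
    functions of degree 0. With R^{k+1} = R x R^k, the pole e_0 being the point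
    of interest, integrate over the hyperplanes z_0 = u . z' against the
    Gaussian weight e^{-t|u|^2} du. Exchanging the integrals gives
      int (F - G)(z) |z'|^{-1} e^{-tq} dz = 0,   q = z_0^2 / |z'|^2,   for t > 0.
    So all the moments of y = e^{-q}, hence all those of 1 - y, vanish against
    (F - G) |z'|^{-1} e^{-q} dz. High powers of 1 - y concentrate at the poles
    +-e_0, so F > G near +-e_0 is impossible, and so is F < G. Two even inverse
    Funk transforms therefore agree wherever both are continuous. *)

(** * Lebesgue measure on row vectors *)

(** The comparison has to be local, since the two inverses are continuous only on an open half
    sphere. As q is even in z_0, it does not tell e_0 from -e_0, so a sign of F - G is required near
    both poles; evenness of the two inverses carries the sign from one pole to the other. An
    arbitrary inverse g is signed and merely integrable, so its iterated integrals cannot be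
    exchanged directly. With g = g^+ - g^-, the pair F = g^+, G = g^- + g0 is nonnegative, has equal
    finite transforms for almost every normal, and F - G = g - g0; every exchange is then an
    instance of Tonelli's theorem. The factor |z'|^{-1} blows up on the axis z' = 0 and at the
    origin. The shell removes the origin, and for t >= 1 the factor e^{-tq} beats |z'|^{-1} near the
    axis. The weight is therefore bounded, and t = 1 + j, j = 0, 1, ..., yields the moments of y
    against one fixed integrable function. Equality of transforms holds only for almost every
    normal, so null sets of the sphere must also be null in the slope u of the hyperplane. *)

Section affine1.
Local Open Scope ereal_scope.
Context {R : realType}.
Local Notation mu := (@lebesgue_measure R).

Let aff (a b : R) : measurableTypeR R -> measurableTypeR R :=
  fun x => (a * x + b)%R.

Let measurable_aff a b : measurable_fun setT (aff a b).
Proof. by apply: measurable_funD => //; exact: mulrl_measurable. Qed.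

(** Lebesgue measure is determined by its values on half-open intervals. For [a < 0] the preimage is
    half open on the other side, which does not change its length. *)
Let lebesgue_measure_aff (a b : R) (A : set R) : a != 0%R -> measurable A ->
  `|a|%:E * pushforward mu (aff a b) A = mu A.
Proof.
move=> a0 mA.
pose nu : {measure set _ -> \bar R} := mscale (NngNum (normr_ge0 a))
  (measure_function_pushforward__canonical__measure_function_Measure
     mu (@measurable_aff a b)).
rewrite -[LHS]/(nu A); apply/esym/lebesgue_measure_unique => //= _ [[c d]] _ <-.
rewrite /nu /mscale/= /pushforward lebesgue_measure_itv/= lte_fin.
have [a_gt0|a_lt0|] := ltgtP 0%R a; last by move=> a00; rewrite -a00 eqxx in a0.
- rewrite (_ : _ @^-1` _ = `](c - b) / a, (d - b) / a]%classic)%R; last first.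
    apply/seteqP; split=> x; rewrite /aff/= !in_itv/= ltr_pdivrMr// ler_pdivlMr//;
    by rewrite ltrBlDr lerBrDr mulrC.
  rewrite lebesgue_measure_itv/= lte_fin ltr_pM2r ?invr_gt0// ltrD2r.
  case: ifP => _; last by rewrite mule0.
  by rewrite gtr0_norm// -!EFinB -EFinM; congr EFin; field.
- rewrite (_ : _ @^-1` _ = `[(d - b) / a, (c - b) / a[%classic)%R; last first.
    apply/seteqP; split=> x; rewrite /aff/= !in_itv/= ltr_ndivlMr// ler_ndivrMr//;
    by rewrite ltrBlDr lerBrDr mulrC andbC.
  rewrite lebesgue_measure_itv/= lte_fin ltr_nM2r ?invr_lt0// ltrD2r.
  case: ifP => _; last by rewrite mule0.
  by rewrite ltr0_norm// -!EFinB -EFinM; congr EFin; field.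
Qed.

Lemma ge0_integral_affine (a b : R) (f : R -> \bar R) : a != 0%R ->
  measurable_fun setT f -> (forall x, 0 <= f x) ->
  \int[mu]_x f x = `|a|%:E * \int[mu]_x f (a * x + b)%R.
Proof.
move=> a0 mf f0.
pose pf : {measure set _ -> \bar R} :=
  (measure_function_pushforward__canonical__measure_function_Measure
     mu (@measurable_aff a b)).
transitivity (\int[mscale (NngNum (normr_ge0 a)) pf]_x f x).
  apply: eq_measure_integral => A mA _.
  by apply/esym; exact: (@lebesgue_measure_aff a b).
by rewrite ge0_integral_mscale// ge0_integral_pushforward.
Qed.

End affine1.

Section lebesgue_rV_integral.
Local Open Scope ereal_scope.
Context {R : realType}.
Local Notation mu := (@lebesgue_measure R).
Local Notation lam n := (@lebesgue_rV R n).

(* [measurable_consrV] uses the default display on [R], [lebesgue_measure] the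
   one of [measurableTypeR R]: the sigma-algebras are the same. *)
Lemma measurable_consrVR n :
  measurable_fun [set: measurableTypeR R * 'rV[R]_n] (@consrV R n).
Proof. exact: measurable_consrV. Qed.

Lemma ge0_integral_rVS n (f : 'rV[R]_n.+1 -> \bar R) :
  measurable_fun setT f -> (forall x, 0 <= f x) ->
  \int[lam n.+1]_x f x = \int[mu]_s \int[lam n]_x f (consrV (s, x)).
Proof.
move=> mf f0.
rewrite -(@fubini_tonelli1 _ _ _ _ _ mu (lam n) (fun p => f (consrV p)))//; last first.
  by apply: measurableT_comp mf _; exact: measurable_consrVR.
have f1 : {in [set: 'rV[R]_n.+1], forall x, 0 <= f x} by move=> x _; exact: f0.
have := ge0_integral_pushforward (@measurable_consrVR n) (mu \x lam n)%E measurableT mf f1.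
rewrite preimage_setT => <-; apply: eq_measure_integral; first exact: measurable_consrVR.
by [].
Qed.

Lemma consrVZD n (a : R) (s b : R) (x v : 'rV[R]_n) :
  (a *: consrV (s, x) + consrV (b, v) = consrV (a * s + b, a *: x + v))%R.
Proof.
by rewrite /consrV/= (@scale_row_mx _ 1 1 n) (@add_row_mx _ 1 1 n) scale_scalar_mx -raddfD.
Qed.

Lemma consrV_eta n (x : 'rV[R]_(1 + n)) : consrV (x 0%R 0%R, rsubmx x) = x.
Proof.
rewrite /consrV/= (_ : (x 0 0)%:M = lsubmx x)%R ?hsubmxK//.
by apply/matrixP => i j; rewrite !ord1 !mxE; congr (x _ _); apply: val_inj.
Qed.

Lemma consrV_head n (s : R) (x : 'rV[R]_n) : consrV (s, x) 0%R 0%R = s.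
Proof.
rewrite /consrV (_ : (0 : 'I_(1 + n)) = @lshift 1 n 0)%R; last exact/val_inj.
by rewrite (@row_mxEl _ 1 1 n) mxE eqxx mulr1n.
Qed.

Lemma rsubmx_consrV n (s : R) (x : 'rV[R]_n) :
  rsubmx (consrV (s, x) : 'rV_(1 + n)) = x.
Proof. by rewrite /consrV row_mxKr. Qed.

Lemma measurable_affine_rV n (a : R) (v : 'rV[R]_n) :
  measurable_fun setT (fun x : 'rV[R]_n => a *: x + v)%R.
Proof.
apply: measurable_fun_rV => i; under eq_fun do rewrite !mxE.
apply: measurable_funD => //.
by apply: measurable_funM => //; exact: measurable_coor.
Qed.

Lemma measurable_consrV2 n s : measurable_fun setT (fun x : 'rV[R]_n => consrV (s, x)).
Proof. by apply: measurableT_comp; [exact: measurable_consrV|exact: pair1_measurable]. Qed.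

(** Induction on [n] by Tonelli: the head coordinate contributes one factor [|a|], the tail the
    remaining ones. *)
Lemma ge0_integral_rV_affine n (a : R) (v : 'rV[R]_n) (f : 'rV[R]_n -> \bar R) :
  a != 0%R -> measurable_fun setT f -> (forall x, 0 <= f x) ->
  \int[lam n]_x f x = (`|a| ^+ n)%:E * \int[lam n]_x f (a *: x + v)%R.
Proof.
move=> a0; elim: n v f => [|n IH] v f mf f0.
  rewrite expr0 mul1e; apply: eq_integral => x _; congr f.
  by rewrite [LHS]thinmx0 [RHS]thinmx0.
rewrite !ge0_integral_rVS//; last first.
  by apply: measurableT_comp mf _; exact: measurable_affine_rV.
pose b := (v : 'rV_(1 + n)) 0%R 0%R; pose w := rsubmx (v : 'rV_(1 + n)).
have vE : v = consrV (b, w) by rewrite /b /w consrV_eta.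
pose F s := \int[lam n]_x f (consrV (s, x)).
have mF : measurable_fun setT F.
  apply: (@measurable_fun_fubini_tonelli_F _ _ (measurableTypeR R) _ _ (lam n)
    (fun p => f (consrV p))) => //.
  by apply: measurableT_comp mf _; exact: measurable_consrVR.
have F0 s : 0 <= F s by exact: integral_ge0.
rewrite -/(F _) (ge0_integral_affine b a0 mF F0).
rewrite exprS EFinM -muleA; congr (_ * _).
rewrite -ge0_integralZl_EFin//; last 2 first.
- by move=> s _; apply: integral_ge0.
- apply: (@measurable_fun_fubini_tonelli_F _ _ (measurableTypeR R) _ _ (lam n)
    (fun p => f (a *: consrV p + v)%R)) => //.
  apply: measurableT_comp mf _.
  apply: (measurableT_comp (measurable_affine_rV a v)).
  exact: measurable_consrVR.
apply: eq_integral => s _; rewrite /F (IH w)//; last first.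
  by apply: measurableT_comp mf _; exact: measurable_consrV2.
by congr (_ * _); apply: eq_integral => x _; rewrite vE consrVZD.
Qed.

(* Tonelli on f(x) g(yP - x): integrating y first (translation) or x first
   (reflection) evaluates the double integral in two ways. *)
Lemma ge0_integral_rV_mulmx_swap n (P : 'M[R]_n) (f g : 'rV[R]_n -> \bar R) :
  P \in unitmx ->
  measurable_fun setT f -> (forall x, 0 <= f x) ->
  measurable_fun setT g -> (forall x, 0 <= g x) ->
  (\int[lam n]_x f x) * (\int[lam n]_x g (x *m P)) =
  (\int[lam n]_x g x) * (\int[lam n]_x f (x *m P)).
Proof.
move=> Pu mf f0 mg g0.
have mP (h : 'rV[R]_n -> \bar R) : measurable_fun setT h ->
    measurable_fun setT (fun x => h (x *m P)).
  by move=> mh; apply: measurableT_comp mh _; exact: measurable_mulmxr.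
have msub : measurable_fun setT (fun p : 'rV[R]_n * 'rV[R]_n => p.2 *m P - p.1)%R.
  apply: measurable_fun_rV => i; under eq_fun do rewrite !mxE.
  apply: measurable_funB; last first.
    by apply: (measurableT_comp (measurable_coor i)); exact: measurable_fst.
  apply: measurable_sum => j; apply: measurable_funM => //.
  by apply: (measurableT_comp (measurable_coor j)); exact: measurable_snd.
pose H (p : 'rV[R]_n * 'rV[R]_n) := f p.1 * g (p.2 *m P - p.1)%R.
have mH : measurable_fun setT H.
  apply: emeasurable_funM; first by apply: measurableT_comp mf _; exact: measurable_fst.
  exact: measurableT_comp mg _.
have H0 p : 0 <= H p by exact: mule_ge0.
have := @fubini_tonelli _ _ _ _ _ (lam n) (lam n) H mH H0.
rewrite /H/= => E.
have mm (v : 'rV[R]_n) : measurable_fun setT (fun x : 'rV[R]_n => v - x)%R.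
  rewrite (_ : (fun _ => _) = fun x => (-1 *: x + v)%R); last first.
    by apply/funext => x; rewrite scaleN1r addrC.
  exact: measurable_affine_rV.
have mp (v : 'rV[R]_n) : measurable_fun setT (fun x : 'rV[R]_n => x *m P - v)%R.
  have mT : measurable_fun setT (fun x : 'rV[R]_n => x - v)%R.
    rewrite (_ : (fun _ => _) = fun x => (1 *: x + - v)%R); last first.
      by apply/funext => x; rewrite scale1r.
    exact: measurable_affine_rV.
  exact: measurableT_comp mT (measurable_mulmxr P).
have tr (h : 'rV[R]_n -> \bar R) x : measurable_fun setT h -> (forall x, 0 <= h x) ->
    \int[lam n]_y h (y *m P - x)%R = \int[lam n]_y h (y *m P).
  move=> mh h0; have mhP := mP _ mh.
  have hP0 y : 0 <= h (y *m P) by [].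
  apply/esym; apply: etrans
    (ge0_integral_rV_affine (- (x *m invmx P))%R (oner_neq0 _) mhP hP0) _.
  rewrite normr1 expr1n mul1e; apply: eq_integral => y _.
  by rewrite scale1r mulmxBl mulmxKV.
have L : \int[lam n]_x \int[lam n]_y (f x * g (y *m P - x)%R) =
         (\int[lam n]_x f x) * (\int[lam n]_x g (x *m P)).
  have Ig : 0 <= \int[lam n]_x g (x *m P) by apply: integral_ge0.
  apply: etrans (ge0_integralZr (lam n) measurableT mf (fun x _ => f0 x) Ig).
  apply: eq_integral => x _; rewrite -(tr _ x mg g0).
  have mgx := measurableT_comp mg (mp x).
  exact: (ge0_integralZl (lam n) measurableT mgx (fun y _ => g0 _) (f0 x)).
have refl y : \int[lam n]_x (f x * g (y *m P - x)%R) =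
    \int[lam n]_x (g x * f (y *m P - x)%R).
  have mfg : measurable_fun setT (fun x => f x * g (y *m P - x)%R).
    by apply: emeasurable_funM mf _; exact: measurableT_comp mg (mm (y *m P)%R).
  have fg0 x : 0 <= f x * g (y *m P - x)%R by apply: mule_ge0.
  have N1 : (-1 != 0 :> R)%R by rewrite oppr_eq0 oner_neq0.
  apply: etrans (ge0_integral_rV_affine (y *m P)%R N1 mfg fg0) _.
  rewrite normrN normr1 expr1n mul1e; apply: eq_integral => x _.
  by rewrite scaleN1r [(- x + _)%R]addrC opprB addrCA subrr addr0 muleC.
have Rr : \int[lam n]_y \int[lam n]_x (f x * g (y *m P - x)%R) =
         (\int[lam n]_x g x) * (\int[lam n]_x f (x *m P)).
  under eq_integral do rewrite refl.
  have If : 0 <= \int[lam n]_x f (x *m P) by apply: integral_ge0.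
  apply: etrans (ge0_integralZr (lam n) measurableT mg (fun x _ => g0 x) If).
  pose H' (p : 'rV[R]_n * 'rV[R]_n) := g p.1 * f (p.2 *m P - p.1)%R.
  have mH' : measurable_fun setT H'.
    apply: emeasurable_funM; first by apply: measurableT_comp mg _; exact: measurable_fst.
    exact: measurableT_comp mf _.
  have H'0 p : 0 <= H' p by exact: mule_ge0.
  apply: etrans (esym (@fubini_tonelli _ _ _ _ _ (lam n) (lam n) H' mH' H'0)) _.
  apply: eq_integral => x _; rewrite -(tr _ x mf f0).
  have mfx := measurableT_comp mf (mp x).
  exact: (ge0_integralZl (lam n) measurableT mfx (fun y _ => f0 _) (g0 x)).
by rewrite -L -Rr.
Qed.

End lebesgue_rV_integral.

Section enorm_lemmas.
Context {R : realType}.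

Lemma dotpE n (x y : 'rV[R]_n) : dotp x y = (x *m y^T) 0 0.
Proof. by rewrite mxE; apply: eq_bigr => i _; rewrite mxE. Qed.

Lemma dotpxx_ge0 n (x : 'rV[R]_n) : 0 <= dotp x x.
Proof. by apply: sumr_ge0 => i _; rewrite -expr2 sqr_ge0. Qed.

Lemma enorm_ge0 n (x : 'rV[R]_n) : 0 <= enorm x.
Proof. exact: sqrtr_ge0. Qed.

Lemma sqr_enorm n (x : 'rV[R]_n) : enorm x ^+ 2 = dotp x x.
Proof. by rewrite /enorm sqr_sqrtr ?dotpxx_ge0. Qed.

Lemma dotpZl n (a : R) (x y : 'rV[R]_n) : dotp (a *: x) y = a * dotp x y.
Proof. by rewrite !dotpE -scalemxAl mxE. Qed.

Lemma dotpC n (x y : 'rV[R]_n) : dotp x y = dotp y x.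
Proof. by apply: eq_bigr => i _; rewrite mulrC. Qed.

Lemma dotpZr n (a : R) (x y : 'rV[R]_n) : dotp x (a *: y) = a * dotp x y.
Proof. by rewrite dotpC dotpZl dotpC. Qed.

Lemma enormZ n (a : R) (x : 'rV[R]_n) : enorm (a *: x) = `|a| * enorm x.
Proof.
by rewrite /enorm dotpZl dotpZr mulrA -expr2 sqrtrM ?sqr_ge0// sqrtr_sqr.
Qed.

Lemma enorm0 n : enorm (0 : 'rV[R]_n) = 0.
Proof. by rewrite -(scale0r (0 : 'rV[R]_n)) enormZ normr0 mul0r. Qed.

Lemma ler_norm_enorm n (x : 'rV[R]_n) i : `|x 0 i| <= enorm x.
Proof.
rewrite -sqrtr_sqr ler_sqrt ?dotpxx_ge0// /dotp (bigD1 i)//= expr2 lerDl.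
by apply: sumr_ge0 => j _; rewrite -expr2 sqr_ge0.
Qed.

Lemma enorm_eq0 n (x : 'rV[R]_n) : (enorm x == 0) = (x == 0).
Proof.
apply/eqP/eqP => [x0|->]; last exact: enorm0.
apply/rowP => i; rewrite mxE; apply/eqP; rewrite -normr_le0 -x0.
exact: ler_norm_enorm.
Qed.

Lemma enorm_gt0 n (x : 'rV[R]_n) : (0 < enorm x) = (x != 0).
Proof. by rewrite lt0r enorm_eq0 enorm_ge0 andbT. Qed.

Lemma dotp_mulmx m n (B : 'M[R]_(m, n)) (x y : 'rV[R]_m) : B *m B^T = 1%:M ->
  dotp (x *m B) (y *m B) = dotp x y.
Proof. by move=> BB; rewrite !dotpE trmx_mul mulmxA -(mulmxA x) BB mulmx1. Qed.

Lemma enorm_mulmx m n (B : 'M[R]_(m, n)) (x : 'rV[R]_m) : B *m B^T = 1%:M ->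
  enorm (x *m B) = enorm x.
Proof. by move=> BB; rewrite /enorm dotp_mulmx. Qed.

End enorm_lemmas.

Section change_of_variables.
Local Open Scope ereal_scope.
Context {R : realType}.
Local Notation mu := (@lebesgue_measure R).
Local Notation lam n := (@lebesgue_rV R n).

(** Closed ball of the sup norm. Its explicit volume makes it the test set for finiteness and
    positivity; radius 0 gives the origin. *)
Definition cube n (r : R) : set 'rV[R]_n := [set x | forall i, `|x 0 i| <= r]%R.

Lemma measurable_cube n r : measurable (@cube n r).
Proof.
rewrite (_ : cube r = \bigcap_(i : 'I_n) ((fun x => `|x 0 i|)%R @^-1` `]-oo, r])).
  apply: fin_bigcap_measurable => // i _; rewrite -[X in measurable X]setTI.
  by apply: (measurableT_comp (@normr_measurable R setT) (measurable_coor i)).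
by apply/seteqP; split=> x /= xr i; [move=> _; rewrite /= in_itv/=; exact: xr|
  have := xr i I; rewrite /= in_itv].
Qed.

Lemma lebesgue_rV_cube n r : (0 <= r)%R -> lam n (@cube n r) = ((2 * r) ^+ n)%:E.
Proof.
move=> r0; elim: n => [|n IH].
  rewrite /= diracE mem_set// => i; by case: i.
have -> : lam n.+1 (@cube n.+1 r) =
    (mu \x lam n) (`[(- r)%R, r]%classic `*` @cube n r).
  congr (product_measure1 _ _ _); apply/seteqP; split => -[s x].
    move=> /= c; split.
      by have := c 0%R; rewrite consrV_head/= in_itv/= ler_norml.
    move=> i; have := c (@rshift 1 n i).
    by rewrite /consrV (@row_mxEr _ 1 1 n).
  move=> [/= s1 c] i; have [j ->|j ->] := @split_ordP 1 n i.
    by rewrite /consrV (@row_mxEl _ 1 1 n) ord1 mxE eqxx mulr1n ler_norml; move: s1; rewrite in_itv.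
  by rewrite /consrV (@row_mxEr _ 1 1 n); exact: c.
rewrite product_measure1E//; last exact: measurable_cube.
rewrite IH /= lebesgue_measure_itv/= lte_fin exprS EFinM; congr (_ * _).
by case: ifPn => rr; [rewrite -EFinB|]; congr EFin; lra.
Qed.

Lemma measurable_EFin_indic d (T : measurableType d) (A : set T) : measurable A ->
  measurable_fun setT (fun x => (\1_A x : R)%:E).
Proof. by move=> mA; apply/measurable_EFinP; exact: measurable_indic. Qed.

(** In the swap identity take for [g] the indicator of the unit cube: this gives [c = w / 2 ^+ n].
    Taking also [f = g o P^-1] gives [w' w = 2^n 2^n], which excludes [w = 0] and [w = +oo]. Later
    only the existence of a positive constant is used, so no determinant enters. *)
Lemma ge0_integral_rV_unitmx n (P : 'M[R]_n) : P \in unitmx ->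
  exists2 c : R, (0 < c)%R &
    forall f, measurable_fun setT f -> (forall x, 0 <= f x) ->
      \int[lam n]_x f (x *m P) = c%:E * \int[lam n]_x f x.
Proof.
move=> Pu; pose g x := (\1_(@cube n 1) x : R)%:E.
have mg : measurable_fun setT g by apply: measurable_EFin_indic; exact: measurable_cube.
have g0 x : 0 <= g x by rewrite lee_fin.
have Ig : \int[lam n]_x g x = (2 ^+ n)%:E.
  by rewrite integral_indic//= ?setIT ?lebesgue_rV_cube ?mulr1//; exact: measurable_cube.
pose w := \int[lam n]_x g (x *m P).
have w0 : 0 <= w by apply: integral_ge0.
have V0 : (0 < 2 ^+ n :> R)%R by rewrite exprn_gt0.
have Vfin (f : 'rV[R]_n -> \bar R) : measurable_fun setT f -> (forall x, 0 <= f x) ->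
    (\int[lam n]_x f x) * w = (2 ^+ n)%:E * \int[lam n]_x f (x *m P).
  move=> mf f0; rewrite -Ig; exact: ge0_integral_rV_mulmx_swap.
have := Vfin (fun x => g (x *m invmx P))
  (measurableT_comp mg (measurable_mulmxr _)) (fun x => g0 _).
rewrite (_ : \int[lam n]_x g (x *m P *m invmx P) = (2 ^+ n)%:E); last first.
  by rewrite -Ig; apply: eq_integral => x _; rewrite mulmxK.
have : 0 <= \int[lam n]_x g (x *m invmx P) by apply: integral_ge0.
have VV0 : 0 < (2 ^+ n)%:E * (2 ^+ n)%:E :> \bar R by rewrite -EFinM lte_fin mulr_gt0.
move: (\int[lam n]_x g (x *m invmx P)) w w0 Vfin => w' w w0 Vfin w'0 ww'.
have w_gt0 : 0 < w.
  rewrite lt0e w0 andbT; apply/eqP => w00; move: VV0; rewrite -ww' w00 mule0.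
  by rewrite ltxx.
have w'_gt0 : 0 < w'.
  rewrite lt0e w'0 andbT; apply/eqP => w00; move: VV0; rewrite -ww' w00 mul0e.
  by rewrite ltxx.
case: w w_gt0 Vfin {w0} ww' => [w|_|//]; last first.
  by move=> _; rewrite gt0_muley.
rewrite lte_fin => w_gt0 Vfin _; exists (w / 2 ^+ n)%R; first by rewrite divr_gt0.
move=> f mf f0; rewrite mulrC EFinM -muleA [w%:E * _]muleC Vfin// muleA -EFinM.
by rewrite mulVf ?gt_eqF// mul1e.
Qed.

(** The Euclidean unit ball is invariant under [P] and has positive finite measure, so the constant
    of proportionality is 1. *)
Lemma ge0_integral_rV_orthogonal n (P : 'M[R]_n) (f : 'rV[R]_n -> \bar R) :
  orthogonal_mx P -> measurable_fun setT f -> (forall x, 0 <= f x) ->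
  \int[lam n]_x f (x *m P) = \int[lam n]_x f x.
Proof.
move=> oP mf f0; have [Pu _] := mulmx1_unit oP.
have [c c0 cP] := ge0_integral_rV_unitmx Pu.
rewrite cP// (_ : c = 1%R) ?mul1e//.
pose B := [set x : 'rV[R]_n | enorm x <= 1]%R.
have mB : measurable B.
  rewrite (_ : B = enorm (n := n) @^-1` `]-oo, 1%R]); last first.
    by apply/seteqP; split=> x /=; rewrite in_itv.
  by rewrite -[X in measurable X]setTI; exact: measurable_enorm.
have Bfin : lam n B < +oo.
  apply: (@le_lt_trans _ _ (lam n (@cube n 1))).
    apply: le_measure; rewrite ?inE//; first exact: measurable_cube.
    by move=> x Bx i; exact: le_trans (ler_norm_enorm x i) Bx.
  by rewrite lebesgue_rV_cube ?ltry.
have B0 : 0 < lam n B.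
  (* On this cube the squared norm is at most [n r^2 <= n r <= 1]; [n.+1] instead of [n] covers
     dimension 0. *)
  pose r := (n.+1%:R^-1 : R)%R.
  have r0 : (0 < r)%R by rewrite invr_gt0 ltr0n.
  have r1 : (r <= 1)%R by rewrite invf_le1 ?ler1n// ltr0n.
  apply: (@lt_le_trans _ _ (lam n (@cube n r))).
    by rewrite lebesgue_rV_cube ?lte_fin ?exprn_gt0 ?mulr_gt0 ?ltW.
  apply: le_measure; rewrite ?inE//; first exact: measurable_cube.
  move=> x c1; rewrite /B/= -(ler_pXn2r (n := 2))// ?nnegrE ?enorm_ge0// sqr_enorm expr1n.
  apply: (@le_trans _ _ (\sum_(i < n) r)%R).
    apply: ler_sum => i _; rewrite -expr2 -real_normK ?num_real//.
    by rewrite expr2 (le_trans (ler_pM _ _ (c1 i) (c1 i)))// ger_pMl.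
  by rewrite sumr_const card_ord -mulr_natl ler_pdivrMr ?ltr0n// mul1r ler_nat.
pose h x : \bar R := (\1_B x)%:E.
have h0 x : 0 <= h x by rewrite lee_fin.
have hP : \int[lam n]_x h (x *m P) = \int[lam n]_x h x.
  apply: eq_integral => x _; rewrite /h !indicE; congr ((nat_of_bool _)%:R)%:E.
  by apply/idP/idP => /set_mem b1; apply/mem_set; move: b1; rewrite /B/= enorm_mulmx.
have := cP h (measurable_EFin_indic mB) h0.
rewrite hP {hP} integral_indic//= setIT.
move: (lam n B) B0 Bfin => [b||]//; rewrite lte_fin => b0 _.
rewrite -EFinM => -[bE]; apply: (mulIf (lt0r_neq0 b0)).
by rewrite mul1r [RHS]bE.
Qed.

End change_of_variables.

(** * Orthonormal bases *)

Section orthonormal_bases.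
Context {R : realType}.

(** The number [m] of rows is free, whereas [orthobasis E] has [\rank E] rows by type: a basis of
    known size needs no cast. *)
Definition orthonormal_basis m n (E : 'M[R]_n) (B : 'M[R]_(m, n)) :=
  B *m B^T = 1%:M /\ (B == E)%MS.

Lemma orthonormal_basis_rank m n (E : 'M[R]_n) (B : 'M[R]_(m, n)) :
  orthonormal_basis E B -> \rank E = m.
Proof.
move=> [BB /eqmxP BE]; apply/eqP; rewrite -BE eqn_leq rank_leq_row/=.
by rewrite -{1}(@mxrank1 R m) -BB mxrankM_maxl.
Qed.

Lemma sub_orthcE n (x w : 'rV[R]_n) : (x <= orthc w)%MS = (dotp x w == 0).
Proof.
rewrite sub_kermx dotpE; apply/eqP/eqP => [->|xw]; first by rewrite mxE.
by apply/matrixP => i j; rewrite !ord1 xw mxE.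
Qed.

Lemma orthcP m n (A : 'M[R]_(m, n)) w : reflect (A *m w^T = 0) (A <= orthc w)%MS.
Proof. by rewrite sub_kermx; exact: eqP. Qed.

Lemma orthonormal_basis_cons r n (E : 'M[R]_n) (z : 'rV[R]_n) (B : 'M[R]_(r, n)) :
  (z <= E)%MS -> enorm z = 1 -> orthonormal_basis (E :&: orthc z)%MS B ->
  orthonormal_basis E (col_mx z B).
Proof.
move=> zE z1 [BB /eqmxP BE].
have zz : z *m z^T = 1%:M.
  by apply/matrixP => i j; rewrite !ord1 -dotpE -sqr_enorm z1 expr1n mxE.
have Bz : B *m z^T = 0 by apply/orthcP; rewrite BE capmxSr.
split.
  rewrite tr_col_mx mul_col_row zz BB Bz -(trmxK (z *m B^T)) trmx_mul trmxK Bz.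
  by rewrite trmx0 -scalar_mx_block.
apply/andP; split.
  by rewrite col_mx_sub zE BE capmxSl.
rewrite -addsmxE; apply/rV_subP => x xE.
rewrite -(subrK (dotp x z *: z) x) addrC addmx_sub_adds//.
  by rewrite scalemx_sub.
rewrite BE sub_capmx sub_orthcE; apply/andP; split.
  by rewrite addmx_sub// -scaleNr scalemx_sub.
by apply/eqP; rewrite dotpE mulmxBl -scalemxAl zz [LHS]mxE -dotpE !mxE eqxx mulr1 subrr.
Qed.

(** Gram-Schmidt, one unit vector at a time. The complement of [z] in [E] has smaller rank because
    [z] is not orthogonal to itself, and its exact rank is then read off the enlarged basis. *)
Lemma orthonormal_basis_exists r n (E : 'M[R]_n) :
  \rank E = r -> exists B : 'M[R]_(r, n), orthonormal_basis E B.
Proof.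
elim/ltn_ind: r E => -[|r] IH E rE.
  exists 0; split; first by rewrite [LHS]flatmx0 [RHS]flatmx0.
  move/eqP: rE; rewrite mxrank_eq0 => /eqP ->.
  by rewrite /eqmx !sub0mx.
have E0 : nz_row E != 0 by rewrite nz_row_eq0 -mxrank_eq0 rE.
pose z := (enorm (nz_row E))^-1 *: nz_row E.
have zE : (z <= E)%MS by rewrite scalemx_sub// nz_row_sub.
have z1 : enorm z = 1.
  by rewrite enormZ ger0_norm ?invr_ge0 ?enorm_ge0// mulVf// enorm_eq0.
have EzE : (\rank (E :&: orthc z)%MS < r.+1)%N.
  rewrite -rE rank_ltmx// ltmxE capmxSl/= sub_capmx submx_refl/=.
  apply: contra_eqN z1 => Ez; have := submx_trans zE Ez.
  by rewrite sub_orthcE -sqr_enorm expf_eq0/= => /eqP ->; rewrite eq_sym oner_neq0.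
have [B BE] := IH _ EzE _ erefl.
have BE' := orthonormal_basis_cons zE z1 BE.
have rr : r = \rank (E :&: orthc z)%MS.
  by have := orthonormal_basis_rank BE'; rewrite rE => -[].
by rewrite rr; exists (col_mx z B).
Qed.

Lemma orthonormal_basis_extend r n (E : 'M[R]_n) (z : 'rV[R]_n) :
  \rank E = r.+1 -> (z <= E)%MS -> enorm z = 1 ->
  exists B : 'M[R]_(r, n), orthonormal_basis E (col_mx z B).
Proof.
move=> rE zE z1.
have [B BE] := orthonormal_basis_exists (erefl (\rank (E :&: orthc z)%MS)).
have BE' := orthonormal_basis_cons zE z1 BE.
have -> : r = \rank (E :&: orthc z)%MS.
  by have := orthonormal_basis_rank BE'; rewrite rE => -[].
by exists B.
Qed.

Lemma rank_cap_orthc r n (E : 'M[R]_n) (z : 'rV[R]_n) :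
  \rank E = r.+1 -> (z <= E)%MS -> enorm z = 1 -> \rank (E :&: orthc z)%MS = r.
Proof.
move=> rE zE z1.
have [B BE] := orthonormal_basis_exists (erefl (\rank (E :&: orthc z)%MS)).
by have := orthonormal_basis_rank (orthonormal_basis_cons zE z1 BE); rewrite rE => -[].
Qed.

End orthonormal_bases.

(** * Gaussian averages over hyperplanes *)

Section gauss.
Local Open Scope ereal_scope.
Context {R : realType}.
Local Notation mu := (@lebesgue_measure R).
Local Notation lam n := (@lebesgue_rV R n).

Lemma dotp_consrV n (s t : R) (x y : 'rV[R]_n) :
  dotp (consrV (s, x)) (consrV (t, y)) = (s * t + dotp x y)%R.
Proof.
rewrite /dotp (@big_split_ord _ _ _ 1 n)/= big_ord1; congr (_ + _)%R.
  by rewrite /consrV !(@row_mxEl _ 1 1 n) !mxE eqxx !mulr1n.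
by apply: eq_bigr => i _; rewrite /consrV !(@row_mxEr _ 1 1 n).
Qed.

Definition gauss n (t : R) (x : 'rV[R]_n) : R := expR (- (t * dotp x x))%R.

Lemma measurable_dotp d (T : measurableType d) n (f g : T -> 'rV[R]_n) :
  measurable_fun setT f -> measurable_fun setT g ->
  measurable_fun setT (fun x => dotp (f x) (g x)).
Proof.
move=> mf mg; apply: measurable_sum => j; apply: measurable_funM.
  exact: (measurableT_comp (measurable_coor j) mf).
exact: (measurableT_comp (measurable_coor j) mg).
Qed.

Lemma measurable_gauss n t : measurable_fun setT (@gauss n t).
Proof.
apply: (measurableT_comp (@measurable_expR R)).
apply: measurable_funN; apply: measurable_funM => //.
by apply: measurable_dotp; exact: measurable_id.
Qed.

Lemma measurable_gaussE n t : measurable_fun setT (fun x => (@gauss n t x)%:E).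
Proof. by apply/measurable_EFinP; exact: measurable_gauss. Qed.

Lemma gauss_consrV n t s (x : 'rV[R]_n) :
  gauss t (consrV (s, x)) = (expR (- (t * s ^+ 2)) * gauss t x)%R.
Proof. by rewrite /gauss dotp_consrV mulrDr opprD expRD expr2. Qed.

Lemma integral_gauss1 t : (0 < t)%R ->
  exists2 c : R, (0 < c)%R & \int[mu]_s (expR (- (t * s ^+ 2)))%:E = c%:E.
Proof.
move=> t0; have st0 : (0 < Num.sqrt t)%R by rewrite sqrtr_gt0.
exists (Num.sqrt pi / Num.sqrt t)%R; first by rewrite divr_gt0// sqrtr_gt0 pi_gt0.
have mg : measurable_fun setT (EFin \o @gauss_fun R).
  by apply/measurable_EFinP; exact: measurable_gauss_fun.
have := ge0_integral_affine 0%R (lt0r_neq0 st0) mg (fun s => _ : 0 <= _).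
rewrite [X in X = _]integralT_gauss gtr0_norm// => /(_ (fun s => _)) E.
rewrite [_%:E in RHS](_ : _ = (Num.sqrt t)^-1%:E * (Num.sqrt pi)%:E); last by rewrite -EFinM mulrC.
rewrite E; last by move=> s; rewrite /= lee_fin gauss_fun_ge0.
rewrite muleA -EFinM mulVf ?lt0r_neq0// mul1e.
apply: eq_integral => s _; rewrite /gauss_fun/= addr0 exprMn sqr_sqrtr ?ltW//.
Qed.

Lemma integral_gauss n t : (0 < t)%R ->
  exists2 c : R, (0 < c)%R & \int[lam n]_x (gauss t x)%:E = c%:E.
Proof.
move=> t0; elim: n => [|n [c c0 IH]].
  exists 1%R => //=; rewrite integral_dirac//=; [|exact: measurable_gaussE].
  by rewrite diracT mul1e /gauss /dotp big_ord0 mulr0 oppr0 expR0.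
have [c1 c10 E1] := integral_gauss1 t0.
exists (c1 * c)%R; first by rewrite mulr_gt0.
rewrite ge0_integral_rVS; last 2 first.
- exact: measurable_gaussE.
- by move=> x; rewrite lee_fin expR_ge0.
rewrite EFinM -E1 -ge0_integralZr//; last 2 first.
- apply/measurable_EFinP; apply: (measurableT_comp (@measurable_expR R)).
  by apply: measurable_funN; apply: measurable_funM => //; exact: measurable_funX.
- by rewrite lee_fin ltW.
apply: eq_integral => s _; rewrite -IH -ge0_integralZl_EFin ?expR_ge0//.
- by apply: eq_integral => x _; rewrite gauss_consrV EFinM.
- by move=> x _; rewrite lee_fin expR_ge0.
- exact: measurable_gaussE.
Qed.

Lemma cube0 n : @cube R n 0%R = [set 0%R].
Proof.
apply/seteqP; split=> x /=; last by move=> -> i; rewrite mxE normr0.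
by move=> x0; apply/rowP => i; rewrite mxE; apply/eqP; rewrite -normr_le0.
Qed.

Lemma lebesgue_rV_origin n : lam n.+1 [set 0%R] = 0.
Proof. by rewrite -cube0 lebesgue_rV_cube// mulr0 expr0n. Qed.

(* Density, with respect to dz, of the average over u ~ gauss t of the
   hyperplanes z_0 = u . z'. *)
Definition kappa n (t : R) (z : 'rV[R]_(1 + n)) : R :=
  ((enorm (rsubmx z))^-1 * expR (- (t * (z 0 0 / enorm (rsubmx z)) ^+ 2)))%R.

Lemma kappa_consrV n t s (x : 'rV[R]_n) :
  kappa t (consrV (s, x)) = ((enorm x)^-1 * expR (- (t * (s / enorm x) ^+ 2)))%R.
Proof. by rewrite /kappa rsubmx_consrV consrV_head. Qed.

Lemma kappa_ge0 n t (z : 'rV[R]_(1 + n)) : (0 <= kappa t z)%R.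
Proof. by rewrite mulr_ge0 ?invr_ge0 ?enorm_ge0 ?expR_ge0. Qed.

Lemma measurable_inv d (T : measurableType d) (f : T -> R) :
  (forall x, 0 <= f x)%R -> measurable_fun setT f ->
  measurable_fun setT (fun x => (f x)^-1)%R.
Proof.
move=> f0 mf; under eq_fun do rewrite -powR_inv1//.
exact: (measurableT_comp (@measurable_powR R (-1)) mf).
Qed.

Lemma measurable_rsubmx n : measurable_fun setT (fun x : 'rV[R]_n.+1 => rsubmx (x : 'rV_(1 + n))).
Proof.
by apply: measurable_fun_rV => i; under eq_fun do rewrite mxE; exact: measurable_coor.
Qed.

Lemma measurable_kappa n t :
  measurable_fun setT (@kappa n t : 'rV[R]_n.+1 -> R).
Proof.
have mr := measurableT_comp (@measurable_enorm R n) (@measurable_rsubmx n).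
have mi := measurable_inv (fun x => enorm_ge0 _) mr.
apply: measurable_funM => //.
apply: (measurableT_comp (@measurable_expR R)).
apply: measurable_funN; apply: measurable_funM => //.
apply: measurable_funX; apply: measurable_funM => //; exact: measurable_coor.
Qed.

(** In an orthonormal basis starting with [x / |x|], [dotp u x] is [|x|] times the first coordinate
    of [u]. The other coordinates integrate to [c], and dividing the first by [|x|] produces the two
    factors of [kappa]. *)
Lemma integral_gauss_hyperplane n t (x : 'rV[R]_n.+1) (h : R -> \bar R) c :
  (0 < c)%R -> \int[lam n]_x (gauss t x)%:E = c%:E ->
  x != 0%R -> measurable_fun setT h -> (forall s, 0 <= h s) ->
  \int[lam n.+1]_u ((gauss t u)%:E * h (dotp u x)) =
  c%:E * \int[mu]_s (h s * (kappa t (consrV (s, x)))%:E).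
Proof.
move=> c0 cE x0 mh h0; pose N := enorm x.
have N0 : (0 < N)%R by rewrite enorm_gt0.
pose z := (N^-1 *: x)%R.
have z1 : enorm z = 1%R by rewrite enormZ ger0_norm ?invr_ge0 ?ltW// mulVf// gt_eqF.
have [B' [BB _]] : exists B : 'M[R]_(n, n.+1), orthonormal_basis 1%:M (col_mx z B).
  by apply: orthonormal_basis_extend => //; rewrite ?mxrank1 ?submx1.
pose B : 'M[R]_n.+1 := col_mx z B'.
have oB : orthogonal_mx B by exact: BB.
have dB s (v : 'rV_n) : dotp (consrV (s, v) *m B) x = (N * s)%R.
  have xE : x = (consrV (N, 0) *m B)%R.
    rewrite /consrV /B (@mul_row_col _ 1 1 n) mul0mx addr0 mul_scalar_mx.
    by rewrite scalerA mulfV ?scale1r// gt_eqF.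
  rewrite {1}xE dotp_mulmx// dotp_consrV mulrC.
  by rewrite /dotp big1 ?addr0// => i _; rewrite mxE mulr0.
have mg := measurable_gauss (n := n.+1) t.
have mF : measurable_fun setT (fun u : 'rV[R]_n.+1 => (gauss t u)%:E * h (dotp u x)).
  apply: emeasurable_funM; first exact/measurable_EFinP.
  apply: (measurableT_comp mh); apply: measurable_dotp => //; exact: measurable_id.
have F0 u : 0 <= (gauss t u)%:E * h (dotp u x) by rewrite mule_ge0// lee_fin expR_ge0.
rewrite -(ge0_integral_rV_orthogonal oB mF F0) ge0_integral_rVS; last 2 first.
- apply: (measurableT_comp mF); exact: measurable_mulmxr.
- by move=> u; exact: F0.
pose k s := (expR (- (t * s ^+ 2)))%:E * h (N * s)%R.
have mk : measurable_fun setT k.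
  apply: emeasurable_funM.
    apply/measurable_EFinP; apply: (measurableT_comp (@measurable_expR R)).
    by apply: measurable_funN; apply: measurable_funM => //; exact: measurable_funX.
  by apply: (measurableT_comp mh); exact: mulrl_measurable.
have k0 s : 0 <= k s by rewrite mule_ge0// lee_fin expR_ge0.
transitivity (\int[mu]_s (c%:E * k s)).
  apply: eq_integral => s _.
  transitivity (\int[lam n]_v (k s * (gauss t v)%:E)).
    apply: eq_integral => v _; rewrite dB /gauss dotp_mulmx// -/(gauss _ _).
    by rewrite gauss_consrV EFinM /k muleAC.
  rewrite ge0_integralZl//; last by move=> v _; rewrite lee_fin expR_ge0.
    by rewrite cE muleC.
  exact: measurable_gaussE.
rewrite ge0_integralZl_EFin// ?(ltW c0)//; congr (_ * _).
have N10 : (N^-1 != 0)%R by rewrite invr_neq0// gt_eqF.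
apply: etrans (ge0_integral_affine 0%R N10 mk k0) _.
rewrite -ge0_integralZl_EFin//; last first.
- have ma : measurable_fun setT (fun s : measurableTypeR R => N^-1 * s + 0)%R.
    by apply: measurable_funD => //; exact: mulrl_measurable.
  exact: (measurableT_comp mk ma).
apply: eq_integral => s _; rewrite /k kappa_consrV -/N addr0 mulrA mulfV ?gt_eqF// mul1r.
by rewrite gtr0_norm ?invr_gt0// muleA -EFinM muleC [(s / N)%R]mulrC.
Qed.

(** Tonelli exchanges [u] and [x]; for fixed [x != 0] the inner integral is
    [integral_gauss_hyperplane]. The constant does not depend on [f]. *)
Lemma integral_gauss_slices n t : (0 < t)%R -> exists2 c : R, (0 < c)%R &
  forall f : 'rV[R]_n.+2 -> \bar R, measurable_fun setT f -> (forall x, 0 <= f x) ->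
  \int[lam n.+1]_u \int[lam n.+1]_x ((gauss t u)%:E * f (consrV (dotp u x, x))) =
  c%:E * \int[lam n.+2]_z (f z * (@kappa n.+1 t z)%:E).
Proof.
move=> t0; have [c c0 cE] := integral_gauss n t0.
exists c => // f mf f0.
have mc : measurable_fun setT
    (fun p : 'rV[R]_n.+1 * 'rV[R]_n.+1 => consrV (dotp p.1 p.2, p.2)).
  apply: (measurableT_comp (@measurable_consrVR R n.+1)).
  apply/measurable_fun_pairP; split.
    by apply: measurable_dotp; [exact: measurable_fst|exact: measurable_snd].
  exact: measurable_snd.
pose H (p : 'rV[R]_n.+1 * 'rV[R]_n.+1) :=
  (gauss t p.1)%:E * f (consrV (dotp p.1 p.2, p.2)).
have mH : measurable_fun setT H.
  apply: emeasurable_funM; last exact: (measurableT_comp mf mc).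
  apply/measurable_EFinP; apply: (measurableT_comp (measurable_gauss t)).
  exact: measurable_fst.
have H0 p : 0 <= H p by rewrite mule_ge0// lee_fin expR_ge0.
apply: etrans (@fubini_tonelli _ _ _ _ _ (lam n.+1) (lam n.+1) H mH H0) _.
pose K (p : R * 'rV[R]_n.+1) := f (consrV p) * (kappa t (consrV p : 'rV_(1 + n.+1)))%:E.
have mfk : measurable_fun setT (fun z : 'rV[R]_n.+2 => f z * (@kappa n.+1 t z)%:E).
  by apply: emeasurable_funM mf _; apply/measurable_EFinP; exact: measurable_kappa.
have mK : measurable_fun setT (K : measurableTypeR R * 'rV[R]_n.+1 -> \bar R).
  exact: (measurableT_comp mfk (@measurable_consrVR R n.+1)).
have fk0 z : 0 <= f z * (@kappa n.+1 t z)%:E by rewrite mule_ge0// lee_fin kappa_ge0.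
have K0 p : 0 <= K p by exact: fk0.
rewrite ge0_integral_rVS//.
have mGK := @measurable_fun_fubini_tonelli_G _ _ _ _ _ mu K mK K0.
have mGH := @measurable_fun_fubini_tonelli_G _ _ _ _ _ (lam n.+1) H mH H0.
have EK := @fubini_tonelli _ _ _ _ _ mu (lam n.+1) K mK K0.
apply: etrans (congr1 (fun e => c%:E * e) (esym EK)).
have pG x : 0 <= \int[mu]_s K (s, x) by apply: integral_ge0.
apply: etrans (ge0_integralZl_EFin (lam n.+1) measurableT (fun x _ => pG x) mGK (ltW c0)).
apply: ge0_ae_eq_integral => //.
- by apply: emeasurable_funM => //; exact: mGK.
- by move=> x _; apply: integral_ge0.
- by move=> x _; apply: mule_ge0; [rewrite lee_fin ltW|exact: pG].
(* At [x = 0] the inverse in [kappa] takes the default value 0 and the formula fails; the point is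
   null because the dimension is positive. *)
exists [set 0%R]; split.
- by rewrite -cube0; exact: measurable_cube.
- exact: lebesgue_rV_origin.
move=> x /= xP; apply/eqP; apply: contrapT => /negP x0; apply: xP => _.
have mcx : measurable_fun setT (fun s : R => f (consrV (s, x))).
  apply: (measurableT_comp mf).
  exact: (measurableT_comp (@measurable_consrV R n.+1) (pair2_measurable x)).
exact: (integral_gauss_hyperplane c0 cE x0 mcx (fun s => f0 _)).
Qed.

End gauss.

Lemma ge0_integralTZl d (T : measurableType d) (R : realType)
  (mu : {measure set T -> \bar R}) (f : T -> \bar R) (k : R) :
  (0 <= k)%R -> measurable_fun setT f -> (forall x, 0 <= f x)%E ->
  (k%:E * \int[mu]_x f x = \int[mu]_x (k%:E * f x))%E.
Proof. by move=> k0 mf f0; rewrite ge0_integralZl_EFin. Qed.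

(** * Polar coordinates *)

Section radial_formula.
Local Open Scope ereal_scope.
Context {R : realType}.
Local Notation mu := (@lebesgue_measure R).
Local Notation lam n := (@lebesgue_rV R n).

Definition pball n : set 'rV[R]_n := [set x | 0 < enorm x <= 1]%R.

Lemma measurable_natr_bool d (T : measurableType d) (f : T -> bool) :
  measurable_fun setT f -> measurable_fun setT (fun x => (f x)%:R : R)%R.
Proof.
move=> mf; rewrite (_ : (fun _ => _) = (fun x => if f x then 1%R else 0%R)).
  exact: measurable_fun_ifT.
by apply/funext => x; case: (f x).
Qed.

(* Both sides of [lebesgue_rV_radial] are compared, up to the constant
   int s^n half1(s) ds, through Tonelli's theorem for half1(s / r(y)): rescaling
   y by s in one order and s by r(y) in the other. *)
Let half1 (s : R) : R := ((2^-1 <= s <= 1)%R%:R)%R.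

Let measurable_half1 : measurable_fun setT half1.
Proof.
apply: measurable_natr_bool; apply: measurable_and.
  exact: measurable_fun_ler.
exact: measurable_fun_ler.
Qed.

(** On [[1/2, 1]] the factor [|s|^n] lies between [2^-n] and 1. Positivity and finiteness are what
    allows the constant to be cancelled. *)
Let half1_mass n : exists2 c : R, (0 < c)%R &
  \int[mu]_s (`|s| ^+ n * half1 s)%:E = c%:E.
Proof.
have mf : measurable_fun setT (fun s : R => (`|s| ^+ n * half1 s)%:E).
  apply/measurable_EFinP; apply: measurable_funM => //.
  by apply: measurable_funX; exact: normr_measurable.
have massE (k : R) : (0 <= k)%R ->
    \int[mu]_s (k * half1 s)%:E = (k / 2)%:E.
  move=> k0; under eq_integral do rewrite EFinM.
  rewrite ge0_integralZl_EFin//; last 2 first.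
  - by move=> s _; rewrite lee_fin.
  - exact/measurable_EFinP.
  have -> : \int[mu]_s (half1 s)%:E = mu `[2^-1%R, 1%R]%classic.
    rewrite -[X in _ = _ X]setIT -integral_indic//.
    apply: eq_integral => s _; rewrite /half1 indicE; congr ((nat_of_bool _)%:R)%:E.
    by apply/idP/idP => [h|/set_mem/=]; rewrite ?in_itv//; apply/mem_set; rewrite /= in_itv.
  rewrite lebesgue_measure_itv/= lte_fin ifT; last by lra.
  by rewrite -EFinB -EFinM; congr (_ * _)%:E; field.
have lo : ((2^-1 ^+ n) / 2 : R)%:E <= \int[mu]_s (`|s| ^+ n * half1 s)%:E.
  rewrite -massE ?exprn_ge0 ?invr_ge0//; apply: ge0_le_integral => //.
  - by move=> s _; rewrite lee_fin mulr_ge0 ?exprn_ge0 ?invr_ge0.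
  - by apply/measurable_EFinP; apply: measurable_funM.
  - move=> s _; rewrite lee_fin /half1.
    case: (boolP (_ <= s <= _)%R) => [/andP[s2 s1]|_]; last by rewrite !mulr0.
    by rewrite !mulr1 lerXn2r ?nnegrE ?invr_ge0// ger0_norm//; apply: le_trans s2; rewrite invr_ge0.
have hi : \int[mu]_s (`|s| ^+ n * half1 s)%:E <= (1 / 2 : R)%:E.
  rewrite -massE//; apply: ge0_le_integral => //.
  - by move=> s _; rewrite lee_fin mulr_ge0 ?exprn_ge0.
  - by apply/measurable_EFinP; apply: measurable_funM.
  - move=> s _; rewrite lee_fin /half1.
    case: (boolP (_ <= s <= _)%R) => [/andP[s2 s1]|_]; last by rewrite !mulr0.
    rewrite !mulr1 exprn_ile1// ger0_norm//; apply: le_trans s2; by rewrite invr_ge0.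
move: (\int[mu]_s _) lo hi => [c||]//; rewrite lee_fin => lo _.
by exists c => //; apply: lt_le_trans lo; rewrite divr_gt0// exprn_gt0// invr_gt0.
Qed.

Variables (n : nat) (r : 'rV[R]_n.+1 -> R).
Hypotheses (mr : measurable_fun setT r) (r0 : forall y, (0 <= r y)%R).
Hypothesis rZ : forall (t : R) y, (0 < t)%R -> r (t *: y)%R = r y.

(** This is [half1 (s / r y)], set to 0 where [r y = 0]. *)
Let beta (s : R) (y : 'rV[R]_n.+1) : R :=
  ((0 < r y) && (2^-1 * r y <= s <= r y))%R%:R%R.
Let sph (s : R) (y : 'rV[R]_n.+1) : R := (0 < enorm y <= s)%R%:R%R.

(** The substitution [y -> y / s] turns [J1] into [J2], and [s -> r(y) s] turns [J2] into [J3].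
    Integrating [J1] over [s] leaves the integrand [r^(n+1)] on the ball; integrating [J3] over [y]
    leaves the measure of the radial set. Each carries the mass of [half1]. *)
Let J1 (p : measurableTypeR R * 'rV[R]_n.+1) : R :=
  (`|p.1| ^+ n * beta p.1 p.2 * sph 1 p.2)%R.
Let J2 (p : measurableTypeR R * 'rV[R]_n.+1) : R :=
  (`|p.1|^-1 * beta p.1 p.2 * sph p.1 p.2)%R.
Let J3 (p : measurableTypeR R * 'rV[R]_n.+1) : R :=
  (`|p.1|^-1 * half1 p.1 * sph (p.1 * r p.2) p.2)%R.

Let mfst : measurable_fun setT (fst : measurableTypeR R * 'rV[R]_n.+1 -> R).
Proof. exact: measurable_fst. Qed.
Let mr2 : measurable_fun setT (fun p : measurableTypeR R * 'rV[R]_n.+1 => r p.2).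
Proof. by apply: (measurableT_comp mr); exact: measurable_snd. Qed.
Let me2 : measurable_fun setT (fun p : measurableTypeR R * 'rV[R]_n.+1 => enorm p.2).
Proof. by apply: (measurableT_comp (@measurable_enorm R n.+1)); exact: measurable_snd. Qed.
Let mnorm1 : measurable_fun setT (fun p : measurableTypeR R * 'rV[R]_n.+1 => `|p.1|)%R.
Proof. exact: (measurableT_comp (@normr_measurable R setT) mfst). Qed.
Let mbeta : measurable_fun setT (fun p : measurableTypeR R * 'rV[R]_n.+1 => beta p.1 p.2).
Proof.
apply: measurable_natr_bool; apply: measurable_and; first exact: measurable_fun_ltr.
apply: measurable_and; apply: measurable_fun_ler => //.
by apply: measurable_funM.
Qed.
Let msph (f : measurableTypeR R * 'rV[R]_n.+1 -> R) : measurable_fun setT f ->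
  measurable_fun setT (fun p => sph (f p) p.2).
Proof.
move=> mf; apply: measurable_natr_bool; apply: measurable_and.
  exact: measurable_fun_ltr.
exact: measurable_fun_ler.
Qed.
Let mJ1 : measurable_fun setT (EFin \o J1).
Proof.
apply/measurable_EFinP; apply: measurable_funM; last exact: msph.
by apply: measurable_funM => //; exact: measurable_funX.
Qed.
Let mJ2 : measurable_fun setT (EFin \o J2).
Proof.
apply/measurable_EFinP; apply: measurable_funM; last exact: msph.
by apply: measurable_funM => //; apply: measurable_inv => // p; exact: normr_ge0.
Qed.
Let mJ3 : measurable_fun setT (EFin \o J3).
Proof.
apply/measurable_EFinP; apply: measurable_funM; last by apply: msph; exact: measurable_funM.
apply: measurable_funM => //.
  by apply: measurable_inv => // p; exact: normr_ge0.
exact: (measurableT_comp measurable_half1 mfst).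
Qed.
Let J10 p : 0 <= (EFin \o J1) p.
Proof. by rewrite lee_fin !mulr_ge0. Qed.
Let J20 p : 0 <= (EFin \o J2) p.
Proof. by rewrite lee_fin !mulr_ge0 ?invr_ge0. Qed.
Let J30 p : 0 <= (EFin \o J3) p.
Proof. by rewrite lee_fin !mulr_ge0 ?invr_ge0. Qed.

Let mJs (J : measurableTypeR R * 'rV[R]_n.+1 -> R) y :
  measurable_fun setT (EFin \o J) -> measurable_fun setT (fun s => (J (s, y))%:E).
Proof. by move=> mJ; exact: (measurableT_comp mJ (pair2_measurable y)). Qed.
Let mJy (J : measurableTypeR R * 'rV[R]_n.+1 -> R) s :
  measurable_fun setT (EFin \o J) -> measurable_fun setT (fun y => (J (s, y))%:E).
Proof. by move=> mJ; exact: (measurableT_comp mJ (pair1_measurable s)). Qed.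

Let betaE s y : (0 < r y)%R -> beta (r y * s) y = half1 s.
Proof.
move=> ry0; rewrite /beta /half1 ry0/=; congr (nat_of_bool _)%:R.
by rewrite mulrC (ler_pM2l ry0) ger_pMr.
Qed.

Let beta0 s y : ~~ (0 < r y)%R -> beta s y = 0%R.
Proof. by move=> /negbTE ry0; rewrite /beta ry0. Qed.

Let beta_le0 s y : (s <= 0)%R -> beta s y = 0%R.
Proof.
move=> s0; rewrite /beta; case: ltP => //= ry0; case: ltP s0 => //.
by case: (boolP (_ <= _ <= _)%R) => // /andP[+ _]; lra.
Qed.

Let betaZ s t y : (0 < t)%R -> beta s (t *: y)%R = beta s y.
Proof. by move=> t0; rewrite /beta rZ. Qed.

Let sphZ s t y : (0 < t)%R -> sph (t * s) (t *: y)%R = sph s y.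
Proof.
move=> t0; rewrite /sph enormZ gtr0_norm// ler_pM2l//.
by rewrite pmulr_rgt0.
Qed.

Let step1 c : (0 < c)%R -> \int[mu]_s (`|s| ^+ n * half1 s)%:E = c%:E ->
  forall y, \int[mu]_s (J1 (s, y))%:E = c%:E * (r y ^+ n.+1 * sph 1 y)%:E.
Proof.
move=> c0 cE y; have [ry0|ry0] := boolP (0 < r y)%R; last first.
  rewrite (_ : r y = 0%R); last by apply/eqP; rewrite eq_le r0 andbT leNgt.
  rewrite expr0n mul0r mule0 integral0_eq// => s _.
  by rewrite /J1/= beta0// mulr0 mul0r.
have mJ := mJs y mJ1.
apply: etrans (ge0_integral_affine 0%R (lt0r_neq0 ry0) mJ (fun s => J10 _)) _.
rewrite -cE muleC; have mh : measurable_fun setT (fun s : R => (`|s| ^+ n * half1 s)%:E).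
  apply/measurable_EFinP; apply: measurable_funM => //.
  by apply: measurable_funX; exact: normr_measurable.
have q0 : (0 <= r y ^+ n * sph 1 y)%R by rewrite mulr_ge0 ?exprn_ge0.
transitivity (\int[mu]_s ((r y ^+ n * sph 1 y)%:E * (`|s| ^+ n * half1 s)%:E) * `|r y|%:E).
  congr (_ * _); apply: eq_integral => s _; rewrite -EFinM; congr EFin.
  rewrite addr0 /J1/= betaE// normrM exprMn gtr0_norm//; ring.
rewrite ge0_integralZl_EFin//; last by move=> s _; rewrite lee_fin mulr_ge0 ?exprn_ge0.
rewrite cE -!EFinM gtr0_norm// exprS; congr EFin; ring.
Qed.

Let step2 s : \int[lam n.+1]_y (J1 (s, y))%:E = \int[lam n.+1]_y (J2 (s, y))%:E.
Proof.
have [s0|s0] := leP s 0%R.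
  by apply: eq_integral => y _; rewrite /J1 /J2/= beta_le0// !mulr0 !mul0r.
have sV0 : (0 < s^-1)%R by rewrite invr_gt0.
have mJ := mJy s mJ1.
apply: etrans (ge0_integral_rV_affine 0%R (lt0r_neq0 sV0) mJ (fun y => J10 _)) _.
rewrite ge0_integralTZl//; last 2 first.
- exact: (measurableT_comp mJ (measurable_affine_rV _ _)).
- by move=> y; exact: J10.
apply: eq_integral => y _; rewrite -EFinM; congr EFin.
rewrite addr0 /J1 /J2/= betaZ// -[in sph 1 _](mulVf (lt0r_neq0 s0)) sphZ//.
rewrite !gtr0_norm// exprS exprVn; field.
by rewrite expf_neq0 gt_eqF.
Qed.

Let step3 y : \int[mu]_s (J2 (s, y))%:E = \int[mu]_s (J3 (s, y))%:E.
Proof.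
have [ry0|ry0] := boolP (0 < r y)%R; last first.
  have ry : r y = 0%R by apply/eqP; rewrite eq_le r0 andbT leNgt.
  apply: eq_integral => s _; congr EFin; rewrite /J2 /J3/= beta0// ry mulr0 mul0r mulr0 /sph.
  rewrite (_ : (0 < enorm y <= 0)%R = false) ?mulr0//.
  by apply/negP => /andP[e0]; rewrite leNgt e0.
have mJ := mJs y mJ2.
apply: etrans (ge0_integral_affine 0%R (lt0r_neq0 ry0) mJ (fun s => J20 _)) _.
have ma : measurable_fun setT (fun s : measurableTypeR R => r y * s + 0)%R.
  by apply: measurable_funD => //; exact: mulrl_measurable.
rewrite ge0_integralTZl//; last 2 first.
- exact: (measurableT_comp mJ ma).
- by move=> s; exact: J20.
apply: eq_integral => s _; rewrite -EFinM; congr EFin.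
rewrite addr0 /J2 /J3/= betaE// normrM invfM !mulrA.
by rewrite mulfV ?mul1r ?normr_eq0 ?gt_eqF// [(r y * s)%R]mulrC.
Qed.

Let step4 s : \int[lam n.+1]_y (J3 (s, y))%:E =
  (`|s| ^+ n * half1 s)%:E * \int[lam n.+1]_y (sph (r y) y)%:E.
Proof.
have [s2|s2] := boolP (2^-1 <= s <= 1)%R; last first.
  rewrite /half1 (negbTE s2) mulr0 mul0e integral0_eq// => y _.
  by rewrite /J3/= /half1 (negbTE s2) mulr0 mul0r.
have s0 : (0 < s)%R by case/andP: s2 => s2 _; apply: lt_le_trans s2; rewrite invr_gt0.
have mJ := mJy s mJ3.
apply: etrans (ge0_integral_rV_affine 0%R (lt0r_neq0 s0) mJ (fun y => J30 _)) _.
rewrite ge0_integralTZl//; last 2 first.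
- exact: (measurableT_comp mJ (measurable_affine_rV _ _)).
- by move=> y; exact: J30.
rewrite ge0_integralTZl ?mulr_ge0 ?exprn_ge0//; last 2 first.
- apply/measurable_EFinP/measurable_natr_bool; apply: measurable_and.
    by apply: measurable_fun_ltr => //; exact: measurable_enorm.
  by apply: measurable_fun_ler => //; exact: measurable_enorm.
- by move=> y; rewrite lee_fin.
apply: eq_integral => y _; rewrite -!EFinM; congr EFin.
rewrite addr0 /J3/= rZ// sphZ// gtr0_norm// exprS; field.
by rewrite gt_eqF.
Qed.

Lemma lebesgue_rV_radial : lam n.+1 [set y | 0 < enorm y <= r y]%R =
  \int[lam n.+1]_(y in @pball n.+1) (r y ^+ n.+1)%:E.
Proof.
have [c c0 cE] := half1_mass n.
have ms f : measurable_fun setT f -> measurable_fun setT (fun y => (sph (f y) y)).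
  move=> mf; apply/measurable_natr_bool; apply: measurable_and.
    by apply: measurable_fun_ltr => //; exact: measurable_enorm.
  by apply: measurable_fun_ler => //; exact: measurable_enorm.
have mset : measurable [set y : 'rV[R]_n.+1 | 0 < enorm y <= r y]%R.
  pose f y := (0 < enorm y <= r y)%R.
  have mf : measurable_fun setT f.
    apply: measurable_and.
      by apply: measurable_fun_ltr => //; exact: measurable_enorm.
    by apply: measurable_fun_ler => //; exact: measurable_enorm.
  by have := mf measurableT [set true] I; rewrite setTI.
have mS f : measurable_fun setT f -> measurable_fun setT (fun y => (sph (f y) y)%:E).
  by move=> /ms/measurable_EFinP.
have -> : lam n.+1 [set y | 0 < enorm y <= r y]%R =
    \int[lam n.+1]_y (sph (r y) y)%:E.
  rewrite -[X in lam _ X]setIT -integral_indic//.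
  apply: eq_integral => y _; rewrite indicE; congr ((nat_of_bool _)%:R)%:E.
  by apply/idP/idP => [/set_mem|h]//; exact/mem_set.
have -> : \int[lam n.+1]_(y in @pball n.+1) (r y ^+ n.+1)%:E =
    \int[lam n.+1]_y (r y ^+ n.+1 * sph 1 y)%:E.
  rewrite integral_mkcond; apply: eq_integral => y _.
  rewrite patchE /sph; have [|] := boolP (0 < enorm y <= 1)%R => hy.
    by rewrite mem_set// mulr1.
  by rewrite memNset ?mulr0//; exact/negP.
have mI : measurable_fun setT (fun y => (r y ^+ n.+1 * sph 1 y)%:E).
  apply/measurable_EFinP; apply: measurable_funM; first exact: measurable_funX.
  by apply: ms.
have I0 y : 0 <= (r y ^+ n.+1 * sph 1 y)%:E by rewrite lee_fin mulr_ge0 ?exprn_ge0.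
have T1 := @fubini_tonelli _ _ _ _ _ mu (lam n.+1) _ mJ1 J10.
have T2 := @fubini_tonelli _ _ _ _ _ mu (lam n.+1) _ mJ2 J20.
have T3 := @fubini_tonelli _ _ _ _ _ mu (lam n.+1) _ mJ3 J30.
have E : c%:E * \int[lam n.+1]_y (sph (r y) y)%:E =
         c%:E * \int[lam n.+1]_y (r y ^+ n.+1 * sph 1 y)%:E.
  rewrite [RHS]ge0_integralTZl ?(ltW c0)//.
  transitivity (\int[lam n.+1]_y \int[mu]_s (J1 (s, y))%:E); last first.
    by apply: eq_integral => y _; exact: step1.
  rewrite -[RHS]T1.
  transitivity (\int[mu]_s \int[lam n.+1]_y (J2 (s, y))%:E); last first.
    by apply: eq_integral => s _; rewrite [RHS]step2.
  rewrite [RHS]T2.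
  transitivity (\int[lam n.+1]_y \int[mu]_s (J3 (s, y))%:E); last first.
    by apply: eq_integral => y _; rewrite [RHS]step3.
  rewrite -[RHS]T3 -cE.
  have mh : measurable_fun setT (fun s : R => (`|s| ^+ n * half1 s)%:E).
    apply/measurable_EFinP; apply: measurable_funM => //.
    by apply: measurable_funX; exact: normr_measurable.
  have h0 s : [set: R] s -> 0 <= (`|s| ^+ n * half1 s)%:E.
    by rewrite lee_fin mulr_ge0 ?exprn_ge0.
  have W0 : 0 <= \int[lam n.+1]_y (sph (r y) y)%:E.
    by apply: integral_ge0 => y _; rewrite lee_fin.
  apply: etrans (esym (ge0_integralZr mu measurableT mh h0 W0)) _.
  by apply: eq_integral => s _; rewrite [RHS]step4.
have cV : c^-1%:E * c%:E = 1 :> \bar R by rewrite -EFinM mulVf ?gt_eqF.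
by rewrite -[LHS]mul1e -[RHS]mul1e -cV -!muleA E.
Qed.

End radial_formula.

(** * Volume and surface measure in an arbitrary orthonormal basis *)

Section subspace_integrals.
Local Open Scope ereal_scope.
Context {R : realType}.
Local Notation mu := (@lebesgue_measure R).
Local Notation lam n := (@lebesgue_rV R n).

(** Total, with [dir 0 = 0], a point off the sphere; this is why balls are punctured. *)
Definition dir n (x : 'rV[R]_n) : 'rV[R]_n := ((enorm x)^-1 *: x)%R.

Lemma measurable_pball n : measurable (@pball R n).
Proof. exact: measurable_uball. Qed.

Lemma measurable_dir_mulmx m n (B : 'M[R]_(m, n)) :
  measurable_fun setT (fun c : 'rV[R]_m => dir (c *m B)).
Proof.
apply: (measurableT_comp (@measurable_normalize R n)); exact: measurable_mulmxr.
Qed.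

Lemma lebesgue_rV_preimage n (P : 'M[R]_n) (A : set 'rV[R]_n) :
  orthogonal_mx P -> measurable A -> lam n ((fun c => c *m P) @^-1` A) = lam n A.
Proof.
move=> oP mA; have mPA : measurable ((fun c => c *m P) @^-1` A).
  by rewrite -[X in measurable X]setTI; exact: measurable_mulmxr.
rewrite -[A in RHS]setIT -[X in lam n X = _]setIT -!integral_indic//.
apply: etrans (ge0_integral_rV_orthogonal oP _ _) => //.
  exact: measurable_EFin_indic.
Qed.

Lemma orthobasisP n (E : 'M[R]_n) : orthonormal_basis E (orthobasis E).
Proof.
have [B BE] := orthonormal_basis_exists (erefl (\rank E)).
exact: (@getPex _ [set B : 'M[R]_(\rank E, n) | B *m B^T = 1%:M /\ (B == E)%MS]
  (ex_intro _ B BE)).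
Qed.

(** Two orthonormal bases of [E] differ by an orthogonal matrix, which preserves Lebesgue measure.
    The basis chosen in [vol] can thus be replaced by a convenient one. *)
Lemma vol_orthonormal_basis m n (E : 'M[R]_n) (B : 'M[R]_(m, n)) (A : set 'rV[R]_n) :
  orthonormal_basis E B -> measurable A ->
  vol E A = lam m ((fun c => c *m B) @^-1` A).
Proof.
move=> BE mA; have rE := orthonormal_basis_rank BE; subst m.
have [OO /eqmxP OE] := orthobasisP E; case: BE => BB /eqmxP BE.
have /submxP[D BD] : (B <= orthobasis E)%MS by rewrite OE -BE.
have oD : orthogonal_mx D.
  by rewrite /orthogonal_mx -BB BD trmx_mul mulmxA -(mulmxA D) OO mulmx1.
rewrite /vol /pushforward -(lebesgue_rV_preimage oD).
  by congr (lam _ _); apply/funext => c /=; rewrite BD mulmxA.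
by rewrite -[X in measurable X]setTI; exact: measurable_mulmxr.
Qed.

Lemma surface_orthonormal_basis m n (E : 'M[R]_n) (B : 'M[R]_(m, n)) (A : set 'rV[R]_n) :
  orthonormal_basis E B -> measurable A ->
  surface E A = m%:R%:E * lam m (((fun c => dir (c *m B)) @^-1` A) `&` @pball R m).
Proof.
move=> BE mA; rewrite /surface (orthonormal_basis_rank BE).
rewrite (vol_orthonormal_basis BE); last first.
  apply: measurableI; last exact: measurable_uball.
  by rewrite -[X in measurable X]setTI; exact: measurable_normalize.
congr (_ * lam m _); case: BE => BB _.
by apply/seteqP; split => c [/= Ac bc]; split => //; move: bc;
  rewrite /pball/= enorm_mulmx.
Qed.

Lemma ge0_integral_surface m n (E : 'M[R]_n) (B : 'M[R]_(m, n)) (f : 'rV[R]_n -> \bar R) :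
  orthonormal_basis E B -> measurable_fun setT f -> (forall x, 0 <= f x) ->
  \int[surface E]_x f x = m%:R%:E * \int[lam m]_(c in @pball R m) f (dir (c *m B)).
Proof.
move=> BE mf f0; have md := measurable_dir_mulmx B.
pose rm : {measure set 'rV[R]_m -> \bar R} := mrestr (lam m) (@measurable_pball m).
pose pf : {measure set 'rV[R]_n -> \bar R} :=
  measure_function_pushforward__canonical__measure_function_Measure rm md.
transitivity (\int[mscale (m%:R%:nng)%R pf]_x f x).
  apply: eq_measure_integral => A mA _.
  exact: (surface_orthonormal_basis BE mA).
rewrite ge0_integral_mscale//; congr (_ * _).
have f1 : {in [set: 'rV[R]_n], forall x, 0 <= f x} by move=> x _; exact: f0.
have := ge0_integral_pushforward md rm measurableT mf f1.
rewrite preimage_setT => ->.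
have mfd := measurableT_comp mf md.
have mN : measurable (~` @pball R m) by apply: measurableC; exact: measurable_pball.
have N0 : rm (~` @pball R m) = 0 by rewrite /rm/= /mrestr setICl measure0.
rewrite (ge0_negligible_integral mN measurableT mfd (fun x _ => f0 _) N0).
rewrite setTD setCK; apply: eq_measure_integral => A mA AB.
by rewrite /rm/= /mrestr setIidl.
Qed.

End subspace_integrals.

(** * The moment argument *)

Section moments.
Local Open Scope ereal_scope.
Context d (T : measurableType d) (R : realType) (mu : {measure set T -> \bar R}).

(* On A the factor z^j is at least z1^j, while the negative part of D lives on
   z < z0, where z^j <= z0^j: dividing by z1^j, the mass of D on A is at most
   (z0 / z1)^j times the L1 norm of D. *)
Lemma integral_powers_null (D z : T -> R) (z0 z1 : R) (A : set T) :
  mu.-integrable setT (EFin \o D) ->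
  measurable_fun setT z -> (forall x, 0 <= z x <= 1)%R ->
  (0 <= z0 < z1)%R -> measurable A -> (forall x, A x -> z1 <= z x)%R ->
  {ae mu, forall x, z0 <= z x -> 0 <= D x}%R ->
  {ae mu, forall x, A x -> 0 < D x}%R ->
  (forall j, \int[mu]_x (D x * z x ^+ j)%:E = 0) -> mu A = 0.
Proof.
move=> iD mz z01 /andP[z00 z0z1] mA Az D0 D1 mom.
have mD : measurable_fun setT D by apply/measurable_EFinP; exact: measurable_int iD.
have z10 : (0 < z1)%R by exact: le_lt_trans z00 z0z1.
pose M := \int[mu]_x `|(D x)%:E|.
have Mfin : M < +oo by case/integrableP: iD.
have M0 : 0 <= M by apply: integral_ge0.
pose a := \int[mu]_(x in A) `|(D x)%:E|.
have a0 : 0 <= a by apply: integral_ge0.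
have bnd j : (z1 ^+ j)%:E * a <= (z0 ^+ j)%:E * M.
  pose h x := (D x * z x ^+ j)%R.
  have mh : measurable_fun setT h by apply: measurable_funM => //; exact: measurable_funX.
  have ih : mu.-integrable setT (EFin \o h).
    apply: le_integrable iD => //; first exact/measurable_EFinP.
    move=> x _; rewrite /= lee_fin /h normrM ler_piMr//.
    by have /andP[zx0 zx1] := z01 x; rewrite ger0_norm ?exprn_ge0// exprn_ile1.
  have inh : mu.-integrable setT (EFin \o (fun x => `|h x|)%R) by exact: integrable_norm.
  (* The estimate to integrate is [z1^j |D| 1_A <= h + z0^j |D|]. Adding [|h|] makes both sides
     nonnegative, and its finite integral cancels afterwards; [h] itself integrates to 0. *)
  pose f1 x : \bar R := ((z1 ^+ j * `|D x|) * \1_A x + `|h x|)%:E.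
  pose f2 x : \bar R := ((h x + `|h x|) + z0 ^+ j * `|D x|)%:E.
  have mnD : measurable_fun setT (fun x => `|D x|%R).
    exact: (measurableT_comp (@normr_measurable R setT) mD).
  have mnh : measurable_fun setT (fun x => `|h x|%R).
    exact: (measurableT_comp (@normr_measurable R setT) mh).
  have le12 : \int[mu]_x f1 x <= \int[mu]_x f2 x.
    apply: ae_ge0_le_integral => //.
    - by move=> x _; rewrite lee_fin addr_ge0// mulr_ge0 ?indicE// mulr_ge0// exprn_ge0// ltW.
    - apply/measurable_EFinP; apply: measurable_funD => //.
      by apply: measurable_funM; [exact: measurable_funM|exact: measurable_indic].
    - move=> x _; rewrite lee_fin addr_ge0 ?mulr_ge0 ?exprn_ge0//.
      by rewrite -lerBlDr sub0r lerNnormlW.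
    - apply/measurable_EFinP; apply: measurable_funD; first exact: measurable_funD.
      exact: measurable_funM.
    - near=> x => _; rewrite lee_fin addrAC lerD2r.
      have D0x : (z0 <= z x -> 0 <= D x)%R by near: x.
      have D1x : (A x -> 0 < D x)%R by near: x.
      have /andP[zx0 zx1] := z01 x.
      have [Ax|nAx] := pselect (A x).
        rewrite indicE mem_set// mulr1 /h gtr0_norm ?D1x//.
        apply: ler_wpDr; first by rewrite mulr_ge0 ?exprn_ge0// ltW ?D1x.
        rewrite mulrC ler_pM2l ?D1x// lerXn2r ?nnegrE ?(ltW z10)//; exact: Az.
      rewrite indicE memNset// mulr0; have [zz|zz] := leP z0 (z x).
        by rewrite addr_ge0 ?mulr_ge0 ?exprn_ge0// D0x.
      rewrite -lerBlDr sub0r lerNl /h -mulNr mulrC.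
      apply: (@le_trans _ _ (z x ^+ j * `|D x|)%R).
        by rewrite ler_wpM2l ?exprn_ge0// -normrN ler_norm.
      by rewrite ler_wpM2r// lerXn2r ?nnegrE// ltW.
  have mA1 : measurable_fun setT (fun x => `|D x| * \1_A x : R)%R.
    by apply: measurable_funM => //; exact: measurable_indic.
  have aE : \int[mu]_x (`|D x| * \1_A x)%:E = a.
    rewrite /a [RHS]integral_mkcond; apply: eq_integral => x _.
    rewrite patchE indicE; case: ifP => _; last by rewrite mulr0.
    by rewrite mulr1.
  have f1E : \int[mu]_x f1 x = (z1 ^+ j)%:E * a + \int[mu]_x `|h x|%:E.
    have p1 x : 0 <= (`|D x| * \1_A x)%:E by rewrite lee_fin mulr_ge0 ?indicE.
    have mA1' : measurable_fun setT (fun x => (`|D x| * \1_A x)%:E).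
      exact/measurable_EFinP.
    rewrite -aE (ge0_integralTZl _ (exprn_ge0 j (ltW z10)) mA1' p1).
    have p2 x : [set: T] x -> 0 <= (z1 ^+ j)%:E * (`|D x| * \1_A x)%:E.
      by move=> _; rewrite mule_ge0// lee_fin exprn_ge0// ltW.
    have m2 : measurable_fun setT (fun x => (z1 ^+ j)%:E * (`|D x| * \1_A x)%:E).
      exact: emeasurable_funM.
    have m3 : measurable_fun setT (fun x => `|h x|%:E) by exact/measurable_EFinP.
    rewrite -(ge0_integralD mu measurableT p2 m2 _ m3)//.
    by apply: eq_integral => x _; rewrite -EFinD mulrA.
  have f2E : \int[mu]_x f2 x = \int[mu]_x `|h x|%:E + (z0 ^+ j)%:E * M.
    have iD1 : mu.-integrable setT (fun x => `|(D x)%:E|) by exact: integrable_abse.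
    have iD2 := integrableZl measurableT (z0 ^+ j) iD1.
    have ihh := integrableD measurableT ih inh.
    transitivity (\int[mu]_x (((h x)%:E + `|h x|%:E) + (z0 ^+ j)%:E * `|(D x)%:E|)).
      by apply: eq_integral => x _.
    rewrite (integralD measurableT ihh iD2) (integralD measurableT ih inh).
    by rewrite [X in X + _ + _](mom j) add0e integralZl.
  have Nfin : \int[mu]_x `|h x|%:E \is a fin_num by exact: integrable_fin_num.
  by move: le12; rewrite f1E f2E [X in X <= _]addeC leeD2lE.
have afin : a \is a fin_num.
  have := bnd 0%N; rewrite !expr0 !mul1e => aM.
  by rewrite ge0_fin_numE//; exact: le_lt_trans aM Mfin.
have a_eq0 : a = 0.
  apply/eqP; rewrite eq_le a0 andbT.
  have MM : M \is a fin_num by rewrite ge0_fin_numE.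
  rewrite -(fineK afin) lee_fin.
  have q1 : (`|z0 / z1| < 1)%R.
    by rewrite ger0_norm ?divr_ge0 ?(ltW z10)// ltr_pdivrMr// mul1r.
  have qcvg : ((z0 / z1) ^+ j * fine M @[j --> \oo] --> (0 : R))%R.
    by rewrite -(mul0r (fine M)); apply: cvgMl; exact: cvg_expr.
  rewrite -(cvg_lim _ qcvg)//; apply: limr_ge; first by apply/cvg_ex; exists 0%R.
  near=> j; have := bnd j.
  rewrite -(fineK afin) -(fineK MM) -!EFinM lee_fin.
  by rewrite expr_div_n mulrAC ler_pdivlMr ?exprn_gt0// [(fine a * _)%R]mulrC.
(* On [A], [D] vanishes almost everywhere and is positive almost everywhere, so [A] lies in the
   union of two null sets. *)
have /(ae_eq_integral_abs mu mA _) : \int[mu]_(x in A) `|(EFin \o D) x| = 0 by exact: a_eq0.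
move=> /(_ _) [|N [mN N0 AN]]; first by apply/measurable_EFinP; exact: measurable_funTS.
case: D1 => N' [mN' N'0 AN'].
apply/eqP; rewrite eq_le measure_ge0 andbT.
have : mu (N `|` N') = 0 by rewrite measureU0.
move=> <-; apply: le_measure; rewrite ?inE//; first exact: measurableU.
move=> x Ax; have [Dx0|Dx0] := eqVneq (D x) 0%R.
  by right; apply: AN' => /= /(_ Ax); rewrite Dx0 ltxx.
by left; apply: AN => /= /(_ Ax) [] /eqP; rewrite (negbTE Dx0).
Unshelve. all: by end_near.
Qed.

End moments.

(** * Star bodies *)

Section borel_rV.
Context {R : realType}.

(** The sigma-algebra is generated by the coordinates, so topology enters through a countable base:
    an open set is the union of the closed cubes with rational centre and radius [1/(k+1)] that it
    contains. *)
Lemma open_measurable_rV n (U : set 'rV[R]_n) : open U -> measurable U.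
Proof.
move=> oU.
pose box (p : 'rV[rat]_n * nat) : set 'rV[R]_n :=
  [set x | forall i, `|x 0 i - ratr (p.1 0 i)| <= p.2.+1%:R^-1].
have mbox p : measurable (box p).
  rewrite (_ : box p = (fun x => 1 *: x + - map_mx ratr p.1) @^-1` @cube R n p.2.+1%:R^-1).
    rewrite -[X in measurable X]setTI; apply: measurable_affine_rV => //.
    exact: measurable_cube.
  apply/seteqP; split=> x /= xp i; have := xp i; by rewrite !mxE mul1r.
pose F p := if `[< box p `<=` U >] then box p else set0.
rewrite (_ : U = \bigcup_p F p).
  apply: countable_bigcupT_measurable => [|p]; first exact: countableP.
  by rewrite /F; case: ifP.
apply/seteqP; split=> x; last first.
  by move=> [p _]; rewrite /F; case: ifPn => // /asboolP; exact.
move=> Ux; have /nbhs_ballP[e /= e0 eU] := open_nbhs_nbhs (conj oU Ux).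
(* Both [x] and the points of the cube are within [1/(k+1)] of the centre, hence the factor 2. *)
have [k ke] : exists k : nat, 2 * k.+1%:R^-1 < e.
  have [k _ kP] := near_infty_natSinv_lt (PosNum (divr_gt0 e0 (ltr0n _ 2))).
  exists k; have := kP k (leqnn _); rewrite /= ltr_pdivlMr ?ltr0n// mulrC; exact.
pose r : R := k.+1%:R^-1.
have r0 : 0 < r by rewrite invr_gt0.
have /choice[q qP] (i : 'I_n) : exists q : rat, `|x 0 i - ratr q| < r.
  have [q] := @rat_in_itvoo R (x 0 i) (x 0 i + r) ltac:(by rewrite ltrDl).
  rewrite in_itv/= => /andP[q1 q2]; exists q.
  by rewrite ltr_norml; apply/andP; split; lra.
have xb : box (\row_i q i, k) x by move=> i; rewrite !mxE/= ltW.
have bU : box (\row_i q i, k) `<=` U.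
  move=> y yb; apply: eU; split => // i j; rewrite !ord1 /ball/=.
  have := yb j; rewrite !mxE/= -/r => yj; have xj := qP j.
  apply: (le_lt_trans (ler_distD (ratr (q j)) (x 0 j) (y 0 j))).
  by rewrite [X in _ + X]distrC; have ke' : 2 * r < e := ke; lra.
by exists (\row_i q i, k) => //; rewrite /F; case: asboolP.
Qed.

Lemma closed_measurable_rV n (F : set 'rV[R]_n) : closed F -> measurable F.
Proof.
by move=> cF; rewrite -[F]setCK; apply: measurableC; apply: open_measurable_rV; rewrite openC.
Qed.

Lemma compact_measurable_rV n (K : set 'rV[R]_n) : compact K -> measurable K.
Proof.
move=> cK; apply: closed_measurable_rV; exact: compact_closed.
Qed.

End borel_rV.

Section euclidean_topology.
Context {R : realType}.

Lemma enormN n (x : 'rV[R]_n) : enorm (- x) = enorm x.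
Proof. by rewrite -scaleN1r enormZ normrN1 mul1r. Qed.

(** The topology of ['rV[R]_n] comes from the sup norm, and the two norms are equivalent; the crude
    constant [n.+1] also covers [n = 0]. *)
Lemma nbhs_enormP n (x : 'rV[R]_n) (P : set 'rV[R]_n) :
  nbhs x P <-> exists2 e, 0 < e & forall y, enorm (x - y) < e -> P y.
Proof.
split=> [/nbhs_ballP[e /= e0 eP]|[e e0 eP]].
  exists e => // y xy; apply: eP; split => // i j; rewrite !ord1 /ball/=.
  by have := ler_norm_enorm (x - y) j; rewrite !mxE => /le_lt_trans; apply.
have d0 : 0 < e / n.+1%:R by rewrite divr_gt0.
apply/nbhs_ballP; exists (e / n.+1%:R) => // y [_ xy]; apply: eP.
rewrite -(ltr_pXn2r (n := 2))// ?nnegrE ?enorm_ge0 ?(ltW e0)// sqr_enorm.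
apply: (@le_lt_trans _ _ (\sum_(i < n) (e / n.+1%:R) ^+ 2)).
  apply: ler_sum => i _; rewrite -expr2 -real_normK ?num_real//.
  rewrite lerXn2r ?nnegrE ?(ltW d0)//.
  by have := xy 0 i; rewrite /ball/= !mxE => /ltW.
rewrite sumr_const card_ord -[_ *+ n]mulr_natl expr_div_n mulrCA gtr_pMr ?exprn_gt0//.
rewrite ltr_pdivrMr ?exprn_gt0// mul1r -natrX ltr_nat.
by rewrite -mulnn -[X in (X < _)%N]muln1 (@leq_ltn_trans (n * n.+1))// ?leq_mul// ltn_pmul2r.
Qed.

Lemma within_continuous_enormP n (A : set 'rV[R]_n) (f : 'rV[R]_n -> R) :
  {within A, continuous f} <-> forall x, A x -> forall e, 0 < e ->
    exists2 d, 0 < d & forall y, A y -> enorm (x - y) < d -> `|f x - f y| < e.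
Proof.
split=> [/subspace_continuousP fA x Ax e e0|fA].
  have /fA/cvgrPdist_lt/(_ e e0) := Ax.
  rewrite near_withinE => /nbhs_enormP[d d0 dP]; exists d => // y Ay xy.
  exact: dP.
apply/subspace_continuousP => x Ax; apply/cvgrPdist_lt => e e0.
rewrite near_withinE; apply/nbhs_enormP.
by have [d d0 dP] := fA x Ax e e0; exists d => // y xy Ay; exact: dP.
Qed.

End euclidean_topology.

Section star_body.
Context {R : realType} (n : nat) (K : set 'rV[R]_n).
Hypothesis sK : star_body K.

Let cK : compact K. Proof. by case: sK. Qed.
Let K0 : K 0. Proof. by case: sK => _ /interior_subset. Qed.
Let starK x t : K x -> 0 <= t <= 1 -> K (t *: x).
Proof. by case: sK => _ _ + _; apply. Qed.

Lemma star_body_measurable : measurable K.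
Proof. exact: compact_measurable_rV. Qed.

(** By compactness of [K] the set of admissible radii is closed and, as [theta != 0], bounded, so it
    contains its supremum; star-shapedness supplies the smaller radii. *)
Lemma radialP theta r : theta != 0 -> 0 <= r ->
  K (r *: theta) <-> r <= radial K theta.
Proof.
move=> t0 r0; pose S := [set r : R | 0 <= r /\ K (r *: theta)].
have et0 : 0 < enorm theta by rewrite enorm_gt0.
have S0 : S !=set0 by exists 0; split => //; rewrite scale0r.
have Sub : has_ubound S.
  have [M [_ /(_ (M + 1))]] := compact_bounded cK.
  rewrite ltrDl ltr01 => /(_ isT) KM.
  exists ((M + 1) / `|theta|) => s [s0 Ks].
  have := KM _ Ks; rewrite /= mx_normZ ger0_norm// => sM.
  by rewrite ler_pdivlMr// normr_gt0.
have supS : S (sup S).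
  have S_closed : closed S.
    rewrite (_ : S = [set r | 0 <= r] `&` (fun r => r *: theta) @^-1` K) //.
    apply: closedI; first exact: closed_ge.
    apply: closed_comp; first by move=> x _; exact: scalel_continuous.
    by apply: compact_closed => //; exact: norm_hausdorff.
  by rewrite [X in X _](closure_id S).1//; exact: closure_sup.
split=> [Kr|rs]; first exact: ub_le_sup.
have [s0 Ks] := supS.
have [r00|rn0] := eqVneq r 0; first by rewrite r00 scale0r.
have s_gt0 : 0 < sup S by apply: lt_le_trans rs; rewrite lt_neqAle eq_sym rn0.
rewrite -[r](divfK (lt0r_neq0 s_gt0)) -scalerA; apply: starK => //.
by rewrite divr_ge0//= ler_pdivrMr// mul1r.
Qed.

Lemma radial_ge0 theta : theta != 0 -> 0 <= radial K theta.
Proof. by move=> t0; apply/(radialP t0 (lexx 0)); rewrite scale0r. Qed.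

Lemma star_body_dirP x : x != 0 -> K x <-> enorm x <= radial K (dir x).
Proof.
move=> x0; have ex : enorm x != 0 by rewrite enorm_eq0.
have d0 : dir x != 0 by rewrite scaler_eq0 negb_or invr_eq0 ex.
have := radialP d0 (enorm_ge0 x).
by rewrite /dir scalerA mulfV// scale1r.
Qed.

(** In direction 0 every radius is admissible and [sup] returns its default value 0 on the unbounded
    set. *)
Lemma radial0 : radial K 0 = 0.
Proof.
rewrite /radial (_ : [set r | _] = `[0, +oo[%classic) ?sup_out//.
  by move=> [_ [M /(_ (`|M| + 1))]]; rewrite /= in_itv/= andbT => /(_ _); 
     rewrite addr_ge0// => /(_ isT); have := ler_norm M; lra.
apply/seteqP; split=> r /=; rewrite in_itv/= andbT; first by case.
by move=> r0; split=> //; rewrite scaler0.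
Qed.

(** For [a > 0], the set where the function is at least [a] is, off the origin, the preimage of [K]
    under [x -> a dir x]; for [a <= 0] it is the whole space. *)
Lemma measurable_radial_dir : measurable_fun setT (fun x => radial K (dir x)).
Proof.
apply: (measurability (@RGenCInfty.G R)); first exact: RGenCInfty.measurableE.
move=> _ [_ [a ->] <-]; rewrite setTI.
have [a0|a0] := leP a 0.
  rewrite (_ : _ @^-1` _ = setT)//; apply/seteqP; split=> // x _ /=.
  rewrite in_itv/= andbT; apply: le_trans a0 _.
  have [->|x0] := eqVneq (dir x) 0; first by rewrite radial0.
  exact: radial_ge0.
have md := @measurable_normalize R n.
rewrite (_ : _ @^-1` _ = [set x | 0 < enorm x] `&` (fun x => a *: dir x + 0) @^-1` K).
  apply: measurableI.
    rewrite (_ : [set x | _] = @enorm R n @^-1` `]0, +oo[%classic); last first.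
      by apply/seteqP; split=> x /=; rewrite in_itv/= andbT.
    by rewrite -[X in measurable X]setTI; exact: measurable_enorm.
  rewrite -[X in measurable X]setTI.
  by apply: (measurableT_comp (measurable_affine_rV a 0) md) => //; exact: star_body_measurable.
apply/seteqP; split=> x /=; rewrite in_itv/= andbT addr0 enorm_gt0.
  move=> ax; have [x0|x0] := eqVneq x 0.
    by move: ax; rewrite x0 /dir scaler0 radial0 leNgt a0.
  split=> //; apply/radialP => //; last exact: ltW.
  by rewrite scaler_eq0 negb_or invr_eq0 enorm_eq0 x0.
move=> [x0 Kx]; apply/radialP => //; last exact: ltW.
by rewrite scaler_eq0 negb_or invr_eq0 enorm_eq0 x0.
Qed.

End star_body.

(** * Spheres of subspaces and functions of degree 0 *)

Section directions.
Context {R : realType}.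

Lemma enorm_dir n (x : 'rV[R]_n) : x != 0 -> enorm (dir x) = 1.
Proof.
move=> x0; rewrite enormZ ger0_norm ?invr_ge0 ?enorm_ge0//.
by rewrite mulVf// enorm_eq0.
Qed.

Lemma dirZ n (t : R) (x : 'rV[R]_n) : 0 < t -> dir (t *: x) = dir x.
Proof.
move=> t0; rewrite /dir enormZ gtr0_norm// invfM scalerA.
by rewrite mulrAC mulVf ?mul1r// gt_eqF.
Qed.

Lemma dirN n (x : 'rV[R]_n) : dir (- x) = - dir x.
Proof. by rewrite /dir enormN scalerN. Qed.

Lemma mulmx_eq0_orthonormal m n (B : 'M[R]_(m, n)) (x : 'rV[R]_m) :
  B *m B^T = 1%:M -> (x *m B == 0) = (x == 0).
Proof. by move=> BB; rewrite -!enorm_eq0 enorm_mulmx. Qed.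

Lemma sphere_dir_mulmx m n (E : 'M[R]_n) (B : 'M[R]_(m, n)) (x : 'rV[R]_m) :
  orthonormal_basis E B -> x != 0 -> (sphere `&` rowset E) (dir (x *m B)).
Proof.
move=> [BB /eqmxP BE] x0; split.
  by rewrite /sphere/= enorm_dir// mulmx_eq0_orthonormal.
by rewrite /rowset/= scalemx_sub// -BE submxMl.
Qed.

Lemma measurable_rowset n (E : 'M[R]_n) : measurable (rowset E).
Proof.
rewrite (_ : rowset E = (fun x => x *m cokermx E) @^-1` [set 0]).
  rewrite -[X in measurable X]setTI; apply: measurable_mulmxr => //.
  by rewrite -cube0; exact: measurable_cube.
by apply/seteqP; split=> x /=; rewrite /rowset/= submxE; [move=> /eqP|move=> ->].
Qed.

Lemma measurable_sphere_rowset n (E : 'M[R]_n) :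
  measurable (sphere `&` rowset E).
Proof.
apply: measurableI; last exact: measurable_rowset.
rewrite -[X in measurable X]setTI.
exact: (@measurable_enorm R n measurableT [set 1] (measurable_set1 _)).
Qed.

Lemma sphere_rowset_cap n (E : 'M[R]_n) (w : 'rV[R]_n) :
  sphere `&` rowset E `&` [set eta | dotp eta w = 0] =
  sphere `&` rowset (E :&: orthc w)%MS.
Proof.
apply/seteqP; split=> x; rewrite /rowset/= sub_capmx sub_orthcE.
  by move=> [[x1 ->] ->]; rewrite eqxx.
by move=> [x1 /andP[xE /eqP xw]].
Qed.

Local Open Scope ereal_scope.
Local Notation lam n := (@lebesgue_rV R n).

Lemma ge0_integral_sphere m n (E : 'M[R]_n) (B : 'M[R]_(m, n)) (f : 'rV[R]_n -> \bar R) :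
  orthonormal_basis E B -> measurable_fun (sphere `&` rowset E) f ->
  (forall x, (sphere `&` rowset E) x -> 0 <= f x) ->
  \int[surface E]_(x in sphere `&` rowset E) f x =
  m%:R%:E * \int[lam m]_(c in @pball R m) f (dir (c *m B)).
Proof.
move=> BE mf f0; have mS := measurable_sphere_rowset E.
rewrite integral_mkcond (ge0_integral_surface BE); last 2 first.
- exact/(measurable_restrictT _ mS).
- by apply: erestrict_ge0.
congr (_ * _); apply: eq_integral => c /set_mem/= /andP[c0 _].
by rewrite patchE mem_set//; apply: sphere_dir_mulmx => //; rewrite -enorm_gt0.
Qed.

Lemma ge0_funk m n (E : 'M[R]_n) w (O : 'M[R]_(m, n)) (f : 'rV[R]_n -> R) :
  orthonormal_basis (E :&: orthc w)%MS O -> measurable_fun (sphere `&` rowset E) f ->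
  (forall x, (sphere `&` rowset E) x -> 0 <= f x)%R ->
  funk E f w = m%:R%:E * \int[lam m]_(y in @pball R m) (f (dir (y *m O)))%:E.
Proof.
move=> OE mf f0; rewrite /funk sphere_rowset_cap.
have sub : sphere `&` rowset (E :&: orthc w)%MS `<=` sphere `&` rowset E.
  by rewrite -sphere_rowset_cap; exact: subIsetl.
have mf' := measurable_funS (measurable_sphere_rowset E) sub mf.
have mf'' : measurable_fun (sphere `&` rowset (E :&: orthc w)%MS) (EFin \o f).
  exact/measurable_EFinP.
have f0' x : (sphere `&` rowset (E :&: orthc w)%MS) x -> 0 <= (EFin \o f) x.
  by move=> /sub/f0; rewrite lee_fin.
exact: (ge0_integral_sphere OE mf'' f0').
Qed.

(** The lower bound on the norm keeps the weight [kappa] bounded, which fails on the whole ball. *)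
Definition shell n : set 'rV[R]_n := [set x | 2^-1 < enorm x <= 1]%R.

Lemma measurable_enorm_itv n (i : interval R) :
  measurable [set x : 'rV[R]_n | enorm x \in i].
Proof.
rewrite -[X in measurable X]setTI.
exact: (@measurable_enorm R n measurableT [set` i] (measurable_itv i)).
Qed.

Lemma shellE n : @shell n = [set x : 'rV[R]_n | enorm x \in `](2^-1)%R, 1%R]].
Proof. by apply/seteqP; split=> x /=; rewrite in_itv. Qed.

Lemma measurable_shell n : measurable (@shell n).
Proof. by rewrite shellE; exact: measurable_enorm_itv. Qed.

(** By scaling, the ball of radius 1/2 carries the fraction [2^-n] of the integral of a function of
    degree 0. Finiteness permits the subtraction. *)
Lemma ge0_integral_shell n (f : 'rV[R]_n -> \bar R) :
  measurable_fun (@pball R n) f -> (forall x, 0 <= f x) ->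
  (forall t x, (0 < t)%R -> f (t *: x)%R = f x) ->
  \int[lam n]_(x in @pball R n) f x < +oo ->
  \int[lam n]_(x in @shell n) f x =
  (1 - 2^-1 ^+ n)%R%:E * \int[lam n]_(x in @pball R n) f x.
Proof.
move=> mf f0 fZ foo; pose S : set 'rV[R]_n := [set x | enorm x \in `]0%R, (2^-1)%R]].
have mS : measurable S by exact: measurable_enorm_itv.
have mB := @measurable_pball R n; have mSh := @measurable_shell n.
have BU : @pball R n = S `|` @shell n.
  apply/seteqP; split=> x; rewrite /pball /S /shell/= in_itv/=.
    by move=> /andP[x0 x1]; case: (leP (enorm x) 2^-1%R) => h; [left; rewrite x0|right].
  by move=> [|] /andP[x0 x1]; apply/andP; split=> //; lra.
have SI : \int[lam n]_(x in S) f x = (2^-1 ^+ n)%:E * \int[lam n]_(x in @pball R n) f x.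
  have SB : S `<=` @pball R n by rewrite BU; left.
  rewrite integral_mkcond; have a0 : (2^-1 != 0 :> R)%R by rewrite invr_neq0.
  have mfS : measurable_fun setT (f \_ S).
    by apply/(measurable_restrictT _ mS); exact: (measurable_funS mB SB mf).
  have fS0 x : 0 <= (f \_ S) x by apply: erestrict_ge0.
  apply: etrans (ge0_integral_rV_affine 0%R a0 mfS fS0) _.
  rewrite ger0_norm ?invr_ge0//; congr (_ * _).
  rewrite [RHS]integral_mkcond; apply: eq_integral => x _.
  rewrite !patchE addr0 fZ ?invr_gt0//; congr (if _ then _ else _).
  apply/idP/idP => /set_mem xS; apply/mem_set; move: xS;
    rewrite /S /pball/= enormZ ger0_norm ?invr_ge0// in_itv/= => /andP[x0 x1]; lra.
have : \int[lam n]_(x in @pball R n) f x =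
    \int[lam n]_(x in S) f x + \int[lam n]_(x in @shell n) f x.
  rewrite BU ge0_integral_setU//.
  - by rewrite -BU.
  - rewrite disj_set2E; apply/eqP/seteqP; split=> x //= [].
    by rewrite /S /shell/= in_itv/= => /andP[_ a] /andP[b _]; have := le_lt_trans a b; rewrite ltxx.
rewrite SI.
have : 0 <= \int[lam n]_(x in @pball R n) f x by apply: integral_ge0.
move: (\int[lam n]_(x in @pball R n) f x) foo => [X| |]//= _ _.
rewrite -EFinM; move: (\int[lam n]_(x in @shell n) f x) => [Y| |]//= [E].
by rewrite -EFinM mulrBl mul1r; congr EFin; lra.
Qed.

End directions.

Lemma lebesgue_rV_affine (R : realType) n (a : R) (v : 'rV[R]_n) (A : set 'rV[R]_n) :
  a != 0 -> measurable A ->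
  lebesgue_rV n A = ((`|a| ^+ n)%:E * lebesgue_rV n [set x | A (a *: x + v)%R])%E.
Proof.
move=> a0 mA; have mAv : measurable [set x | A (a *: x + v)].
  by rewrite -[X in measurable X]setTI; exact: measurable_affine_rV.
rewrite -[A in LHS]setIT -[X in (_ * lebesgue_rV n X)%E]setIT -!integral_indic//.
exact: (ge0_integral_rV_affine v a0 (measurable_EFin_indic mA)).
Qed.

(** * Injectivity of the Funk transform near a point *)

Section slices.
Local Open Scope ereal_scope.
Context {R : realType} (n p : nat) (E : 'M[R]_n) (B : 'M[R]_(p.+2, n)).
Hypothesis BE : orthonormal_basis E B.
Local Notation lam n := (@lebesgue_rV R n).
Local Notation mu := (@lebesgue_measure R).

Let BB : B *m B^T = 1%:M. Proof. by case: BE. Qed.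
Let rE : \rank E = p.+2. Proof. exact: orthonormal_basis_rank BE. Qed.

(** Unit normal of the hyperplane z_0 = u . z' in the coordinates of [B]. As [u] varies it fills the
    open half sphere about [row 0 B]. *)
Definition hyperplane_normal (u : 'rV[R]_p.+1) : 'rV[R]_n :=
  dir (consrV (1%R, - u)%R *m B).

Definition cone_shell (f : 'rV[R]_n -> R) (z : 'rV[R]_p.+2) : R :=
  (f (dir (z *m B)) * \1_(@shell R p.+2) z)%R.

Lemma consrV1_neq0 (u : 'rV[R]_p.+1) : consrV (1%R, u) != 0%R.
Proof.
apply/eqP => /(congr1 (fun z : 'rV_(1 + p.+1) => z 0%R 0%R)).
by rewrite /= consrV_head mxE => /eqP; rewrite oner_eq0.
Qed.

Let graph (u : 'rV[R]_p.+1) : 'M[R]_(p.+1, p.+2) := row_mx u^T 1%:M.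

Let graphE (u x : 'rV[R]_p.+1) : consrV (dotp u x, x) = (x *m graph u)%R.
Proof.
rewrite /graph (@mul_mx_row _ 1 p.+1 1 p.+1) mulmx1 /consrV/=.
rewrite (_ : (dotp u x)%:M = (x *m u^T)%R)//.
by apply/matrixP => i j; rewrite !ord1 mxE eqxx mulr1n dotpC dotpE.
Qed.

Let hyperplane_rank u : \rank (E :&: orthc (hyperplane_normal u))%MS = p.+1.
Proof.
have [] := sphere_dir_mulmx BE (consrV1_neq0 (- u)) => w1 wE.
exact: rank_cap_orthc.
Qed.

(** [graph u] parametrizes the hyperplane by its last coordinates. Dropping the head coordinate is a
    one-sided inverse, which makes the transition matrix [P] invertible. *)
Let graph_factor u (O : 'M[R]_(p.+1, n)) :
  orthonormal_basis (E :&: orthc (hyperplane_normal u))%MS O ->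
  exists2 P : 'M[R]_p.+1, P \in unitmx & graph u *m B = P *m O.
Proof.
move=> [OO /eqmxP OE].
have /submxP[P PE] : (graph u *m B <= O)%MS.
  rewrite OE sub_capmx; case: BE => _ /eqmxP BE'.
  rewrite -BE' submxMl/=; apply/orthcP.
  rewrite /hyperplane_normal /dir linearZ/= -scalemxAr trmx_mul mulmxA.
  rewrite -(mulmxA _ B) BB mulmx1 /consrV/= (@tr_row_mx _ 1 1 p.+1).
  rewrite /graph (@mul_row_col _ p.+1 1 p.+1) tr_scalar_mx mulmx1 mul1mx linearN/=.
  by rewrite subrr scaler0.
exists P => //; have : (P *m (O *m B^T *m (col_mx (0 : 'M[R]_(1, p.+1)) 1%:M : 'M[R]_(p.+2, p.+1))) = 1%:M)%R.
  rewrite !mulmxA -PE -(mulmxA (graph u)) BB mulmx1.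
  by rewrite /graph (@mul_row_col _ p.+1 1 p.+1) mulmx0 mulmx1 add0r.
by move=> /mulmx1_unit[].
Qed.

Lemma measurable_cone_shell f : measurable_fun setT f ->
  measurable_fun setT (cone_shell f).
Proof.
move=> mf; apply: measurable_funM.
  exact: (measurableT_comp mf (measurable_dir_mulmx B)).
by apply: measurable_indic; exact: measurable_shell.
Qed.

Lemma cone_shell_ge0 f : (forall x, 0 <= f x)%R -> forall z, (0 <= cone_shell f z)%R.
Proof. by move=> f0 z; rewrite mulr_ge0// indicE. Qed.

(** The constant collects the Gaussian value, the distortion [cP] of the graph parametrization, the
    fraction [k] of the ball filled by the shell, and the normalization of the surface measure. It
    depends on [t] and [u] but not on [f], so equal transforms give equal slices. *)
Lemma gauss_slice t u : exists2 c : R, (0 < c)%R &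
  forall f : 'rV[R]_n -> R, measurable_fun setT f -> (forall x, 0 <= f x)%R ->
  funk E f (hyperplane_normal u) < +oo ->
  \int[lam p.+1]_x ((gauss t u)%:E * (cone_shell f (consrV (dotp u x, x)))%:E) =
  c%:E * funk E f (hyperplane_normal u).
Proof.
have [W OE] := orthonormal_basis_exists (hyperplane_rank u).
have OO : W *m W^T = 1%:M by case: OE.
have [P Pu PE] := graph_factor OE.
have [cP cP0 cPE] := ge0_integral_rV_unitmx Pu.
pose k : R := (1 - 2^-1 ^+ p.+1)%R.
have k0 : (0 < k)%R.
  by rewrite subr_gt0 exprn_ilt1// ?invr_ge0// invf_lt1// ltr1n.
exists (gauss t u * (cP * (k * p.+1%:R^-1)))%R.
  by rewrite !mulr_gt0 ?expR_gt0 ?invr_gt0.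
move=> f mf f0 foo.
have FE := ge0_funk OE (measurable_funTS mf) (fun x _ => f0 x).
pose phi y := (f (dir (y *m W)))%:E.
have mphi : measurable_fun setT phi.
  by apply/measurable_EFinP; exact: (measurableT_comp mf (measurable_dir_mulmx W)).
have phi0 y : 0 <= phi y by rewrite lee_fin.
have phiZ s y : (0 < s)%R -> phi (s *: y)%R = phi y.
  by move=> s0; rewrite /phi -scalemxAl dirZ.
pose X := \int[lam p.+1]_(y in @pball R p.+1) phi y.
have X0 : 0 <= X by apply: integral_ge0.
have Xoo : X < +oo.
  move: foo; rewrite FE -/X; move: X X0 => [x| |]//=; first by move=> _ _; rewrite ltry.
  by move=> _; rewrite gt0_muley// lte_fin.
have shE := ge0_integral_shell (measurable_funTS mphi) phi0 phiZ Xoo.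
pose H y := phi y * (\1_(@shell R p.+1) y)%:E.
have mH : measurable_fun setT H.
  apply: emeasurable_funM => //; apply: measurable_EFin_indic; exact: measurable_shell.
have H0 y : 0 <= H y by rewrite mule_ge0// lee_fin.
have HE : \int[lam p.+1]_y H y = \int[lam p.+1]_(y in @shell R p.+1) phi y.
  rewrite [RHS]integral_mkcond; apply: eq_integral => y _.
  by rewrite patchE /H indicE; case: ifP => _; rewrite ?mule1 ?mule0.
have HP : \int[lam p.+1]_x H (x *m P) = \int[lam p.+1]_x
    (cone_shell f (consrV (dotp u x, x)))%:E.
  apply: eq_integral => x _; rewrite /H /phi /cone_shell -EFinM graphE -!mulmxA -PE.
  congr ((_ * _)%R%:E); rewrite !indicE; congr ((nat_of_bool _)%:R)%R.
  have e : enorm (x *m P) = enorm (x *m graph u).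
    by rewrite -(enorm_mulmx _ OO) -(enorm_mulmx (x *m graph u) BB) -!mulmxA PE.
  by apply/idP/idP => /set_mem h; apply/mem_set; move: h; rewrite /shell/= e.
have mcs : measurable_fun setT (fun x : 'rV[R]_p.+1 => (cone_shell f (consrV (dotp u x, x)))%:E).
  apply/measurable_EFinP; under eq_fun do rewrite graphE.
  exact: (measurableT_comp (measurable_cone_shell mf) (measurable_mulmxr _)).
rewrite ge0_integralZl_EFin ?expR_ge0//; last first.
  by move=> x _; rewrite lee_fin; exact: cone_shell_ge0.
rewrite -HP cPE// HE shE FE -/X -/k !EFinM -!muleA.
congr (_ * (_ * (_ * _))).
by rewrite muleA -EFinM mulVf ?mul1e// pnatr_eq0.
Qed.

Lemma measurable_hyperplane_normal : measurable_fun setT hyperplane_normal.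
Proof.
have mopp : measurable_fun setT (fun u : 'rV[R]_p.+1 => - u)%R.
  rewrite (_ : (fun _ => _) = fun u => (-1 *: u + 0)%R); last first.
    by apply/funext => u; rewrite scaleN1r addr0.
  exact: measurable_affine_rV.
have mn := measurableT_comp (@measurable_consrV2 R _ 1%R) mopp.
exact: (measurableT_comp (measurable_dir_mulmx B) mn).
Qed.

(** The cone [N] over [A] is null, being covered by countably many dilates of its part in the unit
    ball. Its section at height [s] is [- s U], with [U] the set in question, and has measure
    [s^(p+1)] times that of [U]. Integrating over heights in [[1, 2]] bounds the measure of [U] by
    that of [N]. *)
Lemma surface_null_slices (A : set 'rV[R]_n) : measurable A -> surface E A = 0 ->
  lam p.+1 [set u | A (hyperplane_normal u)] = 0.
Proof.
move=> mA; rewrite (surface_orthonormal_basis BE mA) => /eqP.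
rewrite mule_eq0 eqe pnatr_eq0 => /orP[//|/eqP N1E].
pose N := (fun z : 'rV[R]_p.+2 => dir (z *m B)) @^-1` A `&` [set z | z != 0%R].
have mne0 : measurable [set z : 'rV[R]_p.+2 | z != 0%R].
  rewrite (_ : [set z | _] = ~` [set 0%R]); last first.
    by apply/seteqP; split=> z /=; [move=> /eqP|move=> ?; apply/eqP].
  by apply: measurableC; rewrite -cube0; exact: measurable_cube.
have mN : measurable N.
  apply: measurableI => //; rewrite -[X in measurable X]setTI.
  exact: measurable_dir_mulmx.
have N0 : lam p.+2 N = 0.
  pose N1 := (fun z : 'rV[R]_p.+2 => dir (z *m B)) @^-1` A `&` @pball R p.+2.
  have mN1 : measurable N1.
    apply: measurableI; last exact: measurable_pball.
    by rewrite -[X in measurable X]setTI; exact: measurable_dir_mulmx.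
  pose S (i : nat) := (fun z => i.+1%:R^-1 *: z + 0)%R @^-1` N1.
  have mS i : measurable (S i).
    by rewrite -[X in measurable X]setTI; exact: measurable_affine_rV.
  have S0 i : lam p.+2 (S i) = 0.
    have a0 : (i.+1%:R^-1 != 0 :> R)%R by rewrite invr_neq0.
    have := lebesgue_rV_affine 0%R a0 mN1; rewrite N1E => /esym/eqP.
    rewrite mule_eq0 eqe expf_eq0 normr_eq0 (negbTE a0) andbF/= => /eqP; exact.
  have nS i : (lam p.+2).-negligible (S i).
    by apply/(negligibleP (lam p.+2) (mS i)); exact: S0.
  suff sub : N `<=` \bigcup_i S i.
    exact/(negligibleP (lam p.+2) mN)/(negligibleS sub)/(negligible_bigcup nS).
  move=> z [Az z0]; have ez : (0 < enorm z)%R by rewrite enorm_gt0.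
  have [i zi] : exists i : nat, (enorm z < i.+1%:R)%R.
    by exists (Num.bound (enorm z)); rewrite (lt_le_trans (archi_boundP _)) ?ler_nat// ltW.
  exists i => //; rewrite /S/= addr0; split => /=.
    by rewrite -scalemxAl dirZ// invr_gt0.
  rewrite /pball/= enormZ gtr0_norm ?invr_gt0//.
  by rewrite mulr_gt0 ?invr_gt0//= mulrC ler_pdivrMr// mul1r ltW.
pose U := [set u | A (hyperplane_normal u)].
have mU : measurable U.
  by rewrite -[X in measurable X]setTI; exact: measurable_hyperplane_normal.
have sec s : (1 <= s)%R -> lam p.+1 U <= lam p.+1 [set x | N (consrV (s, x))].
  move=> s1; have s0 : (0 < s)%R by apply: lt_le_trans s1.
  have sN0 : (- s != 0)%R by rewrite oppr_eq0 gt_eqF.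
  have mNs : measurable [set x : 'rV[R]_p.+1 | N (consrV (s, x))].
    by rewrite -[X in measurable X]setTI; exact: measurable_consrV2.
  rewrite (lebesgue_rV_affine 0%R sN0 mNs) normrN gtr0_norm//.
  rewrite (_ : [set x | [set x | N (consrV (s, x))] (- s *: x + 0)%R] = U); last first.
    have e (u : 'rV[R]_p.+1) : consrV (s, - s *: u + 0)%R = (s *: consrV (1, - u))%R.
      have c0 : consrV (0%R, 0%R) = 0%R :> 'rV[R]_p.+2.
        by rewrite /consrV/= raddf0 (@row_mx0 _ 1 1 p.+1).
      transitivity (s *: consrV (1, - u) + consrV (0, 0))%R.
        by rewrite consrVZD mulr1 !addr0 scalerN scaleNr.
      exact: (etrans (congr1 (fun z => s *: consrV (1, - u) + z)%R c0) (addr0 _)).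
    apply/seteqP; split=> u; rewrite /N /U/= e -scalemxAl dirZ//; first by case.
    by move=> Au; split=> //; rewrite scaler_eq0 negb_or gt_eqF//= consrV1_neq0.
  by rewrite -[leLHS]mul1e lee_pmul// lee_fin exprn_ege1.
have : (lam p.+1 U) <= lam p.+2 N.
  rewrite -[X in _ <= lam p.+2 X]setIT -integral_indic// ge0_integral_rVS; last 2 first.
  - exact: measurable_EFin_indic.
  - by move=> z; rewrite lee_fin.
  have -> : lam p.+1 U = \int[mu]_(s in `[1%R, 2%R]%classic) lam p.+1 U.
    rewrite integral_cst//= lebesgue_measure_itv/= lte_fin ltr1n -EFinB.
    by rewrite (_ : 2 - 1 = 1)%R ?mule1//; lra.
  pose g (q : measurableTypeR R * 'rV[R]_p.+1) : \bar R := (\1_N (consrV q))%:E.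
  have mg : measurable_fun setT g.
    exact: (measurableT_comp (measurable_EFin_indic mN) (@measurable_consrVR R p.+1)).
  have g0 q : 0 <= g q by rewrite lee_fin.
  have mF := @measurable_fun_fubini_tonelli_F _ _ _ _ _ (lam p.+1) g mg g0.
  have F0 s : 0 <= fubini_F (lam p.+1) g s by apply: integral_ge0.
  rewrite -[leRHS]/(\int[mu]_s fubini_F (lam p.+1) g s).
  apply: (@le_trans _ _ (\int[mu]_(s in `[1%R, 2%R]%classic) fubini_F (lam p.+1) g s)).
    apply: ge0_le_integral => //; first exact: measurable_funTS.
    move=> s /=; rewrite in_itv/= => /andP[s1 _].
    have mNs : measurable [set x : 'rV[R]_p.+1 | N (consrV (s, x))].
      by rewrite -[X in measurable X]setTI; exact: measurable_consrV2.
    apply: (le_trans (sec s s1)).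
    by rewrite -[X in lam _ X]setIT -integral_indic.
  exact: ge0_subset_integral.
by rewrite N0 => U0; apply/eqP; rewrite eq_le U0 measure_ge0.
Qed.

End slices.

(** * The weight on the shell and the caps around the poles *)

Section kappa_bounds.
Context {R : realType} (n : nat).
Implicit Types z : 'rV[R]_(1 + n).

(** The exponent q: the squared cotangent of the angle to the polar axis. On the axis itself the
    inverse defaults to 0, so the value there is 0 and not infinite. *)
Definition slope2 z : R := (z 0 0 / enorm (rsubmx z)) ^+ 2.

Lemma slope2_ge0 z : 0 <= slope2 z.
Proof. exact: sqr_ge0. Qed.

Lemma sqr_enorm_head z : enorm z ^+ 2 = z 0 0 ^+ 2 + enorm (rsubmx z) ^+ 2.
Proof. by rewrite !sqr_enorm -{1 2}(consrV_eta z) dotp_consrV -expr2. Qed.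

Lemma kappaE t z : kappa t z = (enorm (rsubmx z))^-1 * expR (- (t * slope2 z)).
Proof. by []. Qed.

(** Raising [t] by 1 multiplies the weight by y = e^{-q}: integer steps in [t] give the moments of
    y. *)
Lemma kappaM j z : kappa (1 + j%:R) z = kappa 1 z * expR (- slope2 z) ^+ j.
Proof.
rewrite !kappaE mul1r -expRM_natl -mulrA -expRD; congr (_ * expR _); ring.
Qed.

(** With [N = |z'|], [N^2 (1 + q) = |z|^2 >= 1/4] gives [N^-1 <= 2 (1 + q)], while
    [e^(-tq) <= 1 / (1 + q)] for [t >= 1]. On the axis the default value 0 satisfies the bound. *)
Lemma kappa_le2 t z : 1 <= t -> shell z -> kappa t z <= 2.
Proof.
move=> t1 /andP[z2 z1]; rewrite kappaE.
set N := enorm _; have [N0|N0] := eqVneq N 0; first by rewrite N0 invr0 mul0r.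
have Np : 0 < N by rewrite lt0r N0 enorm_ge0.
pose q := slope2 z; have q0 : 0 <= q by exact: slope2_ge0.
have zN : enorm z ^+ 2 = N ^+ 2 * (1 + q).
  by rewrite sqr_enorm_head /q /slope2 -/N expr_div_n; field.
have e4 : 2^-1 ^+ 2 <= N ^+ 2 * (1 + q) by rewrite -zN lerXn2r ?nnegrE ?enorm_ge0 ?ltW// invr_ge0.
have iN : N^-1 <= 2 * (1 + q).
  have q1 : 0 <= 2 * (1 + q) by lra.
  rewrite -(ler_pXn2r (n := 2))// ?nnegrE ?invr_ge0 ?(ltW Np)//.
  rewrite exprVn -[leLHS]mul1r ler_pdivrMr ?exprn_gt0//.
  rewrite -/q; nra.
have : expR (- (t * q)) <= (1 + q)^-1.
  rewrite expRN lef_pV2 ?posrE ?expR_gt0//; last by lra.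
  apply: le_trans (expR_ge1Dx _) _; rewrite ler_expR; nra.
move=> eq; apply: (@le_trans _ _ ((2 * (1 + q)) * (1 + q)^-1)).
  by apply: ler_pM => //; rewrite ?invr_ge0 ?expR_ge0 ?ltW.
by rewrite mulfK// gt_eqF//; lra.
Qed.

Lemma measurable_slope2 : measurable_fun setT (slope2 : 'rV[R]_n.+1 -> R).
Proof.
have mr := measurableT_comp (@measurable_enorm R n) (@measurable_rsubmx R n).
have mi := measurable_inv (fun x => enorm_ge0 _) mr.
by apply: measurable_funX; apply: measurable_funM => //; exact: measurable_coor.
Qed.

Lemma dotp_dir_pole (m : nat) (B : 'M[R]_(1 + n, m)) z :
  B *m B^T = 1%:M -> dotp (dir (z *m B)) (row 0 B) = z 0 0 / enorm z.
Proof.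
move=> BB; have -> : row 0 B = delta_mx 0 0 *m B by rewrite -rowE.
rewrite /dir enorm_mulmx// scalemxAl dotp_mulmx// dotpZl mulrC; congr (_ / _).
rewrite /dotp (bigD1 0)//= big1 ?addr0 => [|i i0]; first by rewrite !mxE !eqxx mulr1.
by rewrite !mxE (negbTE i0) andbF mulr0.
Qed.

(** Off the axis [(z_0 / |z|)^2 = q / (1 + q)], so the cap of cosine [a] is bounded by
    [q = a^2 / (1 - a^2)]. *)
Lemma slope2_pole (a : R) z : 0 <= a < 1 -> rsubmx z != 0 ->
  a ^+ 2 / (1 - a ^+ 2) <= slope2 z -> a <= `|z 0 0 / enorm z|.
Proof.
move=> /andP[a0 a1] x0; set N := enorm (rsubmx z).
have N0 : 0 < N by rewrite enorm_gt0.
have z0 : 0 < enorm z.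
  by rewrite enorm_gt0; apply: contraNneq x0 => ->; rewrite linear0.
have a21 : a ^+ 2 < 1 by rewrite exprn_ilt1.
rewrite /slope2 -/N expr_div_n ler_pdivlMr ?exprn_gt0// mulrAC ler_pdivrMr ?subr_gt0//.
move=> h; rewrite -(ler_pXn2r (n := 2))// ?nnegrE// normrM normfV exprMn exprVn.
rewrite real_normK ?num_real// [`|enorm z|]gtr0_norm// ler_pdivlMr ?exprn_gt0//.
by rewrite sqr_enorm_head -/N; nra.
Qed.

End kappa_bounds.

Section shell_caps.
Local Open Scope ereal_scope.
Context {R : realType}.
Local Notation lam n := (@lebesgue_rV R n).

Definition shell_cap (p : nat) (q : R) : set 'rV[R]_p.+2 :=
  @shell R p.+2 `&` @slope2 R p.+1 @^-1` `[q, +oo[.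
Arguments shell_cap p q : clear implicits.

Lemma measurable_shell_cap p q : measurable (shell_cap p q).
Proof.
apply: measurableI; first exact: measurable_shell.
by rewrite -[X in measurable X]setTI; exact: measurable_slope2.
Qed.

(** The cap contains a small cube with head coordinate near 3/4 and the others in [[r, 3r]]. The
    cube stays off the axis, where [slope2] takes its default value. *)
Lemma shell_cap_gt0 p Q : (1 <= Q)%R -> 0 < lam p.+2 (shell_cap p Q).
Proof.
move=> Q1.
(* Coordinates at most [3r] give [|x|^2 <= 9 (p+1) r^2], so with 36 = 4 . 9 one gets
   [4 Q |x|^2 <= r], far below [s^2 > 1/2]. *)
pose r : R := (36 * p.+1%:R * Q)^-1%R.
have d0 : (0 < 36 * p.+1%:R * Q :> R)%R by rewrite !mulr_gt0//; lra.
have r0 : (0 < r)%R by rewrite invr_gt0.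
have p1 : (1 <= p.+1%:R :> R)%R by rewrite ler1n.
have r36 : (36 * p.+1%:R * Q * r = 1)%R by rewrite mulfV// gt_eqF.
have rle : (r <= 36^-1)%R.
  rewrite lef_pV2 ?posrE//.
  by rewrite -mulrA ler_peMr// mulr_ege1//; lra.
pose v : 'rV[R]_p.+2 := consrV (- (3 / 4), const_mx (- (2 * r)))%R.
have mC : measurable (@cube R p.+2 r) by exact: measurable_cube.
have := lebesgue_rV_affine v (oner_neq0 _) mC.
rewrite lebesgue_rV_cube ?(ltW r0)// normr1 expr1n mul1e => Cv.
apply: (@lt_le_trans _ _ (lam p.+2 [set z | cube r (1 *: z + v)%R])).
  by rewrite -Cv lte_fin exprn_gt0// mulr_gt0.
apply: le_measure; rewrite ?inE//.
- by rewrite -[X in measurable X]setTI; exact: measurable_affine_rV.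
- exact: measurable_shell_cap.
move=> z /= zC; rewrite -(consrV_eta (z : 'rV_(1 + p.+1))) in zC *.
move: (z _ _) (rsubmx _) zC => s x; rewrite /v consrVZD => zC.
have sC : (`|s - 3 / 4| <= r)%R.
  by have := zC 0%R; rewrite consrV_head mul1r.
have xC i : (`|x 0 i - 2 * r| <= r)%R.
  have := zC (@rshift 1 p.+1 i).
  by rewrite /consrV (@row_mxEr _ 1 1 p.+1) !mxE mul1r.
have xE i : (r <= x 0 i <= 3 * r)%R.
  by have := xC i; rewrite ler_norml => /andP[? ?]; apply/andP; split; lra.
have xe : (enorm x ^+ 2 <= 9 * p.+1%:R * r ^+ 2)%R.
  rewrite sqr_enorm; apply: (@le_trans _ _ (\sum_(i < p.+1) (9 * r ^+ 2))%R).
    by apply: ler_sum => i _; have /andP[? ?] := xE i; nra.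
  by rewrite sumr_const card_ord -[(_ *+ p.+1)%R]mulr_natl; lra.
have xe' : (4 * Q * enorm x ^+ 2 <= r)%R.
  apply: (@le_trans _ _ (4 * Q * (9 * p.+1%:R * r ^+ 2)))%R.
    by rewrite ler_wpM2l// mulr_ge0//; lra.
  have -> : (4 * Q * (9 * p.+1%:R * r ^+ 2) =
      36 * p.+1%:R * Q * r * r :> R)%R by ring.
  by rewrite r36 mul1r.
have x0 : x != 0%R.
  apply/eqP => x0; have /andP[] := xE ord0; rewrite x0 mxE => r_le0 _.
  by move: r0; rewrite ltNge r_le0.
have ex0 : (0 < enorm x)%R by rewrite enorm_gt0.
have zE := sqr_enorm_head (consrV (s, x) : 'rV_(1 + p.+1)).
rewrite consrV_head rsubmx_consrV in zE.
have [s1 s2] : (2^-1 < s ^+ 2 /\ s ^+ 2 < 7 / 10)%R.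
  by move: sC; rewrite ler_norml => /andP[? ?]; split; nra.
have xe2 : (enorm x ^+ 2 <= 1 / 144)%R by have := sqr_ge0 (enorm x); nra.
split; rewrite /shell/=.
  apply/andP; split.
    rewrite -(ltr_pXn2r (n := 2))// ?nnegrE ?enorm_ge0 ?invr_ge0// zE.
    by have := sqr_ge0 (enorm x); nra.
  by rewrite -(ler_pXn2r (n := 2))// ?nnegrE ?enorm_ge0// zE; nra.
rewrite in_itv/= andbT /slope2.
rewrite consrV_head rsubmx_consrV expr_div_n ler_pdivlMr ?exprn_gt0//.
nra.
Qed.

End shell_caps.

Section funk_injectivity.
Local Open Scope ereal_scope.
Context {R : realType} (n p : nat) (E : 'M[R]_n) (B : 'M[R]_(p.+2, n)).
Hypothesis BE : orthonormal_basis E B.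
Local Notation lam n := (@lebesgue_rV R n).
Local Notation mu := (@lebesgue_measure R).

Let BB : B *m B^T = 1%:M. Proof. by case: BE. Qed.

(** Up to one constant both sides are Gaussian averages of slice integrals. The slices agree for
    almost every [u], since the exceptional normals stay null in [u] by [surface_null_slices]. *)
Lemma integral_kappa_eq (f g : 'rV[R]_n -> R) t : (0 < t)%R ->
  measurable_fun setT f -> measurable_fun setT g ->
  (forall x, 0 <= f x)%R -> (forall x, 0 <= g x)%R ->
  {ae surface E, forall w, funk E f w = funk E g w /\ funk E g w < +oo} ->
  \int[lam p.+2]_z (cone_shell B f z * @kappa R p.+1 t z)%:E =
  \int[lam p.+2]_z (cone_shell B g z * @kappa R p.+1 t z)%:E.
Proof.
move=> t0 mf mg f0 g0 [A [mA A0 sA]].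
have [c c0 cE] := integral_gauss_slices p t0.
have mcs h : measurable_fun setT h -> measurable_fun setT (fun z => (cone_shell B h z)%:E).
  by move=> mh; apply/measurable_EFinP; exact: measurable_cone_shell.
have cs0 h : (forall x, 0 <= h x)%R -> forall z, 0 <= (cone_shell B h z)%:E.
  by move=> h0 z; rewrite lee_fin; exact: cone_shell_ge0.
have mc : measurable_fun setT
    (fun p : 'rV[R]_p.+1 * 'rV[R]_p.+1 => consrV (dotp p.1 p.2, p.2)).
  apply: (measurableT_comp (@measurable_consrVR R p.+1)).
  apply/measurable_fun_pairP; split.
    by apply: measurable_dotp; [exact: measurable_fst|exact: measurable_snd].
  exact: measurable_snd.
pose H h (q : 'rV[R]_p.+1 * 'rV[R]_p.+1) :=
  (gauss t q.1)%:E * (cone_shell B h (consrV (dotp q.1 q.2, q.2)))%:E.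
have mH h : measurable_fun setT h -> measurable_fun setT (H h).
  move=> mh; apply: emeasurable_funM; last exact: (measurableT_comp (mcs h mh) mc).
  apply/measurable_EFinP; apply: (measurableT_comp (measurable_gauss t)).
  exact: measurable_fst.
have H0 h : (forall x, 0 <= h x)%R -> forall q, 0 <= H h q.
  by move=> h0 q; rewrite mule_ge0 ?cs0// lee_fin expR_ge0.
have E12 : \int[lam p.+1]_u fubini_F (lam p.+1) (H f) u =
           \int[lam p.+1]_u fubini_F (lam p.+1) (H g) u.
  apply: ge0_ae_eq_integral => //.
  - exact: (@measurable_fun_fubini_tonelli_F _ _ _ _ _ _ _ (mH f mf) (H0 f f0)).
  - exact: (@measurable_fun_fubini_tonelli_F _ _ _ _ _ _ _ (mH g mg) (H0 g g0)).
  - by move=> u _; apply: integral_ge0 => x _; exact: H0.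
  - by move=> u _; apply: integral_ge0 => x _; exact: H0.
  exists [set u | A (hyperplane_normal B u)]; split.
  - by rewrite -[X in measurable X]setTI; exact: measurable_hyperplane_normal.
  - exact: (surface_null_slices BE).
  - move=> u /= hu; apply: sA => /= -[fg goo]; apply: hu => _.
    have [k k0 kE] := gauss_slice BE t u.
    rewrite /fubini_F/= /H/= (kE f mf f0) ?fg//.
    exact/esym/kE.
have := cE _ (mcs f mf) (cs0 f f0); have := cE _ (mcs g mg) (cs0 g g0).
move=> Eg Ef; have := etrans (esym Ef) (etrans E12 Eg).
have cV : c^-1%:E * c%:E = 1 :> \bar R by rewrite -EFinM mulVf ?gt_eqF.
move=> EE; have := congr1 (fun e => c^-1%:E * e) EE.
rewrite !muleA cV !mul1e => EE'.
transitivity (\int[lam p.+2]_z ((cone_shell B f z)%:E * (@kappa R p.+1 t z)%:E)).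
  by apply: eq_integral => z _; rewrite EFinM.
by rewrite EE'; apply: eq_integral => z _; rewrite EFinM.
Qed.

Lemma integral_cone_shell_lty (f : 'rV[R]_n -> R) :
  measurable_fun setT f -> (forall x, 0 <= f x)%R ->
  \int[surface E]_(x in sphere `&` rowset E) (f x)%:E < +oo ->
  \int[lam p.+2]_z (cone_shell B f z)%:E < +oo.
Proof.
move=> mf f0; rewrite (ge0_integral_sphere BE); last 2 first.
- by apply/measurable_EFinP; exact: measurable_funTS.
- by move=> x _; rewrite lee_fin.
have I0 : 0 <= \int[lam p.+2]_(c in @pball R p.+2) (f (dir (c *m B)))%:E.
  by apply: integral_ge0 => c _; rewrite lee_fin.
move=> foo; have : \int[lam p.+2]_(c in @pball R p.+2) (f (dir (c *m B)))%:E < +oo.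
  move: (\int[lam p.+2]_(c in @pball R p.+2) _) I0 foo => [x _ _|_|//].
    by rewrite ltry.
  by rewrite gt0_muley// lte_fin.
apply: le_lt_trans; rewrite [leRHS]integral_mkcond; apply: ge0_le_integral => //.
- by move=> z _; rewrite lee_fin; exact: cone_shell_ge0.
- by apply/measurable_EFinP; exact: measurable_cone_shell.
- apply/(measurable_restrictT _ (@measurable_pball R p.+2))/measurable_funTS.
  by apply/measurable_EFinP; exact: (measurableT_comp mf (measurable_dir_mulmx B)).
- move=> z _; rewrite patchE /cone_shell indicE; case: ifPn => zB.
    by rewrite lee_fin ler_piMr// lern1; case: (_ \in _).
  rewrite memNset ?mulr0// => zS; move/negP: zB; apply; apply/mem_set.
  move: zS; rewrite /shell /pball/= => /andP[z2 ->]; rewrite andbT.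
  by apply: lt_trans z2; rewrite invr_gt0.
Qed.

(** The weights are even in the head coordinate and cannot separate the pole [row 0 B] from its
    antipode; hence the absolute value in the description of the cap. *)
Lemma funk_no_strict_cap (f g : 'rV[R]_n -> R) (a : R) :
  measurable_fun setT f -> measurable_fun setT g ->
  (forall x, 0 <= f x)%R -> (forall x, 0 <= g x)%R ->
  \int[surface E]_(x in sphere `&` rowset E) (f x)%:E < +oo ->
  \int[surface E]_(x in sphere `&` rowset E) (g x)%:E < +oo ->
  {ae surface E, forall w, funk E f w = funk E g w /\ funk E g w < +oo} ->
  (0 <= a < 1)%R ->
  {ae surface E, forall eta, (sphere `&` rowset E) eta ->
    a <= `|dotp eta (row 0 B)| -> g eta < f eta}%R -> False.
Proof.
move=> mf mg f0 g0 foo goo fg a01 fgcap.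
have a21 : (0 < 1 - a ^+ 2)%R.
  by case/andP: a01 => a0 a1; rewrite subr_gt0 exprn_ilt1.
pose F := cone_shell B f; pose G := cone_shell B g.
have mF : measurable_fun setT F by exact: measurable_cone_shell.
have mG : measurable_fun setT G by exact: measurable_cone_shell.
have F0 z : (0 <= F z)%R by exact: cone_shell_ge0.
have G0 z : (0 <= G z)%R by exact: cone_shell_ge0.
have iF : (lam p.+2).-integrable setT (EFin \o F).
  apply/integrableP; split; first exact/measurable_EFinP.
  have := integral_cone_shell_lty mf f0 foo; apply: le_lt_trans.
  by rewrite le_eqVlt; apply/orP; left; apply/eqP/eq_integral => z _; rewrite /= ger0_norm.
have iG : (lam p.+2).-integrable setT (EFin \o G).
  apply/integrableP; split; first exact/measurable_EFinP.
  have := integral_cone_shell_lty mg g0 goo; apply: le_lt_trans.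
  by rewrite le_eqVlt; apply/orP; left; apply/eqP/eq_integral => z _; rewrite /= ger0_norm.
pose kap t : 'rV[R]_p.+2 -> R := @kappa R p.+1 t.
have mkap t : measurable_fun setT (kap t) by exact: measurable_kappa.
have shell_bnd h t z : (1 <= t)%R -> (0 <= cone_shell B h z)%R ->
    (cone_shell B h z * kap t z <= cone_shell B h z * 2)%R.
  move=> t1; rewrite /cone_shell indicE; case: (boolP (z \in _)) => [/set_mem zs|_].
    by rewrite mulr1 => h0; rewrite ler_wpM2l//; exact: kappa_le2.
  by rewrite mulr0 !mul0r.
have iFk t : (1 <= t)%R -> (lam p.+2).-integrable setT (fun z => (F z * kap t z)%:E).
  move=> t1; have iF2 := integrableZr measurableT 2%R iF.
  apply: le_integrable iF2 => //; first by apply/measurable_EFinP; exact: measurable_funM.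
  move=> z _; rewrite lee_fin ger0_norm; last by rewrite mulr_ge0// kappa_ge0.
  by apply: le_trans (ler_norm _); exact: shell_bnd.
have iGk t : (1 <= t)%R -> (lam p.+2).-integrable setT (fun z => (G z * kap t z)%:E).
  move=> t1; have iG2 := integrableZr measurableT 2%R iG.
  apply: le_integrable iG2 => //; first by apply/measurable_EFinP; exact: measurable_funM.
  move=> z _; rewrite lee_fin ger0_norm; last by rewrite mulr_ge0// kappa_ge0.
  by apply: le_trans (ler_norm _); exact: shell_bnd.
pose D z := ((F z - G z) * kap 1 z)%R.
pose y z : R := expR (- @slope2 R p.+1 z).
have my : measurable_fun setT (y : 'rV[R]_p.+2 -> R).
  apply: (measurableT_comp (@measurable_expR R)); apply: measurable_funN.
  exact: measurable_slope2.
have y01 z : (0 <= y z <= 1)%R.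
  by rewrite expR_ge0/= /y expRN invf_le1 ?expR_gt0// -expR0 ler_expR slope2_ge0.
have iD : (lam p.+2).-integrable setT (EFin \o D).
  have := integrableB measurableT (iFk 1%R (lexx _)) (iGk 1%R (lexx _)).
  apply: eq_integrable => // z _ /=.
  by rewrite -EFinB /D mulrBl.
have mom i : \int[lam p.+2]_z (D z * y z ^+ i)%:E = 0.
  have t1 : (1 <= 1 + i%:R :> R)%R by rewrite lerDl.
  have t0 : (0 < 1 + i%:R :> R)%R by apply: lt_le_trans t1.
  transitivity (\int[lam p.+2]_z ((F z * kap (1 + i%:R) z)%:E - (G z * kap (1 + i%:R) z)%:E)).
    apply: eq_integral => z _; rewrite -EFinB /D /kap kappaM -/(y z).
    by congr EFin; ring.
  rewrite (integralB measurableT (iFk _ t1) (iGk _ t1)).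
  rewrite (integral_kappa_eq t0 mf mg f0 g0 fg) subee//.
  exact: (integrable_fin_num measurableT (iGk _ t1)).
pose zz z := (1 - y z)%R.
have mzz : measurable_fun setT zz by apply: measurable_funB.
have zz01 z : (0 <= zz z <= 1)%R by have := y01 z; rewrite /zz => /andP[? ?]; lra.
have mD : measurable_fun setT D.
  by apply: measurable_funM => //; exact: measurable_funB.
have iDyz i j : (lam p.+2).-integrable setT (fun z => (D z * y z ^+ i * zz z ^+ j)%:E).
  apply: le_integrable iD => //.
    apply/measurable_EFinP; apply: measurable_funM; last exact: measurable_funX.
    by apply: measurable_funM => //; exact: measurable_funX.
  move=> z _ /=; rewrite lee_fin !normrM -mulrA ler_piMr//.
  have /andP[ya yb] := y01 z; have /andP[za zb] := zz01 z.
  rewrite !normrX (ger0_norm ya) (ger0_norm za).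
  by rewrite mulr_ile1 ?exprn_ge0// exprn_ile1.
(* As [zz = 1 - y], raising [j] by one splits the integral into the cases [i] and [i.+1]: the
   exponent of [y] must vary in the induction. *)
have mom2 j i : \int[lam p.+2]_z (D z * y z ^+ i * zz z ^+ j)%:E = 0.
  elim: j i => [|j IH] i.
    by rewrite -[RHS](mom i); apply: eq_integral => z _; rewrite mulr1.
  transitivity (\int[lam p.+2]_z ((D z * y z ^+ i * zz z ^+ j)%:E -
      (D z * y z ^+ i.+1 * zz z ^+ j)%:E)).
    by apply: eq_integral => z _; rewrite -EFinB /zz !exprS; congr EFin; ring.
  by rewrite (integralB measurableT (iDyz _ _) (iDyz _ _)) !IH sube0.
have mom3 j : \int[lam p.+2]_z (D z * zz z ^+ j)%:E = 0.
  by rewrite -[RHS](mom2 j 0%N); apply: eq_integral => z _; rewrite expr0 mulr1.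
(* Slope at least [Q] puts the direction in the cap where [g < f]. The larger slope [Q + 1] leaves
   the gap between [z0] and [z1] that makes the powers decay, and is at least 1 as [shell_cap_gt0]
   requires. *)
pose Q := (a ^+ 2 / (1 - a ^+ 2))%R.
have Q0 : (0 <= Q)%R by rewrite divr_ge0 ?sqr_ge0// ltW.
pose z0 := (1 - expR (- Q))%R; pose z1 := (1 - expR (- (Q + 1)))%R.
have z001 : (0 <= z0 < z1)%R.
  rewrite /z0 /z1 subr_ge0 expRN invf_le1 ?expR_gt0// -{1}expR0 ler_expR Q0/=.
  by rewrite ltrD2l ltrN2 -expRN ltr_expR; lra.
have Q1 : (1 <= Q + 1)%R by rewrite lerDr.
pose A := @shell_cap R p (Q + 1)%R.
have mA : measurable A by exact: measurable_shell_cap.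
have Azz z : A z -> (z1 <= zz z)%R.
  by case=> _ /=; rewrite in_itv/= andbT lerD2l lerN2 ler_expR lerN2.
have [N [mN N0 sN]] := fgcap.
pose NZ := (fun z => dir (z *m B)) @^-1` N `&` @pball R p.+2.
have mNZ : measurable NZ.
  apply: measurableI; last exact: measurable_pball.
  by rewrite -[X in measurable X]setTI; exact: measurable_dir_mulmx.
have NZ0 : lam p.+2 NZ = 0.
  move: N0; rewrite (surface_orthonormal_basis BE mN) => /eqP.
  by rewrite mule_eq0 eqe pnatr_eq0 => /orP[//|/eqP].
have Dpos z : ~ NZ z -> @shell R p.+2 z -> rsubmx (z : 'rV_(1 + p.+1)) != 0%R ->
    (z0 <= zz z)%R -> (0 < D z)%R.
  move=> zN zs x0 zQ.
  have zB : @pball R p.+2 z.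
    move: zs; rewrite /shell /pball/= => /andP[z2 ->]; rewrite andbT.
    by apply: lt_trans z2; rewrite invr_gt0.
  have zn0 : z != 0%R by rewrite -enorm_gt0; case/andP: zB.
  have gf : (g (dir (z *m B)) < f (dir (z *m B)))%R.
    apply: contrapT => gf; apply: zN; split=> //; apply: sN => /= H; apply: gf.
    apply: H; first exact: sphere_dir_mulmx.
    rewrite dotp_dir_pole//; apply: slope2_pole => //.
    by move: zQ; rewrite /z0 /zz lerD2l lerN2 ler_expR lerN2.
  rewrite /D /F /G /cone_shell indicE mem_set// !mulr1 mulr_gt0 ?subr_gt0//.
  by rewrite /kap kappaE mulr_gt0 ?expR_gt0// invr_gt0 enorm_gt0.
have NZae (P : 'rV[R]_p.+2 -> Prop) : (forall z, ~ NZ z -> P z) ->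
    {ae lam p.+2, forall z, P z}.
  by move=> h; exists NZ; split=> // z /= nP; apply: contrapT => /h.
have A0 : lam p.+2 A = 0.
  apply: (integral_powers_null iD mzz zz01 z001 mA Azz) => //.
    apply: NZae => z zN zQ.
    have [zs|zs] := pselect (@shell R p.+2 z); last first.
      by rewrite /D /F /G /cone_shell indicE memNset// !mulr0 subrr mul0r.
    (* On the axis the default value of [kappa] is 0, so [D] vanishes and the weak inequality
       holds. *)
    have [x0|x0] := eqVneq (rsubmx (z : 'rV_(1 + p.+1))) 0%R; last exact/ltW/Dpos.
    by rewrite /D /kap kappaE x0 enorm0 invr0 mul0r mulr0.
  apply: NZae => z zN Az; have zQ := Azz z Az; have [z00 z0z1] := andP z001.
  apply: Dpos => //; [by case: Az| |exact: le_trans (ltW z0z1) zQ].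
  (* The axis does not meet the cap [A]: there [slope2] defaults to 0, so [zz = 0 < z1]. *)
  apply: contraTneq zQ => x0; rewrite -ltNge /zz /y /slope2 x0 enorm0 invr0 mulr0.
  by rewrite expr0n/= oppr0 expR0 subrr (le_lt_trans z00).
by have := shell_cap_gt0 p Q1; rewrite -/A A0 ltxx.
Qed.

End funk_injectivity.

(** * Euclidean inequalities *)

Section triangle.
Context {R : realType}.

Lemma dotpDl n (x y z : 'rV[R]_n) : dotp (x + y) z = dotp x z + dotp y z.
Proof. by rewrite !dotpE mulmxDl mxE. Qed.

Lemma dotpDr n (x y z : 'rV[R]_n) : dotp z (x + y) = dotp z x + dotp z y.
Proof. by rewrite dotpC dotpDl !(dotpC z). Qed.

Lemma dotpNl n (x z : 'rV[R]_n) : dotp (- x) z = - dotp x z.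
Proof. by rewrite -scaleN1r dotpZl mulN1r. Qed.

Lemma sqr_enormD n (x y : 'rV[R]_n) :
  enorm (x + y) ^+ 2 = enorm x ^+ 2 + 2 * dotp x y + enorm y ^+ 2.
Proof. by rewrite !sqr_enorm dotpDl !dotpDr (dotpC y x); ring. Qed.

Lemma dotp_le_enorm n (x y : 'rV[R]_n) : dotp x y <= enorm x * enorm y.
Proof.
have [x0|x0] := eqVneq x 0.
  by rewrite x0 enorm0 mul0r /dotp big1// => i _; rewrite mxE mul0r.
have [y0|y0] := eqVneq y 0.
  by rewrite y0 enorm0 mulr0 /dotp big1// => i _; rewrite mxE mulr0.
have ex : 0 < enorm x by rewrite enorm_gt0.
have ey : 0 < enorm y by rewrite enorm_gt0.
have := sqr_ge0 (enorm (enorm y *: x + (- enorm x) *: y)).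
rewrite sqr_enormD !enormZ normrN !gtr0_norm// dotpZl dotpZr => h.
have : 0 < 2 * (enorm x * enorm y) by rewrite !mulr_gt0.
move=> /ler_pM2l <-; nra.
Qed.

Lemma enormD n (x y : 'rV[R]_n) : enorm (x + y) <= enorm x + enorm y.
Proof.
rewrite -(ler_pXn2r (n := 2))// ?nnegrE ?addr_ge0 ?enorm_ge0// sqr_enormD.
by have := dotp_le_enorm x y; nra.
Qed.

(** Normalizing moves [y] by the distance of its norm from 1, which is at most [|x - y|] because
    [|x| = 1]. *)
Lemma enorm_dirB n (x y : 'rV[R]_n) : y != 0 -> enorm x = 1 ->
  enorm (x - dir y) <= 2 * enorm (x - y).
Proof.
move=> y0 x1; have ey : enorm y != 0 by rewrite enorm_eq0.
have -> : x - dir y = (x - y) + (y - dir y) by rewrite addrA subrK.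
apply: (le_trans (enormD _ _)).
have -> : y - dir y = (enorm y - 1) *: dir y.
  by rewrite /dir scalerA mulrBl mulfV// mul1r scalerBl scale1r.
rewrite enormZ enorm_dir// mulr1 mulr2n mulrDl mul1r lerD2l.
have h1 := enormD (x - y) y; have h2 := enormD (y - x) x.
rewrite !subrK x1 in h1 h2; rewrite -(enormN (y - x)) opprB in h2.
by rewrite ler_norml; apply/andP; split; lra.
Qed.

Lemma dotp_evec n i (x : 'rV[R]_n) (j : 'I_n) : j.+1 = i ->
  dotp x (evec n i) = x 0 j.
Proof.
move=> <-; rewrite /dotp (bigD1 j)//= big1 ?addr0 => [|l lj].
  by rewrite mxE eqxx mulr1.
rewrite mxE eqSS (_ : (nat_of_ord l == j) = false) ?mulr0//.
by apply: contraNF lj => /eqP e; apply/eqP/val_inj.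
Qed.

End triangle.

Lemma big_nat_shift (T : Type) (idx : T) (op : T -> T -> T) m k (F : nat -> T) :
  \big[op/idx]_(m <= i < (m + k).+1) F i = \big[op/idx]_(i < k.+1) F (m + i)%N.
Proof.
rewrite -{1}[m]add0n big_addn -addnS addKn big_mkord.
by apply: eq_bigr => i _; rewrite addnC.
Qed.

(** * The subspaces tgamma_v R^{k+1} *)

Section frames.
Context {R : realType} (m k : nat) (m0 : (0 < m)%N).

(** Rows e_m, ..., e_{m+k} in the 1-based numbering of [evec]; for [m = 0] the first row would be 0,
    hence [m0]. *)
Definition Rk1_frame : 'M[R]_(k.+1, m + k) :=
  \matrix_(i, j) (j.+1 == m + i)%N%:R.

Lemma row_Rk1_frame i : row i Rk1_frame = evec (m + k) (m + i).
Proof. by apply/rowP => j; rewrite !mxE. Qed.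

Lemma Rk1_sum : @Rk1 R m k = (\sum_(i < k.+1) <<evec (m + k) (m + i)>>)%MS.
Proof.
exact: big_nat_shift.
Qed.

Lemma Rk1_frameP : orthonormal_basis (Rk1 m k) Rk1_frame.
Proof.
split.
  apply/matrixP => i j; rewrite !mxE.
  have ni : ((m + i).-1 < m + k)%N.
    by rewrite prednK ?addn_gt0 ?m0// leq_add2l -ltnS.
  have e : ((m + i).-1).+1 = (m + i)%N by rewrite prednK// addn_gt0 m0.
  rewrite (bigD1 (Ordinal ni))//= !mxE/= e eqxx mul1r big1 ?addr0.
    by rewrite eqn_add2l.
  move=> l li; rewrite !mxE (_ : (l.+1 == m + i)%N = false) ?mul0r//.
  by apply: contraNF li => /eqP li; apply/eqP/val_inj; rewrite /= -li.
rewrite Rk1_sum; apply/andP; split.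
  apply/row_subP => i; rewrite row_Rk1_frame.
  by apply: (sumsmx_sup i) => //; rewrite genmxE.
apply/sumsmx_subP => i _; rewrite genmxE -row_Rk1_frame; exact: row_sub.
Qed.

Lemma rank_Rk1 : \rank (@Rk1 R m k) = k.+1.
Proof. exact: orthonormal_basis_rank Rk1_frameP. Qed.

Lemma evec_Rk1 i : (m <= i <= m + k)%N -> (evec (m + k) i <= @Rk1 R m k)%MS.
Proof.
move=> /andP[mi ik]; have ik' : (i - m < k.+1)%N by rewrite ltnS leq_subLR.
rewrite Rk1_sum; apply: (sumsmx_sup (Ordinal ik')) => //.
by rewrite genmxE /= subnKC.
Qed.

Lemma evec_row_mx0 : (0 < k)%N ->
  evec (m + k) (m + k) = row_mx 0 (evec k k) :> 'rV[R]_(m + k).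
Proof.
move=> k0; apply/rowP => j; rewrite mxE; have [i ->|i ->] := split_ordP j.
  rewrite row_mxEl mxE/= (_ : (_ == _) = false)//; apply/negbTE.
  by rewrite neq_ltn (leq_ltn_trans (ltn_ord i))// -[X in (X < _)%N]addn0 ltn_add2l.
by rewrite row_mxEr mxE/= -addnS eqn_add2l.
Qed.

Lemma evec_row_mxl : (0 < k)%N ->
  evec (m + k) m = row_mx (evec m m) 0 :> 'rV[R]_(m + k).
Proof.
move=> k0; apply/rowP => j; rewrite mxE; have [i ->|i ->] := split_ordP j.
  by rewrite row_mxEl mxE.
rewrite row_mxEr mxE/= (_ : (_ == _) = false)//; apply/negbTE.
by rewrite neq_ltn ltnS leq_addr orbT.
Qed.

Context (gamma : 'rV[R]_m -> 'M[R]_m) (rg : rotation_family gamma).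

Lemma tgamma_orthogonal v : sphere v -> orthogonal_mx (tgamma k gamma v).
Proof.
move=> /rg[og _]; rewrite /orthogonal_mx /tgamma tr_block_mx !trmx0 trmx1.
rewrite mulmx_block !mulmx0 !mul0mx !mulmx1 !addr0 !add0r og.
by rewrite -scalar_mx_block.
Qed.

Lemma row_mx_tgamma v (x : 'rV[R]_m) (y : 'rV[R]_k) :
  row_mx x y *m tgamma k gamma v = row_mx (x *m gamma v) y.
Proof. by rewrite /tgamma mul_row_block !mulmx0 addr0 add0r mulmx1. Qed.

(** [tgamma] is orthogonal and fixes e_n, so it keeps every point on its side of the hyperplane
    orthogonal to e_n. *)
Lemma dotp_tgamma v (x : 'rV[R]_(m + k)) : (0 < k)%N -> sphere v ->
  dotp (x *m tgamma k gamma v) (evec (m + k) (m + k)) = dotp x (evec (m + k) (m + k)).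
Proof.
move=> k0 sv; rewrite -{1}(dotp_mulmx x (evec (m + k) (m + k)) (tgamma_orthogonal sv)).
by rewrite evec_row_mx0// row_mx_tgamma mul0mx.
Qed.

Lemma tgamma_decomposition (theta : 'rV[R]_(m + k)) : (0 < k)%N ->
  sphere theta -> lsubmx theta != 0 ->
  let v := (enorm (lsubmx theta))^-1 *: lsubmx theta in
  let eta := row_mx (enorm (lsubmx theta) *: evec m m) (rsubmx theta) in
  [/\ sphere v, Sk m k eta & theta = eta *m tgamma k gamma v].
Proof.
move=> k0 th1 th0 v eta.
have sv : sphere v by exact: enorm_dir.
have e0 : enorm (lsubmx theta) != 0 by rewrite enorm_eq0.
have em : enorm (evec m m : 'rV[R]_m) = 1.
  have mm : (m.-1 < m)%N by rewrite prednK.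
  rewrite /enorm (@dotp_evec _ _ m _ (Ordinal mm)) ?mxE/= ?prednK// eqxx.
  exact: sqrtr1.
have tE : theta = eta *m tgamma k gamma v.
  rewrite row_mx_tgamma -scalemxAl; have [_ ->] := rg sv.
  by rewrite /v scalerA mulfV// scale1r hsubmxK.
split=> //; split.
  by rewrite /sphere/= -(enorm_mulmx _ (tgamma_orthogonal sv)) -tE.
rewrite /rowset/= /eta (_ : row_mx _ _ = enorm (lsubmx theta) *: evec (m + k) m +
   \sum_(j < k) rsubmx theta 0 j *: evec (m + k) (m + j.+1)).
  apply: addmx_sub; first by apply/scalemx_sub/evec_Rk1; rewrite leqnn leq_addr.
  apply: summx_sub => j _; apply/scalemx_sub/evec_Rk1.
  by rewrite leq_addr leq_add2l ltn_ord.
rewrite evec_row_mxl// scale_row_mx scaler0.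
have -> : \sum_(j < k) rsubmx theta 0 j *: evec (m + k) (m + j.+1) =
    row_mx 0 (rsubmx theta).
  apply/rowP => l; rewrite summxE; have [i ->|i ->] := split_ordP l.
    rewrite row_mxEl mxE big1// => j _; rewrite !mxE/= (_ : (_ == _) = false) ?mulr0//.
    by apply/negbTE; rewrite neq_ltn (leq_ltn_trans (ltn_ord i))// addnS ltnS leq_addr.
  rewrite row_mxEr (bigD1 i)//= !mxE/= addnS eqxx mulr1 big1 ?addr0// => j ji.
  rewrite !mxE/= addnS eqSS eqn_add2l (_ : (_ == _) = false) ?mulr0//.
  by apply: contraNF ji => /eqP e; apply/eqP/val_inj.
by rewrite add_row_mx addr0 add0r.
Qed.

End frames.

(** * Density of the points where theta' and theta_n do not vanish *)

Section dense.
Context {R : realType} (m k : nat).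

(** Moving [th] slightly along [u = e_1 + e_n] and projecting back to the sphere makes both the
    first and the last coordinate nonzero; continuity of [f] and [g] then excludes a gap at [th]. *)
Lemma eq_sphere_by_continuity (f g : 'rV[R]_(m + k) -> R) :
  (1 < m)%N -> (0 < k)%N ->
  {within sphere, continuous f} -> {within sphere, continuous g} ->
  (forall theta, sphere theta -> lsubmx theta != 0 ->
     dotp theta (evec (m + k) (m + k)) != 0 -> f theta = g theta) ->
  forall theta, sphere theta -> f theta = g theta.
Proof.
move=> m1 k0 /within_continuous_enormP cf /within_continuous_enormP cg fg th sth.
apply/eqP; rewrite -subr_eq0 -normr_eq0; apply: contraT => d0.
pose e := `|f th - g th| / 2.
have e0 : 0 < e by rewrite divr_gt0// lt0r d0 normr_ge0.
have [d1 d10 P1] := cf th sth e e0; have [d2 d20 P2] := cg th sth e e0.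
pose d := Num.min d1 d2; have dgt0 : 0 < d by rewrite lt_min d10 d20.
have m0 : (0 < m)%N by exact: ltnW.
pose i1 : 'I_m := Ordinal m0; pose j1 : 'I_(m + k) := lshift k i1.
have nn : ((m + k).-1 < m + k)%N by rewrite prednK// addn_gt0 m0.
pose jn := Ordinal nn.
pose u : 'rV[R]_(m + k) := \row_j ((j == j1) || (j == jn))%:R.
have jn1 : jn != j1.
  rewrite -val_eqE/= -lt0n -ltnS prednK ?addn_gt0 ?m0//.
  by rewrite (leq_trans m1)// leq_addr.
have uj1 : u 0 j1 = 1 by rewrite mxE eqxx.
have ujn : u 0 jn = 1 by rewrite mxE eqxx orbT.
have u0 : 0 < enorm u by apply: lt_le_trans (ler_norm_enorm u j1); rewrite uj1 normr1.
(* Projection to the sphere at most doubles the displacement; 4 leaves room for a strict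
   inequality. *)
pose t0 := d / (4 * enorm u); have t00 : 0 < t0 by rewrite divr_gt0// mulr_gt0.
have [t /andP[tp tt] [ta tb]] : exists2 t, 0 < t <= t0 &
    (th 0 j1 + t != 0) /\ (th 0 jn + t != 0).
  (* For [c < 0] the sum [c + t] stays negative up to [t = - c / 2]; for [c >= 0] it is positive for
     every [t > 0]. *)
  pose s (c : R) := if c < 0 then - c / 2 else t0.
  have sp c : 0 < s c by rewrite /s; case: ifP => // c0; lra.
  have sn c t : 0 < t -> t <= s c -> c + t != 0.
    rewrite /s; case: (ltP c 0) => c0 t1 t2; first by rewrite lt_eqF//; lra.
    by rewrite gt_eqF//; lra.
  exists (Num.min t0 (Num.min (s (th 0 j1)) (s (th 0 jn)))).
    by rewrite !lt_min t00 !sp/= ge_min lexx.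
  split; apply: sn; rewrite ?lt_min ?t00 ?sp// !ge_min lexx ?orbT//.
pose y := th + t *: u.
have y1 : y 0 j1 != 0 by rewrite !mxE eqxx mulr1.
have yn : y 0 jn != 0 by rewrite !mxE eqxx orbT mulr1.
have y0 : y != 0 by apply: contraNneq y1 => ->; rewrite mxE.
have iy : (enorm y)^-1 != 0 by rewrite invr_eq0 enorm_eq0.
have near : enorm (th - dir y) < d.
  apply: (le_lt_trans (enorm_dirB y0 sth)).
  rewrite /y opprD addNKr -scaleNr enormZ normrN gtr0_norm//.
  have : t * enorm u <= d / 4.
    by rewrite -ler_pdivlMr// -mulrA -invfM.
  lra.
have sy : sphere (dir y) by exact: enorm_dir.
have E : f (dir y) = g (dir y).
  apply: fg => //.
    apply: contraNneq (mulf_neq0 iy y1) => /rowP/(_ i1).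
    by rewrite !mxE => ->.
  have jnE : jn.+1 = (m + k)%N by rewrite /= prednK// addn_gt0 m0.
  by rewrite (dotp_evec _ jnE) /dir mxE mulf_neq0.
have := P1 _ sy (lt_le_trans near _); have := P2 _ sy (lt_le_trans near _).
rewrite /d !ge_min !lexx orbT => /(_ isT) h2 /(_ isT) h1.
have := ler_distD (f (dir y)) (f th) (g th); rewrite {2}E [X in _ <= _ + X]distrC.
by rewrite /e in h1 h2; lra.
Qed.

End dense.

Section star_body_bound.
Context {R : realType}.

Lemma compact_enorm_bounded n (K : set 'rV[R]_n) : compact K ->
  exists2 M, 0 <= M & forall x, K x -> enorm x <= M.
Proof.
move=> /compact_bounded[M [_ /(_ (`|M| + 1))]].
rewrite (le_lt_trans (ler_norm M)) ?ltrDl// => /(_ isT) KM.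
have M1 : 0 <= `|M| + 1 by rewrite addr_ge0.
exists ((`|M| + 1) * n.+1%:R); first by rewrite mulr_ge0.
move=> x Kx; rewrite -(ler_pXn2r (n := 2))// ?nnegrE ?enorm_ge0 ?mulr_ge0//.
rewrite sqr_enorm; apply: (@le_trans _ _ (\sum_(i < n) (`|M| + 1) ^+ 2)).
  apply: ler_sum => i _; rewrite -expr2 -real_normK ?num_real// lerXn2r ?nnegrE//.
  apply: le_trans (KM _ Kx); rewrite [leRHS]/Num.norm/= mx_normrE.
  by apply/bigmax_geP; right => /=; exists (0, i).
rewrite sumr_const card_ord -[_ *+ n]mulr_natr exprMn ler_wpM2l ?sqr_ge0//.
by rewrite -natrX ler_nat (leq_trans (leqnSn n))// -mulnn leq_pmulr.
Qed.

Lemma radial_bounded n (K : set 'rV[R]_n) : star_body K ->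
  exists2 M, 0 <= M & forall x, radial K (dir x) <= M.
Proof.
move=> sK; have [cK _ _ _] := sK.
have [M M0 KM] := compact_enorm_bounded cK; exists M => // x.
have [->|x0] := eqVneq x 0; first by rewrite /dir scaler0 radial0.
have dx : dir x != 0 by rewrite -enorm_eq0 enorm_dir// oner_eq0.
have r0 := radial_ge0 sK dx.
have /KM : K (radial K (dir x) *: dir x) by apply/radialP.
by rewrite enormZ enorm_dir// mulr1 ger0_norm.
Qed.

End star_body_bound.

(** * Null sets of the surface measure *)

Section ae_surface.
Local Open Scope ereal_scope.
Context {R : realType} (n d : nat) (E : 'M[R]_n) (B : 'M[R]_(d, n)).
Hypothesis BE : orthonormal_basis E B.

(** [surface E] lives on the whole space but charges only the unit sphere of [E]: directions of
    points of the punctured ball lie there. *)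
Lemma ae_surface_sphere (P : 'rV[R]_n -> Prop) :
  (forall w, (sphere `&` rowset E) w -> P w) -> {ae surface E, forall w, P w}.
Proof.
move=> h; exists (~` (sphere `&` rowset E)); split.
- by apply: measurableC; exact: measurable_sphere_rowset.
- rewrite (surface_orthonormal_basis BE); last first.
    by apply: measurableC; exact: measurable_sphere_rowset.
  rewrite (_ : _ `&` _ = set0) ?measure0 ?mule0//.
  apply/seteqP; split=> // c [nS /andP[c0 _]]; apply: nS.
  by apply: sphere_dir_mulmx => //; rewrite -enorm_gt0.
- by move=> w /= nP Sw; apply: nP; exact: h.
Qed.

(** The ball is symmetric and [dir] is odd. This transfers an almost sure identity near [eta] to the
    antipodal points. *)
Lemma ae_surface_opp (P : 'rV[R]_n -> Prop) :
  {ae surface E, forall w, P w} -> {ae surface E, forall w, P (- w)%R}.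
Proof.
move=> [N [mN N0 sN]].
have mopp : measurable_fun setT (fun u : 'rV[R]_n => - u)%R.
  rewrite (_ : (fun _ => _) = fun u => (-1 *: u + 0)%R); last first.
    by apply/funext => u; rewrite scaleN1r addr0.
  exact: measurable_affine_rV.
have mN' : measurable (-%R @^-1` N) by rewrite -[X in measurable X]setTI; exact: mopp.
exists (-%R @^-1` N); split => //; last by move=> w /= nP; apply: sN.
move: N0; rewrite !(surface_orthonormal_basis BE)// => <-; congr (_ * _).
have mD : measurable ((fun c => dir (c *m B)) @^-1` N `&` @pball R d).
  apply: measurableI; last exact: measurable_pball.
  by rewrite -[X in measurable X]setTI; exact: measurable_dir_mulmx.
have N10 : (-1 != 0 :> R)%R by rewrite oppr_eq0 oner_neq0.
rewrite (lebesgue_rV_affine 0%R N10 mD) normrN1 expr1n mul1e.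
congr (lebesgue_rV d _); apply/seteqP; split=> c /=;
  by rewrite /pball/= addr0 scaleN1r mulNmx dirN enormN.
Qed.

End ae_surface.

(** The factor [k] of the surface measure, the [1 / 2k] of the density and the two equal halves
    cancel; this has to hold for an infinite volume too. *)
Lemma mule_half_double (R : realType) (k : nat) (x : \bar R) : (0 <= x)%E ->
  (k.+1%:R%:E * (((2 * k.+1%:R)^-1)%:E * (x + x)) = x)%E.
Proof.
have k0 : 0 < k.+1%:R :> R by rewrite ltr0n.
case: x => [x _|_|//].
  by rewrite -EFinD -!EFinM; congr EFin; field; rewrite gt_eqF.
by rewrite addye// !gt0_muley ?lte_fin// invr_gt0 mulr_gt0.
Qed.

(** * The even density with Funk transform v_v^+- *)

Section section_function.
Context {R : realType} (m p : nat) (gamma : 'rV[R]_m -> 'M[R]_m).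
Context (K : set 'rV[R]_(m + p.+1)) (eps : bool) (v : 'rV[R]_m).
Hypotheses (m0 : (0 < m)%N) (rg : rotation_family gamma) (sK : star_body K).
Hypothesis sv : sphere v.
Local Notation k := p.+1.
Local Notation n := (m + p.+1)%N.
Local Notation E := (@Rk1 R m p.+1).
Local Notation S := (sphere `&` rowset E).
Local Notation G := (tgamma k gamma v).
Local Notation lam d := (@lebesgue_rV R d).

Let oG : orthogonal_mx G. Proof. exact: tgamma_orthogonal. Qed.
Let rE : \rank E = p.+2. Proof. exact: rank_Rk1. Qed.

Let inhalf (x : 'rV[R]_n) : bool := 0 < (-1) ^+ eps * dotp x (evec n n).

(** Through [dir] this is of degree 0 on the whole space, as [lebesgue_rV_radial] requires. *)
Definition half_radial (x : 'rV[R]_n) : R := (inhalf x)%:R * radial K (dir (x *m G)).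

Definition half_density (x : 'rV[R]_n) : R :=
  (2 * k%:R)^-1 * (half_radial x ^+ k + half_radial (- x) ^+ k).

Lemma half_radial_ge0 x : 0 <= half_radial x.
Proof.
rewrite mulr_ge0//; have [->|x0] := eqVneq (dir (x *m G)) 0; first by rewrite radial0.
exact: radial_ge0.
Qed.

Lemma half_density_ge0 x : 0 <= half_density x.
Proof. by rewrite mulr_ge0 ?invr_ge0// addr_ge0// exprn_ge0// half_radial_ge0. Qed.

Lemma half_densityN x : half_density (- x) = half_density x.
Proof. by rewrite /half_density opprK addrC. Qed.

Lemma half_radialZ t x : 0 < t -> half_radial (t *: x) = half_radial x.
Proof.
move=> t0; rewrite /half_radial -scalemxAl dirZ//; congr (_%:R * _).
by rewrite /inhalf dotpZl mulrCA pmulr_rgt0.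
Qed.

Let measurable_inhalf : measurable_fun setT inhalf.
Proof.
apply: measurable_fun_ltr => //; apply: measurable_funM => //.
by apply: measurable_dotp => //; exact: measurable_id.
Qed.

Lemma measurable_half_radial : measurable_fun setT half_radial.
Proof.
apply: measurable_funM; first exact: measurable_natr_bool.
exact: (measurableT_comp (measurable_radial_dir sK) (measurable_mulmxr G)).
Qed.

Let mopp : measurable_fun setT (fun u : 'rV[R]_n => - u).
Proof.
rewrite (_ : (fun _ => _) = fun u => -1 *: u + 0); last first.
  by apply/funext => u; rewrite scaleN1r addr0.
exact: measurable_affine_rV.
Qed.

Lemma measurable_half_density : measurable_fun setT half_density.
Proof.
apply: measurable_funM => //; apply: measurable_funD; apply: measurable_funX.
  exact: measurable_half_radial.
exact: (measurableT_comp measurable_half_radial mopp).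
Qed.

Lemma inhalfN x : inhalf x -> ~~ inhalf (- x).
Proof. by rewrite /inhalf dotpNl mulrN oppr_gt0 -leNgt => /ltW. Qed.

Lemma half_density_half x : S x -> halfspace eps x ->
  half_density x = (2 * k%:R)^-1 * radial K (x *m G) ^+ k.
Proof.
move=> [x1 _] hx; rewrite /half_density /half_radial.
rewrite (_ : inhalf x)// (negbTE (inhalfN hx)) mul1r mul0r expr0n/= addr0.
by rewrite /dir enorm_mulmx// x1 invr1 scale1r.
Qed.

Local Open Scope ereal_scope.

Lemma half_density_bounded : exists2 M : R, (0 <= M)%R &
  forall x, (half_density x <= M)%R.
Proof.
have [M M0 KM] := radial_bounded sK.
have hM x : (half_radial x ^+ k <= M ^+ k)%R.
  rewrite lerXn2r ?nnegrE ?half_radial_ge0//; apply: le_trans (KM (x *m G)).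
  rewrite /half_radial ler_piMl//; last by case: (inhalf x).
  have [->|x0] := eqVneq (dir (x *m G)) 0%R; first by rewrite radial0.
  exact: radial_ge0.
exists ((2 * k%:R)^-1 * (M ^+ k + M ^+ k))%R.
  by rewrite mulr_ge0 ?invr_ge0// addr_ge0// exprn_ge0.
by move=> x; rewrite ler_wpM2l ?invr_ge0// lerD.
Qed.

Lemma pball_lty d : lam d (@pball R d) < +oo.
Proof.
apply: (@le_lt_trans _ _ (lam d (@cube R d 1))).
  apply: le_measure; rewrite ?inE//; [exact: measurable_pball|exact: measurable_cube|].
  by move=> x /andP[_ x1] i; exact: le_trans (ler_norm_enorm x i) x1.
by rewrite lebesgue_rV_cube ?ltry.
Qed.

Lemma integral_bounded_dir_lty d (B : 'M[R]_(d, n)) :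
  d%:R%:E * \int[lam d]_(c in @pball R d) (half_density (dir (c *m B)))%:E < +oo.
Proof.
have [M M0 hM] := half_density_bounded.
have : \int[lam d]_(c in @pball R d) (half_density (dir (c *m B)))%:E < +oo.
  apply: (@le_lt_trans _ _ (\int[lam d]_(c in @pball R d) M%:E)).
    apply: ge0_le_integral => //; first exact: measurable_pball.
    - by move=> c _; rewrite lee_fin half_density_ge0.
    - apply/measurable_funTS/measurable_EFinP.
      exact: (measurableT_comp measurable_half_density (measurable_dir_mulmx B)).
    - by move=> c _; rewrite lee_fin.
  rewrite integral_cst; last exact: measurable_pball.
  by rewrite lte_mul_pinfty// pball_lty.
have : 0 <= \int[lam d]_(c in @pball R d) (half_density (dir (c *m B)))%:E.
  by apply: integral_ge0 => c _; rewrite lee_fin half_density_ge0.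
by move=> I0 Ioo; rewrite lte_mul_pinfty// lee_fin.
Qed.

Lemma integral_half_density_lty :
  \int[surface E]_(x in S) (half_density x)%:E < +oo.
Proof.
rewrite (ge0_integral_sphere (Rk1_frameP p.+1 m0)); last 2 first.
- by apply/measurable_funTS/measurable_EFinP; exact: measurable_half_density.
- by move=> x _; rewrite lee_fin half_density_ge0.
exact: integral_bounded_dir_lty.
Qed.

Lemma funk_half_density_lty w : S w -> funk E half_density w < +oo.
Proof.
move=> [w1 wE]; have [W WE] := orthonormal_basis_exists (rank_cap_orthc rE wE w1).
rewrite (ge0_funk WE); first exact: integral_bounded_dir_lty.
  by apply: measurable_funTS; exact: measurable_half_density.
by move=> x _; exact: half_density_ge0.
Qed.

(** In an orthonormal basis [W] of the hyperplane the two summands of the density have equal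
    integrals, by [y -> - y]. Each is the measure of a radial set by [lebesgue_rV_radial], and the
    isometry [W *m G] carries that set onto the half section. *)
Lemma funk_half_density w : S w -> funk E half_density w = vfun gamma K eps v w.
Proof.
move=> [w1 wE]; have [W WE] := orthonormal_basis_exists (rank_cap_orthc rE wE w1).
have [WW /eqmxP WE'] := WE.
rewrite (ge0_funk WE); last 2 first.
- by apply: measurable_funTS; exact: measurable_half_density.
- by move=> x _; exact: half_density_ge0.
pose r y := half_radial (y *m W).
have mr : measurable_fun setT r.
  exact: (measurableT_comp measurable_half_radial (measurable_mulmxr W)).
have r0 y : (0 <= r y)%R by exact: half_radial_ge0.
have rZ t y : (0 < t)%R -> r (t *: y)%R = r y.
  by move=> t0; rewrite /r -scalemxAl half_radialZ.
have mrk : measurable_fun setT (fun y => (r y ^+ k)%:E).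
  by apply/measurable_EFinP; exact: measurable_funX.
have mB := @measurable_pball R p.+1.
have oppI : \int[lam k]_(y in @pball R k) (r (- y)%R ^+ k)%:E =
    \int[lam k]_(y in @pball R k) (r y ^+ k)%:E.
  rewrite !(integral_mkcond (@pball R k)).
  have mb : measurable_fun setT ((fun y => (r y ^+ k)%:E) \_ (@pball R k)).
    by apply/(measurable_restrictT _ mB)/measurable_funTS.
  have b0 y : 0 <= ((fun y => (r y ^+ k)%:E) \_ (@pball R k)) y.
    by apply: erestrict_ge0 => z _; rewrite lee_fin exprn_ge0.
  have N10 : (-1 != 0 :> R)%R by rewrite oppr_eq0 oner_neq0.
  apply/esym; apply: etrans (ge0_integral_rV_affine 0%R N10 mb b0) _.
  rewrite normrN1 expr1n mul1e; apply: eq_integral => y _.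
  rewrite !patchE addr0 scaleN1r; congr (if _ then _ else _).
  by apply/idP/idP => /set_mem yB; apply/mem_set; move: yB; rewrite /pball/= enormN.
have moppk : measurable_fun setT (fun u : 'rV[R]_k => - u)%R.
  rewrite (_ : (fun _ => _) = fun u => (-1 *: u + 0)%R); last first.
    by apply/funext => u; rewrite scaleN1r addr0.
  exact: measurable_affine_rV.
have -> : \int[lam k]_(y in @pball R k) (half_density (dir (y *m W)))%:E =
    ((2 * k%:R)^-1)%:E * (\int[lam k]_(y in @pball R k) (r y ^+ k)%:E +
      \int[lam k]_(y in @pball R k) (r (- y)%R ^+ k)%:E).
  have mro : measurable_fun (@pball R k) (fun y => (r (- y)%R ^+ k)%:E).
    by apply: measurable_funTS; exact: (measurableT_comp mrk moppk).
  have mrp : measurable_fun (@pball R k) (fun y => (r y ^+ k)%:E).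
    exact: measurable_funTS.
  have pp y : @pball R k y -> 0 <= (r y ^+ k)%:E by rewrite lee_fin exprn_ge0.
  have po y : @pball R k y -> 0 <= (r (- y)%R ^+ k)%:E by rewrite lee_fin exprn_ge0.
  have mrs := emeasurable_funD mrp mro.
  have ps y : @pball R k y -> 0 <= (r y ^+ k)%:E + (r (- y)%R ^+ k)%:E.
    by move=> yB; apply: adde_ge0; [exact: pp|exact: po].
  have c0 : (0 <= (2 * k%:R)^-1 :> R)%R by rewrite invr_ge0.
  apply: etrans (congr1 (fun e => _ * e) (ge0_integralD (lam k) mB pp mrp po mro)).
  apply: etrans (ge0_integralZl_EFin (lam k) mB ps mrs c0).
  apply: eq_integral => y /set_mem/andP[y0 _]; rewrite -EFinD -EFinM; congr EFin.
  have i0 : (0 < (enorm (y *m W))^-1)%R by rewrite invr_gt0 enorm_mulmx.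
  have e1 := half_radialZ (y *m W) i0.
  have e2 : half_radial (- dir (y *m W)) = half_radial (- y *m W).
    by rewrite /dir -scalerN -mulNmx; exact: half_radialZ.
  by rewrite /half_density e2 e1.
rewrite oppI -(lebesgue_rV_radial mr r0 rZ).
rewrite /vfun /half_section.
have WGE : orthonormal_basis ((orthc w :&: E)%MS *m G) (W *m G).
  split.
    by rewrite trmx_mul mulmxA -(mulmxA W) oG mulmx1.
  by apply/eqmxP; apply: eqmxMr; rewrite capmxC.
rewrite (vol_orthonormal_basis WGE); last first.
  apply: measurableI; first exact: star_body_measurable.
  apply: measurableI; first exact: measurable_rowset.
  by have := @measurable_inhalf measurableT [set true] I; rewrite setTI.
have inhalfG y : inhalf (y *m W *m G) = inhalf (y *m W).
  by rewrite /inhalf dotp_tgamma.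
have enG y : enorm (y *m W *m G) = enorm y by rewrite !enorm_mulmx.
(* The open half-space excludes the origin, which matches [0 < enorm y]. Conversely [r y = 0]
   outside the half-space, so no [y] there satisfies [0 < enorm y <= r y]. *)
rewrite (_ : (fun c => _) @^-1` _ = [set y | 0 < enorm y <= r y]%R); last first.
  apply/seteqP; split=> y /=; rewrite mulmxA.
    move=> [Ky [_ hy]]; have hy' : inhalf (y *m W) by rewrite -inhalfG.
    have y0 : y *m W *m G != 0%R.
      apply: contraTneq hy' => y0.
      by rewrite -inhalfG y0 /inhalf -(scale0r (0 : 'rV[R]_n)) dotpZl mul0r mulr0 ltxx.
    rewrite -enG enorm_gt0 y0 /r /half_radial hy' mul1r.
    exact/(star_body_dirP sK y0).
  move=> /andP[ey yr]; have y0 : y *m W *m G != 0%R by rewrite -enorm_gt0 enG.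
  have hy : inhalf (y *m W).
    apply: contraTT ey => hy; rewrite -leNgt; apply: le_trans yr _.
    by rewrite /r /half_radial (negbTE hy) mul0r.
  split.
    apply/(star_body_dirP sK y0); rewrite enG; apply: le_trans yr _.
    by rewrite /r /half_radial hy mul1r.
  split; last by rewrite /halfspace/=; move: hy; rewrite -inhalfG.
  by rewrite /rowset/= -mulmxA; have [_ /eqmxP <-] := WGE; exact: submxMl.
apply: mule_half_double; exact: measure_ge0.
Qed.

End section_function.

(** * Comparison of an arbitrary inverse with the half density *)

Section inversion.
Context {R : realType} (m p : nat) (gamma : 'rV[R]_m -> 'M[R]_m).
Context (K : set 'rV[R]_(m + p.+1)) (eps : bool) (v : 'rV[R]_m).
Hypotheses (m0 : (0 < m)%N) (rg : rotation_family gamma) (sK : star_body K).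
Hypothesis sv : sphere v.
Local Notation k := p.+1.
Local Notation n := (m + p.+1)%N.
Local Notation E := (@Rk1 R m p.+1).
Local Notation S := (sphere `&` rowset E).
Local Notation G := (tgamma k gamma v).
Local Notation g0 := (half_density gamma K eps v).

Let oG : orthogonal_mx G. Proof. exact: tgamma_orthogonal. Qed.
Let rE : \rank E = p.+2. Proof. exact: rank_Rk1. Qed.
Let BE := @Rk1_frameP R m p.+1 m0.
Let mg0 : measurable_fun setT g0. Proof. exact: measurable_half_density. Qed.
Let g00 x : 0 <= g0 x. Proof. exact: half_density_ge0. Qed.

Lemma funk_inverse_half_density :
  funk_inverse E (vfun gamma K eps v) g0.
Proof.
exists g0; split.
- by move=> eta _; exact: half_densityN.
- apply/integrableP; split.
    by apply/measurable_funTS/measurable_EFinP.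
  have := @integral_half_density_lty R m p gamma K eps v m0 sK; apply: le_lt_trans.
  rewrite le_eqVlt; apply/orP; left; apply/eqP/eq_integral => x _.
  by rewrite /= ger0_norm.
- by apply: (ae_surface_sphere BE) => w Sw; exact: funk_half_density.
- exact: (ae_surface_sphere BE).
Qed.

(** On the open half the antipodal summand vanishes, which leaves a multiple of rho_K^k composed
    with an isometry. *)
Lemma half_density_continuous :
  {within Sk m k `&` halfspace eps, continuous g0}.
Proof.
have [_ _ _ cK] := sK.
pose A : set 'rV[R]_n := Sk m k `&` halfspace eps.
have cKG : {within A, continuous (fun x => radial K (x *m G))}.
  apply/within_continuous_enormP => x [[x1 _] _] e e0.
  have sxG (y : 'rV[R]_n) : sphere y -> sphere (y *m G).
    by rewrite /sphere/= enorm_mulmx.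
  move/within_continuous_enormP : cK => /(_ _ (sxG x x1) e e0)[d d0 dP].
  exists d => // y [[y1 _] _] xy; apply: dP; first exact: sxG.
  by rewrite -mulmxBl enorm_mulmx.
apply/subspace_continuousP => x Ax.
have /subspace_continuousP/(_ x Ax) cx := cKG.
have : (2 * k%:R)^-1 * radial K (y *m G) ^+ k @[y --> within A (nbhs x)] -->
    (2 * k%:R)^-1 * radial K (x *m G) ^+ k.
  apply: cvgM; first exact: cvg_cst.
  exact: (cvg_comp _ _ cx (@exprn_continuous R k _)).
have Ag y : A y -> g0 y = (2 * k%:R)^-1 * radial K (y *m G) ^+ k.
  by move=> [Sy hy]; exact: half_density_half.
rewrite /from_subspace/= (Ag x Ax); apply: cvg_trans.
apply: near_eq_cvg; near=> y; rewrite Ag//; near: y; exact: withinT.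
Unshelve. all: by end_near.
Qed.

(** For unit vectors [|z - x|^2 = 2 - 2 x . z <= d^2 / 2 < d^2]. *)
Lemma cap_near (x z : 'rV[R]_n) (d : R) : 0 < d -> enorm x = 1 -> enorm z = 1 ->
  1 - d ^+ 2 / 4 <= dotp x z -> enorm (z - x) < d.
Proof.
move=> d0 x1 z1 h; rewrite -(ltr_pXn2r (n := 2))// ?nnegrE ?enorm_ge0 ?(ltW d0)//.
rewrite addrC sqr_enormD enormN x1 z1 dotpNl.
have d20 : 0 < d ^+ 2 by rewrite exprn_gt0.
by rewrite !expr1n; lra.
Qed.


Lemma rcol0 (z : 'rV[R]_n) (B : 'M[R]_(p.+1, n)) :
  row 0 (col_mx z B : 'M[R]_(1 + p.+1, n)) = z.
Proof.
apply/rowP => j; transitivity (col_mx z B (lshift p.+1 0) j).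
  by rewrite mxE; congr (fun_of_matrix _ _ _); exact: val_inj.
by rewrite col_mxEu.
Qed.

Local Open Scope ereal_scope.

Lemma funk_no_strict_near (eta : 'rV[R]_n) (d : R) (f1 f2 : 'rV[R]_n -> R) :
  S eta -> (0 < d)%R -> measurable_fun setT f1 -> measurable_fun setT f2 ->
  (forall x, 0 <= f1 x)%R -> (forall x, 0 <= f2 x)%R ->
  \int[surface E]_(x in S) (f1 x)%:E < +oo ->
  \int[surface E]_(x in S) (f2 x)%:E < +oo ->
  {ae surface E, forall w, funk E f1 w = funk E f2 w /\ funk E f2 w < +oo} ->
  {ae surface E, forall x, S x ->
     (enorm (eta - x) < d)%R \/ (enorm (eta + x) < d)%R -> (f2 x < f1 x)%R} -> False.
Proof.
move=> [eta1 etaE] d0 mf1 mf2 f10 f20 f1oo f2oo f12 h.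
have [B' BE'] := orthonormal_basis_extend rE etaE eta1.
(* The truncation at 1 keeps the cosine [1 - d'^2 / 4] in [[0, 1)]. *)
pose d' := Num.min d 1%R; have d'0 : (0 < d')%R by rewrite lt_min d0 ltr01.
have d'1 : (d' ^+ 2 <= 1)%R by rewrite exprn_ile1 ?(ltW d'0)// ge_min lexx orbT.
have d'20 : (0 < d' ^+ 2)%R by rewrite exprn_gt0.
have a01 : (0 <= 1 - d' ^+ 2 / 4 < 1)%R by apply/andP; split; lra.
apply: (funk_no_strict_cap BE' mf1 mf2 f10 f20 f1oo f2oo f12 a01).
have := h; apply: filterS => x hx Sx; rewrite rcol0 => cap.
have x1 : enorm x = 1%R by case: Sx.
have d'd : (d' <= d)%R by rewrite ge_min lexx.
apply: hx => //; move: cap; rewrite ler_normr => /orP[cap|cap].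
  by left; apply: lt_le_trans d'd; exact: cap_near.
right; apply: lt_le_trans d'd; rewrite -[x in (_ + x)%R]opprK; apply: cap_near => //.
  by rewrite enormN.
by rewrite dotpNl.
Qed.

Section comparison.
Variable g : 'rV[R]_n -> R.
Hypothesis ig : (surface E).-integrable S (EFin \o g).
Hypothesis fg : {ae surface E, forall w, funk E g w = vfun gamma K eps v w}.

(** [g] is measurable on [S] only; its extension by 0 is measurable everywhere. [P] and [N] are its
    positive and negative parts, and comparing [P] with [Q] amounts to comparing [g] with [g0]
    without a signed function. *)
Let gS (x : 'rV[R]_n) : R := fine (((EFin \o g) \_ S) x).
Let P (x : 'rV[R]_n) : R := Num.max (gS x) 0%R.
Let N (x : 'rV[R]_n) : R := Num.max (- gS x)%R 0%R.
Let Q (x : 'rV[R]_n) : R := (N x + g0 x)%R.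

Let mS : measurable S. Proof. exact: measurable_sphere_rowset. Qed.

Let gSE x : S x -> gS x = g x.
Proof. by move=> Sx; rewrite /gS patchE mem_set. Qed.

Let mgS : measurable_fun setT gS.
Proof.
have mg := measurable_int _ ig.
apply: (measurableT_comp (@fine_measurable R setT measurableT)).
exact/(measurable_restrictT _ mS).
Qed.

Let mP : measurable_fun setT P.
Proof. exact: measurable_maxr. Qed.

Let mN : measurable_fun setT N.
Proof. by apply: measurable_maxr => //; exact: measurable_funN. Qed.

Let P0 x : (0 <= P x)%R. Proof. by rewrite le_max lexx orbT. Qed.
Let N0 x : (0 <= N x)%R. Proof. by rewrite le_max lexx orbT. Qed.

Let Ple x : S x -> (P x <= `|g x|)%R.
Proof. by move=> Sx; rewrite /P gSE// ge_max ler_norm normr_ge0. Qed.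
Let Nle x : S x -> (N x <= `|g x|)%R.
Proof. by move=> Sx; rewrite /N gSE// ge_max -normrN ler_norm normr_ge0. Qed.

Let igoo : \int[surface E]_(x in S) `|(g x)%:E| < +oo.
Proof. by case/integrableP: ig. Qed.

Let le_goo (f : 'rV[R]_n -> R) : measurable_fun setT f -> (forall x, 0 <= f x)%R ->
  (forall x, S x -> f x <= `|g x|)%R -> \int[surface E]_(x in S) (f x)%:E < +oo.
Proof.
move=> mf f0 fle; apply: le_lt_trans igoo; apply: ge0_le_integral => //.
- by move=> x _; rewrite lee_fin.
- by apply/measurable_funTS/measurable_EFinP.
- exact: (measurableT_comp (@abse_measurable R setT) (measurable_int _ ig)).
Qed.

Let Qoo : \int[surface E]_(x in S) (Q x)%:E < +oo.
Proof.
have -> : \int[surface E]_(x in S) (Q x)%:E =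
    \int[surface E]_(x in S) ((N x)%:E + (g0 x)%:E) by [].
have mNE : measurable_fun S (fun x => (N x)%:E).
  by apply/measurable_funTS/measurable_EFinP.
have mgE : measurable_fun S (fun x => (g0 x)%:E).
  by apply/measurable_funTS/measurable_EFinP.
rewrite (ge0_integralD _ mS (fun x _ => N0 x : 0 <= (N x)%:E) mNE
  (fun x _ => g00 x : 0 <= (g0 x)%:E) mgE).
by rewrite lte_add_pinfty//; [exact: le_goo|exact: integral_half_density_lty].
Qed.

Let mQ : measurable_fun setT Q. Proof. exact: measurable_funD. Qed.
Let Q0 x : (0 <= Q x)%R. Proof. exact: addr_ge0. Qed.
Let Poo : \int[surface E]_(x in S) (P x)%:E < +oo. Proof. exact: le_goo. Qed.

Let funk_split w : funk E g w = funk E P w - funk E N w.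
Proof.
rewrite /funk integralE; congr (_ - _); apply: eq_integral => x /set_mem[Sx _].
  by rewrite /P gSE// funeposE -EFin_max.
by rewrite /N gSE// funenegE -EFin_max.
Qed.

Let funkQ w : funk E Q w = funk E N w + funk E g0 w.
Proof.
rewrite /funk sphere_rowset_cap; have mS' := measurable_sphere_rowset (E :&: orthc w)%MS.
set D := sphere `&` _.
have mNE : measurable_fun D (fun x => (N x)%:E).
  by apply/measurable_funTS/measurable_EFinP.
have mgE : measurable_fun D (fun x => (g0 x)%:E).
  by apply/measurable_funTS/measurable_EFinP.
by rewrite -(ge0_integralD _ mS' (fun x _ => N0 x : 0 <= (N x)%:E) mNE
  (fun x _ => g00 x : 0 <= (g0 x)%:E) mgE).
Qed.

Let funk_ge0 (f : 'rV[R]_n -> R) w : (forall x, 0 <= f x)%R -> 0 <= funk E f w.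
Proof. by move=> f0; apply: integral_ge0 => x _; rewrite lee_fin. Qed.

Let funkPQ : {ae surface E, forall w, funk E P w = funk E Q w /\ funk E Q w < +oo}.
Proof.
have aS : {ae surface E, forall w, S w} by exact: (ae_surface_sphere BE).
near=> w; have Sw : S w by near: w.
have : funk E g w = vfun gamma K eps v w by near: w.
rewrite -(funk_half_density eps m0 rg sK sv Sw) funk_split funkQ.
have := funk_half_density_lty gamma eps v m0 sK Sw.
have := funk_ge0 w g00; have := funk_ge0 w P0; have := funk_ge0 w N0.
(* The difference of the two parts equals the finite number [funk E g0 w]. This forces both parts to
   be finite: [+oo - +oo] is [-oo] by convention, so it is excluded as well. *)
case: (funk E P w) => [a| |]//; case: (funk E N w) => [b| |]//;
  case: (funk E g0 w) => [c| |]//=.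
move=> _ _ _ _ [<-]; rewrite -EFinD ltry; split=> //; congr EFin; lra.
Unshelve. all: by end_near.
Qed.

Let funkQP : {ae surface E, forall w, funk E Q w = funk E P w /\ funk E P w < +oo}.
Proof. by apply: filterS funkPQ => w [-> ->]. Qed.

Let PQ_lt x : S x -> (Q x < P x)%R = (g0 x < g x)%R /\ (P x < Q x)%R = (g x < g0 x)%R.
Proof.
move=> Sx; have gE : g x = (P x - N x)%R.
  by rewrite /P /N gSE// /Num.max; case: ifP => c1; case: ifP => c2; lra.
by rewrite /Q gE; split; [rewrite ltrBrDl|rewrite ltrBlDl].
Qed.

(** If the values at [eta] differed, continuity would give [g - g0] a fixed sign almost everywhere
    near [eta]. Near [- eta] the same sign follows from [g x = g (- x) = h (- x)] and evenness of
    [g0], and [funk_no_strict_near] excludes either sign. *)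
Lemma funk_inverse_agree (h : 'rV[R]_n -> R) (eta : 'rV[R]_n) :
  (forall x, S x -> g (- x)%R = g x) ->
  {ae surface E, forall x, h x = g x} ->
  {within Sk m k `&` halfspace eps, continuous h} ->
  (Sk m k `&` halfspace eps) eta -> h eta = g0 eta.
Proof.
move=> geven hg ch [Seta heta].
have cg := half_density_continuous.
have hgo := ae_surface_opp BE hg.
have SN x : S x -> S (- x)%R.
  by rewrite /rowset/= /sphere/= => -[x1 xE]; rewrite enormN x1 eqmx_opp.
(* Distance from [eta] to the hyperplane orthogonal to e_n: closer points lie in the same open
   half-space. *)
pose d0 : R := ((-1) ^+ eps * dotp eta (evec n n))%R.
have d00 : (0 < d0)%R by [].
have half_near x : (enorm (eta - x) < d0)%R -> halfspace eps x.
  move=> ex; rewrite /halfspace/=.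
  have nn : ((m + k).-1 < m + k)%N by rewrite prednK// addn_gt0 m0.
  have jnE : (Ordinal nn).+1 = (m + k)%N by rewrite /= prednK// addn_gt0 m0.
  have := ler_norm_enorm (eta - x)%R (Ordinal nn); rewrite -(dotp_evec _ jnE) => h1.
  have : (`|(-1) ^+ eps * dotp (eta - x) (evec n n)| < d0)%R.
    by rewrite normrM normrX normrN1 expr1n mul1r; exact: le_lt_trans h1 ex.
  move=> /(le_lt_trans (ler_norm _)).
  by rewrite dotpDl dotpNl mulrDr mulrN /d0; lra.
apply/eqP; apply: contraT => neq; exfalso.
(* Half the gap, so that values within [e] of [h eta] and of [g0 eta] remain strictly ordered. *)
pose e := (`|h eta - g0 eta| / 2)%R.
have e0 : (0 < e)%R by rewrite divr_gt0// normr_gt0 subr_eq0.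
move/within_continuous_enormP : ch => /(_ _ (conj Seta heta) _ e0)[d1 d10 H1].
move/within_continuous_enormP : cg => /(_ _ (conj Seta heta) _ e0)[d2 d20 H2].
pose d := Num.min d0 (Num.min d1 d2).
have dp : (0 < d)%R by rewrite !lt_min d00 d10 d20.
have both x : S x -> (enorm (eta - x) < d)%R ->
    (`|h eta - h x| < e /\ `|g0 eta - g0 x| < e)%R.
  rewrite !lt_min => Sx /andP[xd0 /andP[xd1 xd2]].
  have Ax : (Sk m k `&` halfspace eps) x by split=> //; exact: half_near.
  by split; [exact: H1|exact: H2].
have aboth : {ae surface E, forall x, S x ->
    (enorm (eta - x) < d)%R \/ (enorm (eta + x) < d)%R ->
    (`|h eta - g x| < e /\ `|g0 eta - g0 x| < e)%R}.
  near=> x => Sx.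
  have hx : h x = g x by near: x.
  have hox : h (- x)%R = g (- x)%R by near: x.
  move=> [near|near]; first by rewrite -hx; exact: both.
  by rewrite -geven// -hox -(half_densityN gamma K eps v x); apply: both;
    [exact: SN|rewrite opprK].
have [lt|gt|eq] := ltgtP (h eta) (g0 eta); last by rewrite eq eqxx in neq.
- have eE : e = ((g0 eta - h eta) / 2)%R.
    by rewrite /e ltr0_norm ?subr_lt0// opprB.
  apply: (funk_no_strict_near Seta dp mQ mP Q0 P0 Qoo Poo funkQP).
  apply: filterS aboth => x hx Sx /(hx Sx)[].
  rewrite (PQ_lt Sx).2 eE !ltr_norml => /andP[? ?] /andP[? ?]; lra.
- have eE : e = ((h eta - g0 eta) / 2)%R by rewrite /e gtr0_norm ?subr_gt0.
  apply: (funk_no_strict_near Seta dp mP mQ P0 Q0 Poo Qoo funkPQ).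
  apply: filterS aboth => x hx Sx /(hx Sx)[].
  rewrite (PQ_lt Sx).1 eE !ltr_norml => /andP[? ?] /andP[? ?]; lra.
Unshelve. all: by end_near.
Qed.

End comparison.
End inversion.

(** * Recovery of the radial function *)

Section recovery.
Context {R : realType} (m p : nat) (gamma : 'rV[R]_m -> 'M[R]_m).
Hypotheses (m0 : (0 < m)%N) (rg : rotation_family gamma).
Local Notation k := p.+1.
Local Notation n := (m + p.+1)%N.
Local Notation E := (@Rk1 R m p.+1).

Lemma radial_of_funk_inverse (K : set 'rV[R]_n) eps v h (eta : 'rV[R]_n) :
  star_body K -> sphere v -> funk_inverse E (vfun gamma K eps v) h ->
  {within Sk m k `&` halfspace eps, continuous h} ->
  (Sk m k `&` halfspace eps) eta ->
  radial K (eta *m tgamma k gamma v) ^+ k = 2 * k%:R * h eta.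
Proof.
move=> sK sv [g [geven ig fg hg]] ch Aeta.
rewrite (funk_inverse_agree m0 rg sK sv ig fg geven hg ch Aeta).
have [Seta heta] := Aeta; rewrite (half_density_half K rg sv Seta heta).
by rewrite mulrA mulfV ?mul1r// mulf_neq0.
Qed.

(** When [xi] is orthogonal to e_n both open half sections are empty, so agreement on the remaining
    subspaces gives agreement at every [w], the poles included. *)
Lemma vfun_eq (K K' : set 'rV[R]_n) eps v w :
  sphere v -> (sphere `&` rowset E) w ->
  (forall xi, frakM gamma xi -> ~~ (xi <= orthc (evec n n))%MS ->
     forall eps, half_section K' eps xi = half_section K eps xi) ->
  vfun gamma K' eps v w = vfun gamma K eps v w.
Proof.
move=> sv [w1 wE] KK'; rewrite /vfun; set xi := (_ *m _).
have [xin|xin] := boolP (xi <= orthc (evec n n))%MS; last first.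
  apply: KK' => //; exists v; split=> //; first exact: submxMr (capmxSr _ _).
  rewrite mxrankMfree; last first.
    by rewrite row_free_unit; have [] := mulmx1_unit (tgamma_orthogonal k rg sv).
  by rewrite capmxC; apply: rank_cap_orthc => //; exact: rank_Rk1.
have e0 : rowset xi `&` halfspace eps = set0 :> set 'rV[R]_n.
  apply/seteqP; split=> // x [xxi]; rewrite /halfspace/=.
  have := submx_trans xxi xin; rewrite sub_orthcE => /eqP ->.
  by rewrite mulr0 ltxx.
by rewrite /half_section e0 !setI0 !measure0.
Qed.

End recovery.

Theorem mainTheorem3 (R : realType) (m k : nat)
    (gamma : 'rV[R]_m -> 'M[R]_m) (K : set 'rV[R]_(m + k)) :
  (2 <= k)%N -> (k < (m + k).-1)%N ->
  rotation_family gamma ->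
  star_body K ->
  [/\
   (* rho_K is determined by v^+, v^- on the members of M not orthogonal to e_n *)
   forall K' : set 'rV[R]_(m + k), star_body K' ->
     (forall xi, frakM gamma xi ->
        ~~ (xi <= orthc (evec (m + k) (m + k)))%MS ->
        forall eps, half_section K' eps xi = half_section K eps xi) ->
     forall theta, sphere theta -> radial K' theta = radial K theta,
   (* the inversion formula; eps = false is +, eps = true is - *)
   forall v, sphere v -> forall eps,
     (exists2 h, funk_inverse (Rk1 m k) (vfun gamma K eps v) h &
        {within Sk m k `&` halfspace eps, continuous h}) /\
     (forall h, funk_inverse (Rk1 m k) (vfun gamma K eps v) h ->
        {within Sk m k `&` halfspace eps, continuous h} ->
        forall eta, (Sk m k `&` halfspace eps) eta ->
          radial K (eta *m tgamma k gamma v) ^+ k = 2 * k%:R * h eta),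
   (* every theta with theta' != 0 is of the form tgamma_v eta *)
   forall theta : 'rV[R]_(m + k), sphere theta -> lsubmx theta != 0 ->
     let v := (enorm (lsubmx theta))^-1 *: lsubmx theta in
     let eta := row_mx (enorm (lsubmx theta) *: evec m m) (rsubmx theta) in
     [/\ sphere v, Sk m k eta & theta = eta *m tgamma k gamma v] &
   (* the values at theta' = 0 or theta_n = 0 are determined by continuity *)
   forall f : 'rV[R]_(m + k) -> R, {within sphere, continuous f} ->
     (forall theta, sphere theta -> lsubmx theta != 0 ->
        dotp theta (evec (m + k) (m + k)) != 0 -> f theta = radial K theta) ->
     forall theta, sphere theta -> f theta = radial K theta].
Proof.
case: k K => [//|p] K _ mk rg sK.
have m1 : (1 < m)%N by move: mk; rewrite addnS/= -[p.+2]/(2 + p)%N leq_add2r.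
have m0 : (0 < m)%N by exact: ltnW.
have [_ _ _ cK] := sK; split.
- move=> K' sK' KK'; have [_ _ _ cK'] := sK'.
  apply: eq_sphere_by_continuity => // theta sth th0 thn.
  have [sv Seta tE] := tgamma_decomposition m0 rg (ltn0Sn p) sth th0.
  set v := _ *: lsubmx theta in sv tE; set eta := row_mx _ _ in Seta tE.
  pose eps := dotp theta (evec (m + p.+1) (m + p.+1)) < 0.
  have heta : halfspace eps eta.
    rewrite /halfspace/= -(dotp_tgamma rg eta (ltn0Sn p) sv) -tE /eps.
    case: (ltgtP (dotp theta (evec (m + p.+1) (m + p.+1))) 0) thn => //= h _.
      by rewrite expr1 mulN1r oppr_gt0.
    by rewrite expr0 mul1r.
  have ch := half_density_continuous (eps := eps) rg sK sv.
  have r1 := radial_of_funk_inverse m0 rg sK sv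
    (funk_inverse_half_density eps m0 rg sK sv) ch (conj Seta heta).
  (* The density built from [K] also inverts the data of [K'], so the k-th powers of both radial
     functions at [theta] are read off the same number. *)
  have fi : funk_inverse (Rk1 m p.+1) (vfun gamma K' eps v) (half_density gamma K eps v).
    have [g [geven ig fg hg]] := funk_inverse_half_density eps m0 rg sK sv.
    exists g; split=> //.
    have aS : {ae surface (@Rk1 R m p.+1), forall w, (sphere `&` rowset (Rk1 m p.+1)) w}.
      exact: (ae_surface_sphere (Rk1_frameP p.+1 m0)).
    near=> w; rewrite (@vfun_eq R m p gamma m0 rg K K')//; near: w => //.
  have := radial_of_funk_inverse m0 rg sK' sv fi ch (conj Seta heta).
  have te : enorm theta = 1 by exact: sth.
  have tn0 : theta != 0 by rewrite -enorm_eq0 te oner_eq0.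
  by rewrite -r1 -tE => /eqP; rewrite eqrXn2 ?radial_ge0// => /eqP.
- move=> v sv eps; split; last first.
    move=> h fi ch eta Aeta.
    exact: (radial_of_funk_inverse m0 rg sK sv fi ch Aeta).
  exists (half_density gamma K eps v); first exact: funk_inverse_half_density.
  exact: half_density_continuous.
- by move=> theta; exact: tgamma_decomposition.
- by move=> f cf fK; exact: eq_sphere_by_continuity.
Unshelve. all: by end_near.
Qed.
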